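(* Let $F|K$ be an algebraic function field. The rational discrete places of $F|K$ lie dense, with respect to the patch topology, in the space of all rational places of $F|K$ which admit smooth local uniformization; and likewise the rational places of maximal rank of $F|K$ lie dense in that space.
   Context: An algebraic function field $F|K$ is a finitely generated field extension of transcendence degree at least $1$; the characteristic is arbitrary. $S(F|K)$ is the set of all places $P$ of $F$ whose restriction to $K$ is the identity, up to equivalence. $\mathcal O_P$ is the valuation ring of $P$, $\mathcal M_P$ its maximal ideal, $FP$ its residue field, $v_PF$ its value group. A place $P\in S(F|K)$ is rational if $FP=K$, discrete if $v_PF\cong\mathbb Z$, and of maximal rank if the rank of $v_PF$ (the number of its proper convex subgroups) equals $\operatorname{trdeg}F|K$. A place $P$ of $F|K$ admits smooth local uniformization if there is a model of $F|K$ (a $K$-variety with function field $F$) on which $P$ is centered at a smooth point, and in addition, whenever finitely many elements $a_1,\ldots,a_m\in\mathcal O_P$ are given, the (affine) model can be chosen such that $a_1,\ldots,a_m$ are included in its coordinate ring. The patch topology on $S(F|K)$ has as basic open sets the sets $\{P\in S(F|K)\mid a_1,\ldots,a_k\in\mathcal O_P;\ b_1,\ldots,b_\ell\in\mathcal M_P\}$ with $k,\ell\ge0$ and $a_i,b_j\in F$; subsets carry the subspace topology. *)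

(* Defs.v *)
From HB Require Import structures.
From mathcomp Require Import -(notations) mpoly.
From mathcomp Require Import all_boot all_order all_algebra.
From mathcomp Require Import all_classical all_analysis.

Set Implicit Arguments.
Unset Strict Implicit.
Unset Printing Implicit Defensive.

Import Order.TTheory GRing.Theory Num.Theory.
Local Open Scope classical_set_scope.
Local Open Scope quotient_scope.
Local Open Scope ring_scope.

(* A field extension F|K is given by its embedding iota : K -> F.  For
   p in K[X_1, .., X_n] and y in F^n, [mmap iota y p] is p(y). *)

Section FunctionFields.
Variables (K F : fieldType) (iota : {rmorphism K -> F}).

Definition generates (m : nat) (y : 'I_m -> F) : Prop :=
  forall z : F, exists p q : mpoly m K,
    mmap iota y q != 0 /\ z = mmap iota y p / mmap iota y q.

Definition alg_independent (n : nat) (x : 'I_n -> F) : Prop :=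
  forall p : mpoly n K, mmap iota x p = 0 -> p = 0.

Definition has_trdeg (n : nat) : Prop :=
  (exists x : 'I_n -> F, alg_independent x) /\
  (forall (m : nat) (x : 'I_m -> F), alg_independent x -> (m <= n)%N).

Definition function_field : Prop :=
  (exists (m : nat) (y : 'I_m -> F), generates y) /\
  (exists2 n, (0 < n)%N & has_trdeg n).

(* [None] is the value oo.  Surjectivity makes [residue_field] equal to FP; the
   restriction of a place to K being the identity means that K embeds in FP and
   that the place sends c in K to c. *)
Record place := Place {
  residue_field : fieldType;
  place_fun :> F -> option residue_field;
  residue_emb : {rmorphism K -> residue_field};
  place1 : place_fun 1 = Some 1;
  placeD : forall a b u v,
    place_fun a = Some u -> place_fun b = Some v -> place_fun (a + b) = Some (u + v);
  placeM : forall a b u v,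
    place_fun a = Some u -> place_fun b = Some v -> place_fun (a * b) = Some (u * v);
  placeV : forall a, place_fun a = None -> place_fun a^-1 = Some 0;
  place_surj : forall u, exists a, place_fun a = Some u;
  place_emb : forall c, place_fun (iota c) = Some (residue_emb c) }.

Definition place_ring (P : place) : set F := [set a | P a <> None].
Definition place_ideal (P : place) : set F := [set a | P a = Some 0].

Section PlaceTheory.
Variable P : place.

Lemma place_ringP a : reflect (place_ring P a) (P a != None).
Proof. by apply: (iffP idP) => [/eqP|/eqP]. Qed.

Lemma place_ring1 : place_ring P 1.
Proof. by rewrite /place_ring /= place1. Qed.

Lemma place_ringM a b : place_ring P a -> place_ring P b -> place_ring P (a * b).
Proof.
rewrite /place_ring /=; case Ea: (P a) => [u|//] _; case Eb: (P b) => [v|//] _.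
by rewrite (placeM Ea Eb).
Qed.

Lemma place_ring_total a : place_ring P a \/ place_ring P a^-1.
Proof.
rewrite /place_ring /=; case Ea: (P a) => [u|]; first by left.
by right; rewrite (placeV Ea).
Qed.

Lemma place0 : P 0 = Some 0.
Proof.
case E: (P 0) => [w|]; last by rewrite -E -{1}invr0 (placeV E).
by have := placeD E E; rewrite addr0 E => -[] /esym/eqP; rewrite addrC -subr_eq0
  addrK => /eqP ->.
Qed.

Lemma place_idealE : place_ideal P =
  [set b | b = 0 \/ ~ place_ring P b^-1].
Proof.
rewrite eqEsubset; split=> b; rewrite /place_ideal /place_ring /=.
  move=> Pb; have [->|b0] := eqVneq b 0; [by left | right => h].
  case Eb: (P b^-1) h => [u|//] _; have := placeM Pb Eb.
  by rewrite divff // place1 mul0r => -[] /eqP; rewrite oner_eq0.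
case=> [->|]; first exact: place0.
case Eb: (P b^-1) => [u|]; first by case.
by move=> _; have := placeV Eb; rewrite invrK.
Qed.

(* The value group is the quotient of the group F^* by the units of the
   valuation ring, written additively. *)
Definition nonzero := {a : F | a != 0}.

Definition val_le (x y : nonzero) : bool := P (val y / val x) != None.
Definition val_eq (x y : nonzero) : bool := val_le x y && val_le y x.

Lemma val_le_refl : reflexive val_le.
Proof. by move=> x; apply/place_ringP; rewrite divff ?(valP x)//; exact: place_ring1. Qed.

Lemma val_le_trans : transitive val_le.
Proof.
move=> y x z /place_ringP xy /place_ringP yz; apply/place_ringP.
have -> : val z / val x = (val z / val y) * (val y / val x).
  by rewrite mulrA divfK ?(valP y).
exact: place_ringM.
Qed.

Lemma val_le_total : total val_le.
Proof.
move=> x y; apply/orP; case: (place_ring_total (val y / val x)).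
  by move/place_ringP => ?; left.
by rewrite invf_div => /place_ringP ?; right.
Qed.

Lemma val_eq_refl : reflexive val_eq.
Proof. by move=> x; rewrite /val_eq val_le_refl. Qed.

Lemma val_eq_sym : symmetric val_eq.
Proof. by move=> x y; rewrite /val_eq andbC. Qed.

Lemma val_eq_trans : transitive val_eq.
Proof.
move=> y x z /andP[xy yx] /andP[yz zy]; rewrite /val_eq.
by rewrite (val_le_trans xy yz) (val_le_trans zy yx).
Qed.

Canonical val_equiv := EquivRel val_eq val_eq_refl val_eq_sym val_eq_trans.

Definition value_group := {eq_quot val_equiv}.
HB.instance Definition _ := Choice.on value_group.
HB.instance Definition _ := EqQuotient.on value_group.

Definition nz_one : nonzero := exist _ 1 (oner_neq0 F).
Definition nz_mul (x y : nonzero) : nonzero :=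
  exist _ (val x * val y) (mulf_neq0 (valP x) (valP y)).
Definition nz_inv (x : nonzero) : nonzero :=
  exist _ (val x)^-1 (invr_neq0 (valP x)).

Lemma val_leM x y x' y' : val_le x y -> val_le x' y' ->
  val_le (nz_mul x x') (nz_mul y y').
Proof.
move=> /place_ringP a /place_ringP b; apply/place_ringP; rewrite /=.
by rewrite -mulf_div; exact: place_ringM.
Qed.

Lemma val_leV x y : val_le x y -> val_le (nz_inv y) (nz_inv x).
Proof. by rewrite /val_le /= invrK mulrC. Qed.

Definition value (a : nonzero) : value_group := \pi_value_group a.

Lemma valueE x y : (value x = value y) <-> val_eq x y.
Proof. by split=> /(@eqquotP _ val_equiv value_group x y). Qed.

Lemma val_eq_repr x : val_eq (repr (value x)) x.
Proof. by apply/valueE; rewrite /value reprK. Qed.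

Definition vg_add (g h : value_group) := value (nz_mul (repr g) (repr h)).
Definition vg_opp (g : value_group) := value (nz_inv (repr g)).
Definition vg_le (g h : value_group) := val_le (repr g) (repr h).

Lemma vg_addE x y : vg_add (value x) (value y) = value (nz_mul x y).
Proof.
have /andP[a b] := val_eq_repr x; have /andP[c d] := val_eq_repr y.
by apply/valueE; rewrite /val_eq !val_leM.
Qed.

Lemma vg_oppE x : vg_opp (value x) = value (nz_inv x).
Proof.
have /andP[a b] := val_eq_repr x.
by apply/valueE; rewrite /val_eq !val_leV.
Qed.

Lemma vg_leE x y : vg_le (value x) (value y) = val_le x y.
Proof.
have /andP[a b] := val_eq_repr x; have /andP[c d] := val_eq_repr y.
apply/idP/idP => h; first exact: val_le_trans b (val_le_trans h c).
exact: val_le_trans a (val_le_trans h d).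
Qed.

Lemma valueK g : value (repr g) = g. Proof. exact: reprK. Qed.

Lemma vg_addA : associative vg_add.
Proof.
move=> g h k; rewrite -[g]valueK -[h]valueK -[k]valueK !vg_addE.
by congr value; apply: val_inj; rewrite /= mulrA.
Qed.

Lemma vg_addC : commutative vg_add.
Proof.
move=> g h; rewrite -[g]valueK -[h]valueK !vg_addE.
by congr value; apply: val_inj; rewrite /= mulrC.
Qed.

Lemma vg_add0 : left_id (value nz_one) vg_add.
Proof.
move=> g; rewrite -[g]valueK !vg_addE.
by congr value; apply: val_inj; rewrite /= mul1r.
Qed.

Lemma vg_addN : left_inverse (value nz_one) vg_opp vg_add.
Proof.
move=> g; rewrite -[g]valueK vg_oppE vg_addE.
by congr value; apply: val_inj; rewrite /= mulVf // (valP (repr g)).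
Qed.

HB.instance Definition _ :=
  GRing.isZmodule.Build value_group vg_addA vg_addC vg_add0 vg_addN.

Lemma vg_le_refl : reflexive vg_le.
Proof. by move=> g; exact: val_le_refl. Qed.

Lemma vg_le_anti : antisymmetric vg_le.
Proof. by move=> g h gh; rewrite -[g]valueK -[h]valueK; exact/valueE. Qed.

Lemma vg_le_trans : transitive vg_le.
Proof. by move=> g h k; exact: val_le_trans. Qed.

HB.instance Definition _ := Order.Le_isPOrder.Build ring_display value_group
  vg_le_refl vg_le_anti vg_le_trans.

Lemma vg_le_total : total (<=%O : rel value_group).
Proof. by move=> g h; exact: val_le_total. Qed.

HB.instance Definition _ :=
  Order.POrder_isTotal.Build ring_display value_group vg_le_total.

Definition convex_subgroup (H : set value_group) : Prop :=
  [/\ H 0, (forall g h, H g -> H h -> H (g - h)) &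
      (forall g h k, H g -> H k -> g <= h <= k -> H h)].

Definition rank_is (n : nat) : Prop :=
  ([set H | convex_subgroup H /\ H <> setT] #= `I_n)%card.

Definition rational : Prop := forall u, exists c, residue_emb P c = u.

Definition discrete : Prop :=
  exists f : {additive value_group -> int},
    bijective f /\ {mono f : g h / g <= h}.

Definition maximal_rank : Prop := exists2 n, has_trdeg n & rank_is n.

(* y generates the coordinate ring of an affine model V in affine m-space. The
   place is centered on V if it is finite on y, and then its center has the
   FP-rational coordinates y_j P, given by [center y]. *)
Definition centered (m : nat) (y : 'I_m -> F) : Prop :=
  forall j, place_ring P (y j).

Definition center (m : nat) (y : 'I_m -> F) : 'I_m -> residue_field P :=
  fun j => odflt 0 (P (y j)).

(* Jacobian criterion: the gradients at the center of the polynomials vanishing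
   on V span a space of dimension m - dim V, with dim V = trdeg F|K.  By the Leibniz
   rule this span is that of the gradients of any generators of the ideal of V,
   and its dimension never exceeds m - dim V. *)
Definition center_smooth (m : nat) (y : 'I_m -> F) : Prop :=
  exists (n r : nat) (f : 'I_r -> mpoly m K),
    [/\ has_trdeg n,
        (forall i, mmap iota y (f i) = 0) &
        (\rank (\matrix_(i < r, j < m)
           mmap (residue_emb P) (center y) (mderiv j (f i))) + n)%N
        = m].

(* An empty list s gives a smooth center on some model; a non-affine model can
   be replaced by an affine open neighbourhood of the center. *)
Definition smooth_local_uniformization : Prop :=
  forall s : seq F, {in s, forall a, place_ring P a} ->
  exists (m : nat) (y : 'I_m -> F),
    [/\ generates y, centered y, center_smooth y &
        {in s, forall a, exists p, a = mmap iota y p}].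

End PlaceTheory.

(* Places are equivalent when they have the same valuation ring, which thus
   serves as a name for the equivalence class. *)
Record place_space := PlaceSpace {
  class_ring : set F;
  class_ringP : exists P, place_ring P = class_ring }.

Definition place_class (P : place) : place_space :=
  PlaceSpace (ex_intro _ P erefl).

Lemma place_class_surj x : exists P, place_class P = x.
Proof.
case: x => O OP; have [P PO] := OP; exists P; subst O.
by congr PlaceSpace; exact: Prop_irrelevance.
Qed.

Lemma place_class_ring P Q :
  place_class P = place_class Q -> place_ring P = place_ring Q.
Proof. by move=> /(congr1 class_ring). Qed.

Lemma place_class_ideal P Q :
  place_class P = place_class Q -> place_ideal P = place_ideal Q.
Proof. by move=> /place_class_ring h; rewrite !place_idealE h. Qed.

(* Image of a collection of places (the type [place] is too large for [set]). *)
Definition classes_of (C : place -> Prop) : set place_space :=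
  [set x | exists2 P, C P & place_class P = x].

HB.instance Definition _ := gen_eqMixin place_space.
HB.instance Definition _ := gen_choiceMixin place_space.

Definition patch_index : Type := seq F * seq F.
HB.instance Definition _ := Choice.on patch_index.
HB.instance Definition _ := isPointed.Build patch_index ([::], [::]).

Definition patch_base (st : patch_index) : set place_space :=
  classes_of (fun P => {in st.1, forall a, place_ring P a} /\
                       {in st.2, forall b, place_ideal P b}).

Lemma patch_cover : \bigcup_(st in [set: patch_index]) patch_base st = setT.
Proof.
rewrite eqEsubset; split=> // x _; have [P <-] := place_class_surj x.
by exists ([::], [::]) => //; exists P.
Qed.

Lemma patch_join i j x : setT i -> setT j -> patch_base i x -> patch_base j x ->
  exists k, [/\ setT k, patch_base k x & patch_base k `<=` patch_base i `&` patch_base j].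
Proof.
move=> _ _ [P [iP iP'] <-] [Q [jQ jQ'] QP].
exists (i.1 ++ j.1, i.2 ++ j.2); split=> //.
  exists P => //; split=> a; rewrite mem_cat => /orP[]; [exact: iP | | exact: iP' | ].
  - by rewrite -(place_class_ring QP); exact: jQ.
  - by rewrite -(place_class_ideal QP); exact: jQ'.
move=> _ [R [R1 R2] <-]; split; exists R => //; split=> a ai.
- by apply: R1; rewrite mem_cat ai.
- by apply: R2; rewrite mem_cat ai.
- by apply: R1; rewrite mem_cat ai orbT.
- by apply: R2; rewrite mem_cat ai orbT.
Qed.

HB.instance Definition _ := isBaseTopological.Build place_space patch_cover patch_join.

Definition smooth_rational_places : set place_space :=
  classes_of (fun P => rational P /\ smooth_local_uniformization P).

Definition rational_discrete_places : set place_space :=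
  classes_of (fun P => rational P /\ discrete P).

Definition rational_maxrank_places : set place_space :=
  classes_of (fun P => rational P /\ maximal_rank P).

End FunctionFields.

Arguments function_field {K F} iota.
Arguments place {K F} iota.
Arguments place_space {K F} iota.
Arguments patch_base {K F iota} st _.
Arguments smooth_rational_places {K F} iota _.
Arguments rational_discrete_places {K F} iota _.
Arguments rational_maxrank_places {K F} iota _.

(* The type [set_type X] carries the subspace topology of X. *)
Definition dense_in (T : topologicalType) (X A : set T) : Prop :=
  dense ((set_val : set_type X -> T) @^-1` A).

(* Main.v *)
From HB Require Import structures.
From mathcomp Require Import -(notations) mpoly.
Require Import Defs.
From mathcomp Require Import all_boot all_order all_algebra.
From mathcomp Require Import all_classical all_analysis.
From mathcomp Require Import ring.

Set Implicit Arguments.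
Unset Strict Implicit.
Unset Printing Implicit Defensive.
Import Order.TTheory GRing.Theory Num.Theory.
Local Open Scope classical_set_scope.
Local Open Scope quotient_scope.
Local Open Scope ring_scope.

(** Let P be a rational place with smooth local uniformization, satisfying
    finitely many conditions a P <> oo and b P = 0.  Take a model of F|K on which P
    is centered at a smooth point and whose coordinate ring contains all the a and
    b.  An element of that ring is a polynomial in the coordinates, and its value
    at a place centered at a K-rational point is the value of the polynomial
    there.  So every place with the center of P satisfies the same conditions, and
    a rational place with this center is needed that is discrete, or of maximal
    rank, and that again admits smooth local uniformization.

    By smoothness, after a translation and a linear change of the equations
    ([solved_coordinates]), the coordinates are y = (x_1, .., x_n, z_1, .., z_s)
    with n = trdeg F|K, and the equations can be solved near the center for the z_l
    as formal power series in the x_i.  Replace the x_i by power series xi_i in t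
    without constant term, over a polynomial ring K[w_1, .., w_k], that are
    algebraically independent over K.  Then p(y) = 0 if and only if p vanishes at
    the resulting series ([series_eval_eq0]).  For generic xi_i, a p that vanishes
    at the series lies in all powers of the maximal ideal of the center, so that
    p(y) = 0 by Krull's intersection theorem ([krull_intersection], proved with the
    Rees algebra and the Hilbert basis theorem); conversely the series cannot
    satisfy fewer relations than y, because the Jacobian matrix of the equations
    bounds their transcendence degree ([jacobian_rank]).

    Thus F is embedded in the fraction field of K[w_1, .., w_k][[t]].  Comparing the
    exponents of (t, w_1, .., w_k) lexicographically, the leading terms define a
    valuation with values in Z^(k+1) ([fval]), and a place with residue field K
    ([lex_place]).  For k = 0 it is discrete, and lacunary series serve as xi
    ([lacunary_series_independent]).  For k = n - 1 its rank is n, and the chart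
    t, t w_1, .., t w_k of the blow-up of the origin serves as xi
    ([chart_series_independent]).

    In both cases xi begins with t, t w_1, .., t w_k.  Hence V_0 = x_1 and
    V_i = x_(i+1) / x_1 for 1 <= i <= k have the unit vectors as values.  For a large
    M consider the coordinates V_j / V_(j+1)^M for j < k, V_k and (y_l - A_l) / V_0^M,
    where A_l is the series of y_l truncated after t^M.  In these a monomial in the
    V_j is divisible by each monomial of smaller value with exponents below M
    ([toric_lexpos]), so p(y) is its leading monomial times a polynomial that does
    not vanish at the origin ([trunc_eval_leading]).  Therefore every element of
    the valuation ring is a quotient of polynomials whose denominator does not
    vanish at the origin, once M is large.  The equations of the z_l, divided by
    V_0^M, keep their Jacobian matrix at the center, so the chart is smooth there
    ([chart_uniformization]). *)

Local Notation mX i := (mpolyX _ (mnm1 i)).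
Local Notation mC c := (mpolyC _ c).
Local Notation mcst := (mcoeff mnm0).

(** * Polynomials in several variables *)

(** Stability under products, rather than under multiplication by monomials, suits
    properties of ring homomorphisms. *)
Lemma mpoly_ring_ind n (R : nzRingType) (P : mpoly n R -> Prop) :
  (forall c, P (mC c)) -> (forall i, P (mX i)) ->
  (forall p q, P p -> P q -> P (p + q)) ->
  (forall p q, P p -> P q -> P (p * q)) -> forall p, P p.
Proof.
move=> PC PX PD PM; elim/mpolyind => [|c m p _ _ Pp].
  by rewrite -(mpolyC0 n R); exact: PC.
apply: PD => //; rewrite -mul_mpolyC; apply: (PM) => //.
rewrite mpolyXE_id; elim/big_ind: _ => [|p1 p2|i _]; [|exact: PM|].
  by rewrite -(mpolyC1 n R); exact: PC.
elim: (m i) => [|e IH]; first by rewrite expr0 -(mpolyC1 n R); exact: PC.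
by rewrite exprS; apply: PM.
Qed.

Lemma mmapXU n (R S : nzRingType) (f : {rmorphism R -> S}) (h : 'I_n -> S) i :
  mmap f h (mX i) = h i.
Proof. by rewrite mmapX mmap1U. Qed.

Lemma mmapM n (R : nzRingType) (S : comNzRingType) (f : {rmorphism R -> S})
    (h : 'I_n -> S) : {morph mmap f h : p q / p * q}.
Proof. exact: rmorphM. Qed.

Lemma mmap1D n (S : comNzRingType) (h : 'I_n -> S) m1 m2 :
  mmap1 h (mnm_add m1 m2) = mmap1 h m1 * mmap1 h m2.
Proof. by apply: commr_mmap1_M => i x; exact: mulrC. Qed.

Lemma eq_mmap n (R S : nzRingType) (f g : R -> S) (h k : 'I_n -> S) p :
  f =1 g -> h =1 k -> mmap f h p = mmap g k p.
Proof.
move=> fg hk; apply: eq_bigr => m _; rewrite fg; congr (_ * _).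
by apply: eq_bigr => i _; rewrite hk.
Qed.

Lemma rmorph_mmap n (R : nzRingType) (S T : comNzRingType)
    (g : {rmorphism S -> T}) (f : R -> S) (h : 'I_n -> S) p :
  g (mmap f h p) = mmap (g \o f) (g \o h) p.
Proof.
rewrite /mmap rmorph_sum; apply: eq_bigr => m _; rewrite rmorphM; congr (_ * _).
by rewrite /mmap1 rmorph_prod; apply: eq_bigr => i _; rewrite rmorphXn.
Qed.

Lemma mmap_mmap n k (R : comNzRingType) (S : comNzRingType) (f : {rmorphism R -> S})
    (h : 'I_k -> S) (g : 'I_n -> mpoly k R) p :
  mmap f h (mmap (@mpolyC k R) g p) = mmap f (fun i => mmap f h (g i)) p.
Proof. by rewrite rmorph_mmap; apply: eq_mmap => // c /=; rewrite mmapC. Qed.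

Lemma mcst_mmap n (R : nzRingType) (S : comNzRingType)
    (f : {rmorphism R -> S}) (h : 'I_n -> S) p :
  (forall i, h i = 0) -> mmap f h p = f (mcst p).
Proof.
move=> h0; elim/mpoly_ring_ind: p => [c|i|p q IHp IHq|p q IHp IHq].
- by rewrite mmapC mcoeffC eqxx mulr1.
- by rewrite mmapXU h0 mcoeffX mnm1_eq0 rmorph0.
- by rewrite !raddfD /= IHp IHq.
- by rewrite !rmorphM /= IHp IHq.
Qed.

Lemma mmap_id n (R : nzRingType) p : mmap (@mpolyC n R) (fun i => mX i) p = p.
Proof.
rewrite [RHS]mpolyE; apply: eq_bigr => m _; rewrite mul_mpolyC; congr (_ *: _).
by rewrite [RHS]mpolyXE_id.
Qed.

Lemma mderiv_mX n (R : nzRingType) (i k : 'I_n) :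
  mderiv i (mX k : mpoly n R) = mC (k == i)%:R.
Proof.
rewrite mderivX mnm1E; case: eqP => [->|_]; last by rewrite scale0r mpolyC0.
have -> : mnm_sub (mnm1 i) (mnm1 i) = mnm0.
  by apply/mnmP => s; rewrite mnmBE subnn mnm0E.
by rewrite scale1r mpolyX0 mpolyC1.
Qed.

Lemma mderiv_mmap n k (R : comNzRingType) (g : 'I_n -> mpoly k R) i p :
  mderiv i (mmap (@mpolyC k R) g p) =
    \sum_l mmap (@mpolyC k R) g (mderiv l p) * mderiv i (g l).
Proof.
elim/mpoly_ring_ind: p => [c|l|p q IHp IHq|p q IHp IHq].
- by rewrite mmapC mderivC big1 // => l _; rewrite mderivC mmap0 mul0r.
- rewrite mmapXU (bigD1 l) //= big1 => [|l' ll'].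
    by rewrite mderiv_mX eqxx mmapC /= mulr1n mpolyC1 mul1r addr0.
  by rewrite mderiv_mX eq_sym (negPf ll') mmapC /= mulr0n mpolyC0 mul0r.
- rewrite mmapD mderivD IHp IHq -big_split; apply: eq_bigr => l _.
  by rewrite mderivD mmapD mulrDl.
- rewrite mmapM mderivM IHp IHq mulr_suml mulr_sumr -big_split.
  apply: eq_bigr => l _; rewrite mderivM mmapD !mmapM /= mulrDl mulrA.
  by rewrite -!mulrA [mderiv i _ * _]mulrC.
Qed.

(** * The Hilbert basis theorem *)

Section Noetherian.

Definition ideal (R : nzRingType) (I : R -> Prop) :=
  [/\ I 0, forall a b, I a -> I b -> I (a + b) & forall a b, I b -> I (a * b)].

(** Membership in the ideal generated by [s], as an intersection of ideals. This
    avoids choosing coefficients, and a property of the members is proved by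
    checking that it defines an ideal. *)
Definition gen (R : nzRingType) (s : seq R) (a : R) :=
  forall I, ideal I -> (forall x, x \in s -> I x) -> I a.

Definition noetherian (R : nzRingType) :=
  forall I : R -> Prop, ideal I -> exists s : seq R,
    (forall x, x \in s -> I x) /\ (forall a, I a -> gen s a).

Lemma gen_ideal (R : nzRingType) (s : seq R) : ideal (gen s).
Proof.
split=> [I [] //|a b Ha Hb I HI Hs|a b Hb I HI Hs].
  by case: (HI) => _ + _; apply; [exact: Ha | exact: Hb].
by case: (HI) => _ _; apply; exact: Hb.
Qed.

Lemma gen_mem (R : nzRingType) (s : seq R) x : x \in s -> gen s x.
Proof. by move=> xs I _; apply. Qed.

Lemma gen_sub (R : nzRingType) (s t : seq R) a :
  (forall x, x \in s -> gen t x) -> gen s a -> gen t a.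
Proof. by move=> st; apply; [exact: gen_ideal|]. Qed.

Lemma idealB (R : nzRingType) (I : R -> Prop) : ideal I ->
  forall a b, I a -> I b -> I (a - b).
Proof. by move=> [_ ID IM] a b Ia Ib; apply: ID => //; rewrite -mulN1r; apply: IM. Qed.

Lemma noetherian_field (k : fieldType) : noetherian k.
Proof.
move=> I II; have [[a [a0 Ia]]|H] := EM (exists a, a != 0 /\ I a).
  exists [:: a]; split=> [x|b _ J [_ _ JM] Js]; first by rewrite inE => /eqP->.
  by rewrite -(divfK a0 b); apply: JM; apply: Js; rewrite inE.
exists [::]; split=> // b Ib J [J0 _ _] _; have [->//|b0] := eqVneq b 0.
by case: H; exists b.
Qed.

Lemma noetherian_surj (R S : nzRingType) (f : {rmorphism R -> S}) :
  (forall y, exists x, f x = y) -> noetherian R -> noetherian S.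
Proof.
move=> fs NR I [I0 ID IM].
have [|s [sI Is]] := NR (fun x => I (f x)).
  split; first by rewrite rmorph0.
    by move=> a b; rewrite rmorphD; exact: ID.
  by move=> a b; rewrite rmorphM; exact: IM.
exists (map f s); split=> [x /mapP[y ys ->]|a]; first exact: sI.
have [x <-] := fs a => Ix J [J0 JD JM] Js; apply: (Is x Ix (fun x => J (f x))).
  split; first by rewrite rmorph0.
    by move=> b c; rewrite rmorphD; exact: JD.
  by move=> b c; rewrite rmorphM; exact: JM.
by move=> z zs; apply: Js; exact: map_f.
Qed.

(** A combination of the coefficients in degree [d] lifts to the same combination
    of the polynomials, of size at most [d.+1]; subtracting it from [p] cancels the
    coefficient in degree [d]. *)
Lemma lower_leading (R : nzRingType) (I : {poly R} -> Prop) d (t : seq {poly R}) (p : {poly R}) :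
  ideal I -> (forall q, q \in t -> I q /\ (size q <= d.+1)%N) ->
  gen (map (fun q : {poly R} => q`_d) t) p`_d -> (size p <= d.+1)%N ->
  exists2 q, gen t q & (size (p - q)%R <= d)%N.
Proof.
move=> II tI gp sp.
suff [q [gq sq qd]] : exists q, [/\ gen t q, (size q <= d.+1)%N & q`_d = p`_d].
  exists q => //; have : (size (p - q)%R <= d.+1)%N.
    by rewrite (leq_trans (size_polyD _ _)) // size_polyN geq_max sp sq.
  rewrite leq_eqVlt => /orP[/eqP sd|//]; exfalso.
  have : lead_coef (p - q) = 0 by rewrite lead_coefE sd coefB qd subrr.
  by move/eqP; rewrite lead_coef_eq0 -size_poly_eq0 sd.
move: gp => /(_ (fun a => exists q, [/\ gen t q, (size q <= d.+1)%N & q`_d = a])).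
apply; first split.
- exists 0; rewrite size_poly0 coef0; split=> //; by case: (gen_ideal t).
- move=> a b [q [gq sq qa]] [r [gr sr rb]]; exists (q + r).
  split; last by rewrite coefD qa rb.
    by case: (gen_ideal t) => _ + _; apply.
  by rewrite (leq_trans (size_polyD _ _)) // geq_max sq sr.
- move=> a b [q [gq sq qb]]; exists (a%:P * q); split.
  + by case: (gen_ideal t) => _ _; apply.
  + by rewrite mul_polyC (leq_trans (size_scale_leq _ _)).
  + by rewrite coefCM qb.
move=> _ /mapP[q qt ->]; exists q; split=> //; first exact: gen_mem.
by have [] := tI _ qt.
Qed.

Lemma ideal_mulXn (R : nzRingType) (I : {poly R} -> Prop) e p :
  ideal I -> I p -> I (p * 'X^e).
Proof. by move=> [_ _ IM] Ip; rewrite (commr_polyXn p e); exact: IM. Qed.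

(** The coefficients in degree [d] of the members of [I] of size at most [d.+1] form
    an ideal of [R]; finitely many members of [I] realise its generators. *)
Lemma leading_gens (R : nzRingType) (I : {poly R} -> Prop) d : noetherian R ->
  ideal I -> exists t : seq {poly R}, (forall q, q \in t -> I q) /\
    forall p, I p -> (size p <= d.+1)%N ->
      exists2 q, gen t q & (size (p - q)%R <= d)%N.
Proof.
move=> NR II; case: (II) => I0 ID IM.
have [|s [sL Ls]] := NR (fun a => exists p, [/\ I p, (size p <= d.+1)%N & p`_d = a]).
  split; first by exists 0; rewrite size_poly0 coef0.
    move=> a b [p [Ip sp pa]] [q [Iq sq qb]]; exists (p + q).
    split; [exact: ID| |by rewrite coefD pa qb].
    by rewrite (leq_trans (size_polyD _ _)) // geq_max sp sq.
  move=> a b [p [Ip sp pb]]; exists (a%:P * p).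
  split; [exact: IM| |by rewrite coefCM pb].
  by rewrite mul_polyC (leq_trans (size_scale_leq _ _)).
have [t [tI st]] : exists t : seq {poly R},
    (forall q, q \in t -> I q /\ (size q <= d.+1)%N) /\
    map (fun q : {poly R} => q`_d) t = s.
  elim: s sL {Ls} => [|a s IH] sL; first by exists [::].
  have [|t [tI <-]] := IH; first by move=> x xs; apply: sL; rewrite inE xs orbT.
  have [p [Ip sp <-]] := sL a (mem_head _ _).
  by exists (p :: t); split=> // q; rewrite inE => /orP[/eqP->|/tI].
exists t; split=> [q /tI[] //|p Ip sp]; apply: (lower_leading II) => //.
by rewrite st; apply: Ls; exists p.
Qed.

(** The leading coefficients of all members of [I] form an ideal of [R], whose
    generators are realised in a common degree [D]. Their multiples lower the
    degree from [D] on, and [leading_gens] serves the degrees below [D]. *)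
Theorem hilbert_basis (R : nzRingType) : noetherian R -> noetherian {poly R}.
Proof.
move=> NR I II; case: (II) => I0 ID IM.
pose L a := exists d p, [/\ I p, (size p <= d.+1)%N & p`_d = a].
have shift d e (p : {poly R}) : (size p <= d.+1)%N ->
    (size (p * 'X^e)%R <= (d + e).+1)%N /\ (p * 'X^e)`_(d + e) = p`_d.
  move=> sp; rewrite coefMXn ltnNge leq_addl /= addnK; split=> //.
  by rewrite (leq_trans (size_polyMleq _ _)) // size_polyXn addnS /= -addSn leq_add2r.
have [|s [sL Ls]] := NR L.
  split; first by exists 0, 0; rewrite size_poly0 coef0.
    move=> a b [d [p [Ip sp pa]]] [e [q [Iq sq qb]]].
    exists (d + e)%N, (p * 'X^e + q * 'X^d).
    have [s1 c1] := shift d e p sp; have [s2 c2] := shift e d q sq.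
    rewrite addnC in s2 c2; split; last by rewrite coefD c1 c2 pa qb.
      by apply: ID; apply: ideal_mulXn.
    by rewrite (leq_trans (size_polyD _ _)) // geq_max s1 s2.
  move=> a b [d [p [Ip sp pb]]]; exists d, (a%:P * p).
  split; [exact: IM| |by rewrite coefCM pb].
  by rewrite mul_polyC (leq_trans (size_scale_leq _ _)).
(* beyond some degree D the leading coefficients no longer grow *)
have [D [t [tI st]]] : exists D (t : seq {poly R}),
    (forall q, q \in t -> I q /\ (size q <= D.+1)%N) /\
    map (fun q : {poly R} => q`_D) t = s.
  elim: s sL {Ls} => [|a s IH] sL; first by exists 0%N, [::].
  have [|D [t [tI <-]]] := IH; first by move=> x xs; apply: sL; rewrite inE xs orbT.
  have [d [p [Ip sp <-]]] := sL a (mem_head _ _).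
  exists (d + D)%N, (p * 'X^D :: map (fun q => q * 'X^d) t).
  have [s1 c1] := shift d D p sp; split.
    move=> q; rewrite inE => /orP[/eqP->|/mapP[r /tI[Ir sr] ->]].
      by split=> //; exact: ideal_mulXn.
    have [s2 c2] := shift D d r sr; rewrite addnC in s2; split=> //.
    exact: ideal_mulXn.
  rewrite /= c1; congr cons; rewrite -map_comp; apply/eq_in_map => r /tI[_ sr] /=.
  by have [_ c2] := shift D d r sr; rewrite addnC.
have [u [uI Hu]] : exists u : seq {poly R}, (forall q, q \in u -> I q) /\
    forall d p, (d < D)%N -> I p -> (size p <= d.+1)%N ->
      exists2 q, gen u q & (size (p - q)%R <= d)%N.
  elim: D {t tI st} => [|D [u [uI Hu]]]; first by exists [::].
  have [t [tI Ht]] := leading_gens D NR II.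
  exists (t ++ u); split=> [q|d p].
    by rewrite mem_cat => /orP[/tI|/uI].
  rewrite ltnS leq_eqVlt => /orP[/eqP->|dD] Ip sp.
    have [q gq sq] := Ht p Ip sp; exists q => //.
    by apply: gen_sub gq => x xt; apply: gen_mem; rewrite mem_cat xt.
  have [q gq sq] := Hu d p dD Ip sp; exists q => //.
  by apply: gen_sub gq => x xt; apply: gen_mem; rewrite mem_cat xt orbT.
have wI q : q \in t ++ u -> I q by rewrite mem_cat => /orP[/tI[]|/uI].
exists (t ++ u); split=> // p Ip.
have [m] := ubnP (size p); elim: m p Ip => // m IH p Ip.
rewrite ltnS => sp; case: m IH sp => [|m] IH sp.
  move: sp; rewrite leqn0 size_poly_eq0 => /eqP->.
  by case: (gen_ideal (t ++ u)).
have [q gq sq] : exists2 q, gen (t ++ u) q & (size (p - q)%R <= m)%N.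
  have [mD|Dm] := ltnP m D.
    have [q gq sq] := Hu m p mD Ip sp; exists q => //.
    by apply: gen_sub gq => x xt; apply: gen_mem; rewrite mem_cat xt orbT.
  (* multiplying by a power of the variable moves the generators to degree m *)
  have [q gq sq] : exists2 q, gen (map (fun q => q * 'X^(m - D)) t) q &
      (size (p - q)%R <= m)%N.
    apply: (lower_leading II) => //.
      move=> _ /mapP[r /tI[Ir sr] ->]; split; first exact: ideal_mulXn.
      by have [] := shift D (m - D)%N r sr; rewrite subnKC.
    rewrite -map_comp; have -> : map ((fun q : {poly R} => q`_m) \o
        (fun q => q * 'X^(m - D))) t = s.
      rewrite -st; apply/eq_in_map => r /tI[_ sr] /=.
      by have [_] := shift D (m - D)%N r sr; rewrite subnKC.
    by apply: Ls; exists m, p.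
  exists q => //; apply: gen_sub gq => _ /mapP[r rt ->].
  apply: (@ideal_mulXn _ (gen (t ++ u))); first exact: gen_ideal.
  by apply: gen_mem; rewrite mem_cat rt.
rewrite -(subrK q p); case: (gen_ideal (t ++ u)) => _ + _; apply=> //.
apply: IH => //; apply: (idealB II) => //; exact: gq.
Qed.

Lemma noetherian_mpoly (k : fieldType) n : noetherian (mpoly n k).
Proof.
elim: n => [|n IH].
  apply: (noetherian_surj (f := @mpolyC 0 k)); last exact: noetherian_field.
  by move=> p; exists (mcst p); exact/esym/nvar0_mpolyC.
apply: (noetherian_surj (f := horner_eval (mX ord_max) \o map_poly (@mwiden n k))).
  elim/mpoly_ring_ind => [c|i|_ _ [p <-] [q <-]|_ _ [p <-] [q <-]].
  - exists (mC c)%:P; rewrite /= map_polyC /= horner_evalE hornerC.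
    by rewrite mwidenC.
  - have [j ->|->] := unliftP ord_max i.
      exists (mX j)%:P; rewrite /= map_polyC /= horner_evalE hornerC.
      rewrite /mwiden mmapXU; congr (mX _); apply: val_inj => /=.
      by rewrite /bump leqNgt ltn_ord.
    by exists 'X; rewrite /= map_polyX horner_evalE hornerX.
  - by exists (p + q); rewrite rmorphD.
  - by exists (p * q); rewrite rmorphM.
exact: hilbert_basis.
Qed.

End Noetherian.

(** * Orders of vanishing at the origin and the Krull intersection theorem *)

Section OrderOfVanishing.
Variables (n : nat) (R : comNzRingType).
Implicit Types p q : mpoly n R.

(** Membership in the [N]-th power of the ideal of the origin. *)
Definition mord_ge N p := forall m, (mdeg m < N)%N -> mcoeff m p = 0.

Lemma mord_geD N p q : mord_ge N p -> mord_ge N q -> mord_ge N (p + q).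
Proof. by move=> hp hq m mN; rewrite mcoeffD hp // hq // addr0. Qed.

Lemma mord_geN N p : mord_ge N p -> mord_ge N (- p).
Proof. by move=> hp m mN; rewrite mcoeffN hp // oppr0. Qed.

Lemma mord_geM N M p q : mord_ge N p -> mord_ge M q -> mord_ge (N + M) (p * q).
Proof.
move=> hp hq m mNM; rewrite mcoeffM big1 // => -[a b] /= /eqP E.
have ab := mNM; rewrite (congr1 (@mdeg n) E) mdegD in ab.
have [aN|Na] := ltnP (mdeg a) N; first by rewrite hp // mul0r.
rewrite hq ?mulr0 // -(ltn_add2l (mdeg a)) (leq_trans ab) //.
by rewrite leq_add2r.
Qed.

Lemma mord_ge1X i : mord_ge 1 (mX i : mpoly n R).
Proof.
by move=> m; rewrite ltnS leqn0 mdeg_eq0 => /eqP->; rewrite mcoeffX mnm1_eq0.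
Qed.

Lemma mord_ge1 p : mcst p = 0 -> mord_ge 1 p.
Proof. by move=> p0 m; rewrite ltnS leqn0 mdeg_eq0 => /eqP->. Qed.

End OrderOfVanishing.

Section Krull.
Variables (K F : fieldType) (iota : {rmorphism K -> F}) (m : nat) (y : 'I_m -> F).

Let B a := exists p, a = mmap iota y p.
Let M a := exists2 p, mcst p = 0 & a = mmap iota y p.

Let BD a b : B a -> B b -> B (a + b).
Proof. by move=> [p ->] [q ->]; exists (p + q); rewrite rmorphD. Qed.
Let BM a b : B a -> B b -> B (a * b).
Proof. by move=> [p ->] [q ->]; exists (p * q); rewrite rmorphM. Qed.
Let MD a b : M a -> M b -> M (a + b).
Proof.
move=> [p p0 ->] [q q0 ->]; exists (p + q); last by rewrite rmorphD.
by rewrite mcoeffD p0 q0 addr0.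
Qed.
Let MB a b : M a -> B b -> M (a * b).
Proof.
move=> [p p0 ->] [q ->]; exists (p * q); last by rewrite rmorphM.
by rewrite rmorphM /= p0 mul0r.
Qed.
Let M0 : M 0. Proof. by exists 0; rewrite ?mcoeff0 ?rmorph0. Qed.
Let B0 : B 0. Proof. by exists 0; rewrite rmorph0. Qed.
Let MsubB a : M a -> B a. Proof. by move=> [p _ ->]; exists p. Qed.

(* generators of the Rees algebra K[y, yT] inside F[T] *)
Let gens (i : 'I_(m + m)) : {poly F} :=
  match fintype.split i with inl j => (y j)%:P | inr j => y j *: 'X end.
Let rees (p : mpoly (m + m) K) : {poly F} := mmap (polyC \o iota) gens p.

Let gensl j : gens (lshift m j) = (y j)%:P.
Proof. by rewrite /gens; case: split_ordP => k /eqP; rewrite ?eq_lshift ?eq_lrshift // => /eqP->. Qed.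
Let gensr j : gens (rshift m j) = y j *: 'X.
Proof. by rewrite /gens; case: split_ordP => k /eqP; rewrite ?eq_rshift ?eq_rlshift // => /eqP->. Qed.

Let rees_coef p : (forall e, B (rees p)`_e) /\ (forall e, M (rees p)`_e.+1).
Proof.
rewrite /rees; elim/mpoly_ring_ind: p => [c|i|p q [IB IM] [JB JM]|p q [IB IM] [JB JM]].
- rewrite mmapC /=; split=> e; rewrite coefC //=.
  by case: (e == 0%N); [exists (mC c); rewrite mmapC | exact: B0].
- rewrite mmapXU; case: (split_ordP i) => j ->; rewrite ?gensl ?gensr.
    split=> e; rewrite coefC //=.
    by case: (e == 0%N); [exists (mX j); rewrite mmapXU | exact: B0].
  have My : M (y j) by exists (mX j); rewrite ?mmapXU // mcoeffX mnm1_eq0.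
  by split=> e; rewrite coefZ coefX; case: (_ == 1)%N;
    rewrite ?mulr1 ?mulr0 //; exact: MsubB.
- by split=> e; rewrite rmorphD coefD; [exact: BD | exact: MD].
- split=> e; rewrite rmorphM coefM.
    by elim/big_ind: _ => [|a b|i _]; [exact: B0 | exact: BD | apply: BM => //].
  elim/big_ind: _ => [|a b|[[|i] Hi] _]; [exact: M0 | exact: MD | | ].
    by rewrite subn0 mulrC; apply: MB => //.
  by apply: MB; [exact: IM | exact: JB].
Qed.

Let rees_range N p : mord_ge N p ->
  exists q, rees q = mmap iota y p *: 'X^N.
Proof.
move=> hp; rewrite /mmap scaler_suml.
suff H mo : (N <= mdeg mo)%N -> exists q, rees q = mmap1 y mo *: 'X^N.
  elim/big_ind: _ => [|_ _ [p1 <-] [p2 <-]|mo _].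
  - by exists 0; rewrite /rees rmorph0.
  - by exists (p1 + p2); rewrite /rees rmorphD.
  have [mN|/H[q Hq]] := ltnP (mdeg mo) N.
    by exists 0; rewrite hp // rmorph0 mul0r scale0r /rees rmorph0.
  exists (mC (mcoeff mo p) * q); rewrite -scalerA -Hq /rees rmorphM /= mmapC /=.
  by rewrite mul_polyC.
elim: N mo {p hp} => [|N IH] mo moN.
  exists (mmap (@mpolyC _ _) (fun j => mX (lshift m j)) (mpolyX K mo)).
  rewrite /rees mmap_mmap mmapX expr0 alg_polyC /mmap1 rmorph_prod.
  by apply: eq_bigr => i _; rewrite rmorphXn /= mmapXU gensl.
have [i moi] : exists i, (0 < mo i)%N.
  apply/existsP; apply: contraTT moN; rewrite negb_exists => /forallP mo0.
  by rewrite mdegE big1 // => i _; apply/eqP; have := mo0 i; rewrite lt0n negbK.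
have E : mo = mnm_add (mnm1 i) (mnm_sub mo (mnm1 i)).
  by rewrite addmC submK // lep1mP -lt0n.
have [|q Hq] := IH (mnm_sub mo (mnm1 i)).
  by move: moN; rewrite {1}E mdegD mdeg1.
exists (mX (rshift m i) * q); rewrite /rees rmorphM /= mmapXU gensr -/(rees q) Hq [in RHS]E.
by rewrite mmap1D mmap1U exprS -scalerAl -scalerAr scalerA.
Qed.

(** The elements [g T^N] all lie in the Rees algebra, which is noetherian; so
    some [g T^N] is a combination of the previous ones, and comparing
    coefficients of [T^N] gives [g = h g] with [h] in the maximal ideal. *)
Theorem krull_intersection (g : F) :
  (forall p, mcst p != 0 -> mmap iota y p != 0) ->
  (forall N, exists2 p, mord_ge N p & mmap iota y p = g) -> g = 0.
Proof.
move=> aug Hg.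
have /boolp.choice[a Ha] : forall N, exists q, rees q = g *: 'X^N.
  by move=> N; have [p hp <-] := Hg N; exact: rees_range hp.
have Bg : B g by have [p _ <-] := Hg 0%N; exists p.
pose I q := exists N, gen (map a (seq.iota 0 N)) q.
have mono N N' q : (N <= N')%N ->
    gen (map a (seq.iota 0 N)) q -> gen (map a (seq.iota 0 N')) q.
  move=> NN' gq; apply: gen_sub gq => _ /mapP[k + ->].
  rewrite mem_iota => /andP[_ kN].
  by apply: gen_mem; apply: map_f; rewrite mem_iota /= (leq_trans kN).
have II : ideal I.
  split=> [|p q [N Hp] [N' Hq]|p q [N Hq]].
  - by exists 0%N; case: (gen_ideal (map a (seq.iota 0 0))).
  - exists (maxn N N'); case: (gen_ideal (map a (seq.iota 0 (maxn N N')))).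
    move=> _ + _; apply; [apply: mono Hp | apply: mono Hq];
      by rewrite ?leq_maxl ?leq_maxr.
  - by exists N; case: (gen_ideal (map a (seq.iota 0 N))) => _ _; apply.
have [s [sI sG]] := noetherian_mpoly II.
have [N HN] : exists N, forall x, x \in s -> gen (map a (seq.iota 0 N)) x.
  elim: s sI {sG} => [|x s IH] sI; first by exists 0%N.
  have [|N HN] := IH; first by move=> z zs; apply: sI; rewrite inE zs orbT.
  have [N' HN'] := sI x (mem_head _ _).
  exists (maxn N N') => z; rewrite inE => /orP[/eqP->|/HN].
    by apply: mono HN'; rewrite leq_maxr.
  by apply: mono; rewrite leq_maxl.
have : gen (map a (seq.iota 0 N)) (a N).
  apply: gen_sub HN _; apply: sG; exists N.+1; apply: gen_mem; apply: map_f.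
  by rewrite mem_iota add0n /=.
move=> /(_ (fun q => (forall e, exists2 h, B h & (rees q)`_e = h * g) /\
  (forall e, (N <= e)%N -> exists2 h, M h & (rees q)`_e = h * g))).
case; first split.
- split=> [e|e _]; exists 0; rewrite ?mul0r /rees ?rmorph0 ?coef0 //.
- move=> p q [IB IM] [JB JM]; rewrite /rees rmorphD.
  split=> e.
    have [h hB E] := IB e; have [k kB E'] := JB e.
    by exists (h + k); [exact: BD | rewrite coefD E E' mulrDl].
  move=> Ne; have [h hB E] := IM e Ne; have [k kB E'] := JM e Ne.
  by exists (h + k); [exact: MD | rewrite coefD E E' mulrDl].
- move=> p q [JB JM]; have [IB IM] := rees_coef p.
  rewrite /rees rmorphM; split=> e.
    rewrite coefM; elim/big_ind: _ => [|_ _ [h hB ->] [k kB ->]|i _].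
    + by exists 0; rewrite ?mul0r.
    + by exists (h + k); [exact: BD | rewrite mulrDl].
    have [h hB E] := JB (e - i)%N; exists ((rees p)`_i * h); first exact: BM.
    by rewrite -mulrA -E.
  move=> Ne; rewrite coefM; elim/big_ind: _ => [|_ _ [h hB ->] [k kB ->]|i _].
  + by exists 0; rewrite ?mul0r.
  + by exists (h + k); [exact: MD | rewrite mulrDl].
  case: i => -[|i] Hi.
    have [h hM E] := JM e Ne; exists ((rees p)`_0 * h).
      by rewrite mulrC; exact: MB.
    by rewrite /= subn0 -mulrA -E.
  have [h hB E] := JB (e - i.+1)%N; exists ((rees p)`_i.+1 * h); first exact: MB.
  by rewrite /= -mulrA -E.
- move=> _ /mapP[k + ->]; rewrite mem_iota add0n /= => kN; rewrite Ha; split=> e.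
    exists (if e == k then 1 else 0).
      by case: (e == k); [exists 1; rewrite rmorph1 | exact: B0].
    by rewrite coefZ coefXn mulrC; case: (e == k).
  move=> Ne; exists 0; first exact: M0.
  by rewrite coefZ coefXn mul0r gtn_eqF ?mulr0 // (leq_trans kN).
move=> _ /(_ N (leqnn N)) [_ [p p0 ->]]; rewrite Ha coefZ coefXn eqxx mulr1 => E.
have : mmap iota y (1 - p) * g = 0 by rewrite rmorphB rmorph1 /= mulrBl mul1r -E subrr.
move/eqP; rewrite mulf_eq0 (negPf (aug _ _)) => [/eqP //|].
by rewrite mcoeffB mcoeff1 p0 subr0 eqxx oner_neq0.
Qed.

End Krull.

(** * Gradients and transcendence degree *)

Lemma mmap_mwiden (K E : comNzRingType) (j : {rmorphism K -> E}) n
    (q : 'I_n.+1 -> E) (c : mpoly n K) :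
  mmap j q (mwiden c) = mmap j (fun i => q (widen_ord (leqnSn n) i)) c.
Proof. by rewrite /mwiden mmap_mmap; apply: eq_mmap => // i; rewrite mmapXU. Qed.

Section Gradient.
Variables (K W : fieldType) (j : {rmorphism K -> W}).

Definition grad n (q : 'I_n -> W) (f : mpoly n K) : 'rV[W]_n :=
  \row_i mmap j q (mderiv i f).

Lemma gradD n (q : 'I_n -> W) f g : grad q (f + g) = grad q f + grad q g.
Proof. by apply/rowP => i; rewrite !mxE !raddfD. Qed.

Lemma gradM n (q : 'I_n -> W) f g :
  grad q (f * g) = mmap j q g *: grad q f + mmap j q f *: grad q g.
Proof. by apply/rowP => i; rewrite !mxE mderivM rmorphD !rmorphM /= mulrC. Qed.

Lemma grad_sum n (q : 'I_n -> W) I r (P : pred I) f :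
  grad q (\sum_(i <- r | P i) f i) = \sum_(i <- r | P i) grad q (f i).
Proof.
apply: (big_morph (grad q) (gradD q)).
by apply/rowP => i; rewrite !mxE !raddf0.
Qed.

(** Pseudo-division needs one variable singled out; this is the isomorphism from
    the polynomials in the last variable over those in the others. *)
Definition last_var n : {rmorphism {poly mpoly n K} -> mpoly n.+1 K} :=
  horner_eval (mX ord_max) \o map_poly (@mwiden n K).

Lemma last_varE n (h : {poly mpoly n K}) :
  last_var n h = \sum_(i < size h) mwiden h`_i * mX ord_max ^+ i.
Proof.
rewrite /last_var /= horner_evalE horner_coef.
rewrite size_map_inj_poly ?rmorph0 //; last exact: inj_mwiden.
by apply: eq_bigr => i _; rewrite coef_map.
Qed.

Lemma last_varC n c : last_var n c%:P = mwiden c.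
Proof. by rewrite /last_var /= map_polyC /= horner_evalE hornerC. Qed.

Lemma last_var_surj n f : exists h, last_var n h = f.
Proof.
elim/mpoly_ring_ind: f => [c|i|_ _ [p <-] [q <-]|_ _ [p <-] [q <-]].
- by exists (mC c)%:P; rewrite last_varC mwidenC.
- have [k ->|->] := unliftP ord_max i.
    exists (mX k)%:P; rewrite last_varC /mwiden mmapXU; congr (mX _).
    by apply: val_inj; rewrite /= /bump leqNgt ltn_ord.
  by exists 'X; rewrite /last_var /= map_polyX horner_evalE hornerX.
- by exists (p + q); rewrite rmorphD.
- by exists (p * q); rewrite rmorphM.
Qed.

Section LastVariable.
Variables (n : nat) (q : 'I_n.+1 -> W).
Let q' (i : 'I_n) := q (widen_ord (leqnSn n) i).
Let E : 'M[W]_(n, n.+1) := \matrix_(i, k) (k == widen_ord (leqnSn n) i)%:R.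

Lemma grad_mwiden c : grad q (mwiden c) = grad q' c *m E.
Proof.
elim/mpoly_ring_ind: c => [c|i|f g IHf IHg|f g IHf IHg].
- apply/rowP => k; rewrite !mxE mwidenC mderivC rmorph0 big1 // => i _.
  by rewrite mxE mderivC rmorph0 mul0r.
- apply/rowP => k; rewrite !mxE /mwiden mmapXU mderiv_mX mmapC.
  rewrite (bigD1 i) //= big1 => [|l li].
    by rewrite !mxE mderiv_mX eqxx mmapC /= mulr1n rmorph1 mul1r addr0 rmorph_nat eq_sym.
  by rewrite !mxE mderiv_mX eq_sym (negPf li) mmapC /= mulr0n rmorph0 mul0r.
- by rewrite rmorphD !gradD IHf IHg mulmxDl.
- by rewrite rmorphM !gradM IHf IHg !mmap_mwiden mulmxDl !scalemxAl.
Qed.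

Let ev := mmap j q'.

Let grad_sub (A : 'M[W]_n) (h : {poly mpoly n K}) :
  (forall f, mmap j q' f = 0 -> (grad q' f <= A)%MS) ->
  (forall i, ev h`_i = 0) -> (grad q (last_var n h) <= A *m E)%MS.
Proof.
move=> HA h0; rewrite last_varE grad_sum summx_sub // => i _.
rewrite gradM mmap_mwiden (h0 i : mmap j q' _ = 0) scale0r addr0 grad_mwiden.
by apply: scalemx_sub; apply: submxMr; exact: HA.
Qed.

(* a polynomial of degree below the minimal one vanishes coefficientwise *)
Let coef_vanish S (r : {poly mpoly n K}) :
  (forall g, mmap j q (last_var n g) = 0 -> ev (lead_coef g) != 0 -> (S <= size g)%N) ->
  (size r < S)%N -> mmap j q (last_var n r) = 0 -> forall i, ev r`_i = 0.
Proof.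
move=> HS; have [m] := ubnP (size r); elim: m r => // m IH r.
rewrite ltnS => rm rS r0; have [l0|l0] := eqVneq (ev (lead_coef r)) 0; last first.
  by have := HS r r0 l0; rewrite leqNgt rS.
have [r00|rn0] := eqVneq r 0; first by move=> i; rewrite r00 coef0 /ev rmorph0.
pose t := lead_coef r *: 'X^((size r).-1).
have st : (size (r - t)%R < size r)%N.
  have : (size (r - t)%R <= size r)%N.
    rewrite (leq_trans (size_polyD _ _)) // size_polyN geq_max leqnn /=.
    rewrite (leq_trans (size_scale_leq _ _)) // size_polyXn prednK //.
    by rewrite lt0n size_poly_eq0.
  rewrite leq_eqVlt => /orP[/eqP e|//]; exfalso.
  have : (r - t)`_(size r).-1 = 0.
    by rewrite coefB coefZ coefXn eqxx mulr1 lead_coefE subrr.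
  rewrite -e -lead_coefE => /eqP; rewrite lead_coef_eq0 -size_poly_eq0 e.
  by rewrite size_poly_eq0 (negPf rn0).
have t0 : mmap j q (last_var n (r - t)) = 0.
  rewrite /t -mul_polyC rmorphB rmorphM mmapB mmapM r0 last_varC mmap_mwiden.
  by rewrite (l0 : mmap j q' _ = 0) mul0r subr0.
move=> i; have := IH (r - t) (leq_trans st rm) (ltn_trans st rS) t0 i.
rewrite coefB /ev rmorphB /= coefZ rmorphM /= (l0 : mmap j q' _ = 0) mul0r subr0.
by [].
Qed.

(** Adjoining one more coordinate: either it satisfies no new relation, or all
    new relations are, after pseudo-division, multiples of one of minimal
    degree, whose gradient is the only new one. *)
Lemma grad_last_var (A : 'M[W]_n) :
  (forall f, mmap j q' f = 0 -> (grad q' f <= A)%MS) ->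
  exists2 B : 'M[W]_n.+1, (\rank B <= (\rank A).+1)%N &
    forall f, mmap j q f = 0 -> (grad q f <= B)%MS.
Proof.
move=> HA; pose P s := `[< exists g : {poly mpoly n K}, [/\ size g = s, mmap j q (last_var n g) = 0 &
  ev (lead_coef g) != 0] >].
have [[s Ps]|H] := EM (exists s, P s); last first.
  exists (<<A *m E>>)%MS; first by rewrite genmxE ltnW // ltnS mxrankM_maxl.
  move=> f; have [h <-] := last_var_surj f => h0; rewrite genmxE.
  apply: grad_sub => // i; apply: (@coef_vanish (size h).+1) => // g g0 l0.
  by case: H; exists (size g); apply/asboolP; exists g.
case: (ex_minnP (ex_intro P s Ps)) => {Ps}s /asboolP[g [gs g0 l0]] smin.
have HS g' : mmap j q (last_var n g') = 0 -> ev (lead_coef g') != 0 -> (s <= size g')%N.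
  by move=> h1 h2; apply: smin; apply/asboolP; exists g'.
exists (A *m E + grad q (last_var n g))%MS.
  rewrite (leq_trans (mxrank_adds_leqif _ _)) // -[leqRHS]addn1.
  by rewrite leq_add ?rank_leq_row ?mxrankM_maxl.
move=> f; have [h <-] := last_var_surj f => h0.
have gn0 : g != 0 by apply: contraNneq l0 => ->; rewrite lead_coef0 /ev rmorph0.
have := Pdiv.ComRing.rdivp_eq g h.
set k := Pdiv.Ring.rscalp h g; set d := Pdiv.Ring.rdivp h g.
set r := Pdiv.Ring.rmodp h g => Ediv.
have rs : (size r < s)%N by rewrite -gs Pdiv.Ring.ltn_rmodpN0.
have E1 : mwiden (lead_coef g) ^+ k * last_var n h =
    last_var n d * last_var n g + last_var n r.
  rewrite -rmorphM -rmorphD -Ediv -mul_polyC rmorphM; congr (_ * _).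
  by rewrite last_varC rmorphXn.
have r0 : mmap j q (last_var n r) = 0.
  have := congr1 (mmap j q) E1; rewrite rmorphD !rmorphM /= h0 g0 !mulr0 add0r.
  by move=> <-.
have := congr1 (grad q) E1; rewrite gradD !gradM h0 g0 !scale0r !add0r.
rewrite rmorphXn /= mmap_mwiden => E2.
rewrite -[X in (X <= _)%MS](scalerK (expf_neq0 k l0)) E2.
apply: scalemx_sub; apply: addmx_sub.
  by apply: scalemx_sub; exact: addsmxSr.
apply: submx_trans (addsmxSl _ _); apply: grad_sub => //.
exact: (coef_vanish HS).
Qed.

End LastVariable.

(** Equivalently, the differentials of the field generated by [q] have dimension at
    least [e], in every characteristic. Each coordinate after the first [e] ones
    contributes at most one dimension to the gradients, by [grad_last_var]. *)
Lemma grad_span n e (q : 'I_n -> W) (le : (e <= n)%N) :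
  (forall p : mpoly e K, mmap j (fun i => q (widen_ord le i)) p = 0 -> p = 0) ->
  exists2 A : 'M[W]_n, (\rank A <= n - e)%N &
    forall f, mmap j q f = 0 -> (grad q f <= A)%MS.
Proof.
elim: n q le => [|n IH] q le.
  by move=> _; exists 0; [rewrite mxrank0 | move=> f _; rewrite [grad _ _]thinmx0 sub0mx].
have := le; rewrite [X in is_true X -> _]leq_eqVlt => /orP[/eqP en|en ind].
  subst e; move=> ind; exists 0; first by rewrite mxrank0.
  move=> f f0; rewrite (ind f); last first.
    by rewrite -[RHS]f0; apply: eq_mmap => // i; congr q; apply: val_inj.
  by rewrite (_ : grad q 0 = 0) ?sub0mx //; apply/rowP => i; rewrite !mxE !raddf0.
have le' : (e <= n)%N by rewrite -ltnS.
have [|A rA HA] := IH (fun i => q (widen_ord (leqnSn n) i)) le'.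
  move=> p p0; apply: ind; rewrite -[RHS]p0; apply: eq_mmap => // i.
  by congr q; apply: val_inj.
have [B rB HB] := grad_last_var HA; exists B => //.
by rewrite subSn // (leq_trans rB).
Qed.

Theorem jacobian_rank n e (q : 'I_n -> W) (le : (e <= n)%N) r (f : 'I_r -> mpoly n K) :
  (forall p : mpoly e K, mmap j (fun i => q (widen_ord le i)) p = 0 -> p = 0) ->
  (forall i, mmap j q (f i) = 0) ->
  (\rank (\matrix_(i < r, k < n) mmap j q (mderiv k (f i))) <= n - e)%N.
Proof.
move=> /grad_span[A rA HA] f0; apply: leq_trans rA; apply: mxrankS.
apply/row_subP => i; rewrite (_ : row i _ = grad q (f i)); first exact: HA.
by apply/rowP => k; rewrite !mxE.
Qed.

End Gradient.

(** * Formal power series *)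

Section PowerSeries.
Variable S : comNzRingType.

Record fps := Fps { fcoef : nat -> S }.

HB.instance Definition _ := gen_eqMixin fps.
HB.instance Definition _ := gen_choiceMixin fps.

Implicit Types a b c : fps.

Lemma fpsP a b : fcoef a =1 fcoef b -> a = b.
Proof. by case: a b => [f] [g] /= /funext ->. Qed.

Definition fps_add a b := Fps (fun i => fcoef a i + fcoef b i).
Definition fps_opp a := Fps (fun i => - fcoef a i).
Definition fps_of_poly (p : {poly S}) := Fps (fun i => p`_i).
Definition fps_mul a b := Fps (fun n => \sum_(i < n.+1) fcoef a i * fcoef b (n - i)).

Definition ftrunc n a : {poly S} := \poly_(i < n) fcoef a i.

Lemma coef_ftrunc n a i : (ftrunc n a)`_i = if (i < n)%N then fcoef a i else 0.
Proof. exact: coef_poly. Qed.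

(* the ring axioms are read off polynomial truncations *)
Let fps_mulE n a b i : (i < n)%N -> fcoef (fps_mul a b) i = (ftrunc n a * ftrunc n b)`_i.
Proof.
move=> lt_in; rewrite coefM; apply: eq_bigr => -[k Hk] _ /=.
by rewrite !coef_ftrunc (leq_trans Hk lt_in) (leq_ltn_trans (leq_subr _ _) lt_in).
Qed.

Let coefM_eq n (p p' q q' : {poly S}) : (forall i, (i < n)%N -> p`_i = p'`_i) ->
  (forall i, (i < n)%N -> q`_i = q'`_i) ->
  forall i, (i < n)%N -> (p * q)`_i = (p' * q')`_i.
Proof.
move=> pp qq i lt_in; rewrite !coefM; apply: eq_bigr => -[k Hk] _ /=.
by rewrite pp ?qq // ?(leq_trans Hk lt_in) // (leq_ltn_trans (leq_subr _ _)).
Qed.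

Let fps_addA : associative fps_add.
Proof. by move=> a b c; apply: fpsP => i /=; rewrite addrA. Qed.
Let fps_addC : commutative fps_add.
Proof. by move=> a b; apply: fpsP => i /=; rewrite addrC. Qed.
Let fps_add0 : left_id (fps_of_poly 0) fps_add.
Proof. by move=> a; apply: fpsP => i /=; rewrite coef0 add0r. Qed.
Let fps_addN : left_inverse (fps_of_poly 0) fps_opp fps_add.
Proof. by move=> a; apply: fpsP => i /=; rewrite addNr coef0. Qed.

HB.instance Definition _ :=
  GRing.isZmodule.Build fps fps_addA fps_addC fps_add0 fps_addN.

Let fps_mulA : associative fps_mul.
Proof.
move=> a b c; apply: fpsP => n; rewrite !(@fps_mulE n.+1) //.
have tr d e i : (i < n.+1)%N ->
    (ftrunc n.+1 (fps_mul d e))`_i = (ftrunc n.+1 d * ftrunc n.+1 e)`_i.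
  by move=> H; rewrite coef_ftrunc H (@fps_mulE n.+1).
transitivity (ftrunc n.+1 a * (ftrunc n.+1 b * ftrunc n.+1 c))`_n.
  by apply: (@coefM_eq n.+1) => // i H; exact: tr.
by rewrite mulrA; apply: (@coefM_eq n.+1) => // i H; rewrite tr.
Qed.
Let fps_mulC : commutative fps_mul.
Proof. by move=> a b; apply: fpsP => n; rewrite !(@fps_mulE n.+1) // mulrC. Qed.
Let fps_mul1 : left_id (fps_of_poly 1) fps_mul.
Proof.
move=> a; apply: fpsP => n; rewrite (@fps_mulE n.+1) //.
transitivity (1 * ftrunc n.+1 a)`_n; last by rewrite mul1r coef_ftrunc leqnn.
by apply: (@coefM_eq n.+1) => // i H; rewrite coef_ftrunc H.
Qed.
Let fps_mulDl : left_distributive fps_mul fps_add.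
Proof.
move=> a b c; apply: fpsP => n /=; rewrite -big_split; apply: eq_bigr => i _.
by rewrite /= mulrDl.
Qed.
Let fps_oner_neq0 : fps_of_poly 1 != 0 :> fps.
Proof.
apply/eqP => /(congr1 (fun a => fcoef a 0)) /eqP.
by rewrite /= coef1 coef0 oner_eq0.
Qed.

HB.instance Definition _ := GRing.Zmodule_isComNzRing.Build fps
  fps_mulA fps_mulC fps_mul1 fps_mulDl fps_oner_neq0.

Lemma fcoefD i a b : fcoef (a + b) i = fcoef a i + fcoef b i. Proof. by []. Qed.
Lemma fcoefN i a : fcoef (- a) i = - fcoef a i. Proof. by []. Qed.
Lemma fcoefB i a b : fcoef (a - b) i = fcoef a i - fcoef b i. Proof. by []. Qed.
Lemma fcoef0 i : fcoef 0 i = 0. Proof. exact: coef0. Qed.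
Lemma fcoefM n a b : fcoef (a * b) n = \sum_(i < n.+1) fcoef a i * fcoef b (n - i).
Proof. by []. Qed.

Lemma fcoefM_ftrunc n a b i : (i < n)%N ->
  fcoef (a * b) i = (ftrunc n a * ftrunc n b)`_i.
Proof. exact: fps_mulE. Qed.

Lemma fcoef_sum i I r (P : pred I) (f : I -> fps) :
  fcoef (\sum_(k <- r | P k) f k) i = \sum_(k <- r | P k) fcoef (f k) i.
Proof. exact: (big_morph (fun a => fcoef a i) (fcoefD i) (fcoef0 i)). Qed.

Let fps_of_poly_additive : zmod_morphism fps_of_poly.
Proof. by move=> p q; apply: fpsP => i /=; rewrite coefB. Qed.
Let fps_of_poly_multiplicative : monoid_morphism fps_of_poly.
Proof. by split=> [//|p q]; apply: fpsP => i /=; rewrite coefM. Qed.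
HB.instance Definition _ :=
  GRing.isZmodMorphism.Build {poly S} fps fps_of_poly fps_of_poly_additive.
HB.instance Definition _ :=
  GRing.isMonoidMorphism.Build {poly S} fps fps_of_poly fps_of_poly_multiplicative.

Definition fpsC : {rmorphism S -> fps} := fps_of_poly \o polyC.
Definition fpsX : fps := fps_of_poly 'X.

Lemma fpsCD s t : fpsC (s + t) = fpsC s + fpsC t. Proof. exact: rmorphD. Qed.
Lemma fpsCM s t : fpsC (s * t) = fpsC s * fpsC t. Proof. exact: rmorphM. Qed.

Lemma fcoefC s i : fcoef (fpsC s) i = if i == 0%N then s else 0.
Proof. exact: coefC. Qed.

Lemma fcoefX i : fcoef fpsX i = (i == 1%N)%:R.
Proof. exact: coefX. Qed.

Lemma fcoefCM s a i : fcoef (fpsC s * a) i = s * fcoef a i.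
Proof.
rewrite fcoefM big_ord_recl fcoefC eqxx subn0 big1 ?addr0 // => k _.
by rewrite fcoefC mul0r.
Qed.

Lemma fcoefXnC e s d : fcoef (fpsX ^+ e * fpsC s) d = if d == e then s else 0.
Proof.
have -> : fpsX ^+ e = fps_of_poly 'X^e by rewrite rmorphXn.
by rewrite mulrC fcoefCM /= coefXn; case: (d == e); rewrite ?mulr1 ?mulr0.
Qed.

(** Divisibility by the [N]-th power of the variable. *)
Definition tdvd N a := forall i, (i < N)%N -> fcoef a i = 0.

Lemma tdvdD N a b : tdvd N a -> tdvd N b -> tdvd N (a + b).
Proof. by move=> ha hb i iN; rewrite fcoefD ha // hb // addr0. Qed.

Lemma tdvdN N a : tdvd N a -> tdvd N (- a).
Proof. by move=> ha i iN; rewrite fcoefN ha // oppr0. Qed.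

Lemma tdvdM N M a b : tdvd N a -> tdvd M b -> tdvd (N + M) (a * b).
Proof.
move=> ha hb n nNM; rewrite fcoefM big1 // => i _.
have [iN|Ni] := ltnP i N; first by rewrite ha // mul0r.
rewrite hb ?mulr0 // ltn_subLR; last by rewrite -ltnS.
by rewrite (leq_trans nNM) // leq_add2r.
Qed.

Lemma tdvd_sub N M a : (M <= N)%N -> tdvd N a -> tdvd M a.
Proof. by move=> MN ha i iM; apply: ha; rewrite (leq_trans iM). Qed.

Lemma fcoef0M a b : fcoef (a * b) 0 = fcoef a 0 * fcoef b 0.
Proof. by rewrite fcoefM big_ord1. Qed.

Definition fcst a := fcoef a 0.
Let fcst_additive : zmod_morphism fcst. Proof. by []. Qed.
Let fcst_multiplicative : monoid_morphism fcst.
Proof. by split; [exact: coefC | exact: fcoef0M]. Qed.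
HB.instance Definition _ := GRing.isZmodMorphism.Build fps S fcst fcst_additive.
HB.instance Definition _ := GRing.isMonoidMorphism.Build fps S fcst fcst_multiplicative.

Lemma tdvd_trunc N a :
  tdvd N (a - \sum_(d < N) fpsX ^+ d * fpsC (fcoef a d)).
Proof.
move=> d dN; rewrite fcoefB fcoef_sum (bigD1 (Ordinal dN)) // big1 => [|e ed].
  by rewrite fcoefXnC /= eqxx addr0 subrr.
rewrite fcoefXnC; case: eqP => // de; case/eqP: ed.
exact: val_inj.
Qed.

Lemma fcoef_lowM N M a b : tdvd N a -> tdvd M b ->
  fcoef (a * b) (N + M) = fcoef a N * fcoef b M.
Proof.
move=> ha hb; have HN : (N < (N + M).+1)%N by rewrite ltnS leq_addr.
rewrite fcoefM (bigD1 (Ordinal HN)) //= addKn big1 ?addr0 // => -[i Hi] /= iN.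
have [iN'|Ni] := ltnP i N; first by rewrite ha // mul0r.
rewrite hb ?mulr0 // ltn_subLR // ltn_add2r ltn_neqAle Ni andbT eq_sym.
exact: iN.
Qed.

End PowerSeries.

Lemma tord (S : comNzRingType) (a : fps S) : a != 0 ->
  exists N, tdvd N a /\ fcoef a N != 0.
Proof.
move=> a0; have H : exists N, fcoef a N != 0.
  apply: contrapT => H; case/eqP: a0; apply: fpsP => i; rewrite fcoef0.
  by apply/eqP; apply: contrapT => /negP ai; apply: H; exists i.
exists (ex_minn H); case: ex_minnP => N aN Nmin; split=> // i iN.
by apply/eqP; apply: contraTT iN => /Nmin; rewrite -leqNgt.
Qed.

Section PowerSeriesDomain.
Variable S : idomainType.

Let fps_idomain (a b : fps S) : a * b = 0 -> (a == 0) || (b == 0).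
Proof.
move=> ab0; apply/norP => -[/tord[N [ha aN]] /tord[M [hb bM]]].
have /eqP := fcoef_lowM ha hb; rewrite ab0 fcoef0 eq_sym mulf_eq0.
by rewrite (negPf aN) (negPf bM).
Qed.

Let fps_unit : pred (fps S) := fun a => `[< exists b, b * a = 1 >].
Let fps_inv (a : fps S) : fps S :=
  if pselect (exists b, b * a = 1) is left H then projT1 (cid H) else a.

Let fps_mulV : {in fps_unit, left_inverse 1 fps_inv *%R}.
Proof.
move=> a /asboolP H; rewrite /fps_inv; case: pselect => // H'.
by case: (cid H').
Qed.
Let fps_unitP (a b : fps S) : b * a = 1 -> fps_unit a.
Proof. by move=> ba; apply/asboolP; exists b. Qed.
Let fps_inv_out : {in [predC fps_unit], fps_inv =1 id}.
Proof.
move=> a /negP Ha; rewrite /fps_inv; case: pselect => // H.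
by case: Ha; apply/asboolP.
Qed.

HB.instance Definition _ := GRing.ComNzRing_hasMulInverse.Build (fps S)
  fps_mulV fps_unitP fps_inv_out.
HB.instance Definition _ := GRing.ComUnitRing_isIntegral.Build (fps S) fps_idomain.

End PowerSeriesDomain.

(** * Implicit functions *)

(** The estimates below serve for three filtrations: by the powers of the variable
    of power series, by the powers of a ring element, and by the powers of the
    maximal ideal of a point on the model, pulled back to polynomials. *)
Section Filtration.
Variables (E : comNzRingType) (J : nat -> E -> Prop).

Definition filtration := [/\ forall a, J 0 a, forall N, J N 0,
  forall N a b, J N a -> J N b -> J N (a - b),
  forall N M a b, J N a -> J M b -> J (N + M)%N (a * b) &
  forall N M a, (M <= N)%N -> J N a -> J M a].

Hypothesis HJ : filtration.

Lemma filtB N a b : J N a -> J N b -> J N (a - b).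
Proof. by case: HJ => _ _ + _ _; apply. Qed.

Lemma filtN N a : J N a -> J N (- a).
Proof. by move=> Ja; rewrite -sub0r; apply: filtB => //; case: HJ. Qed.

Lemma filtD N a b : J N a -> J N b -> J N (a + b).
Proof. by move=> Ja /filtN Jb; rewrite -[b]opprK; exact: filtB. Qed.

Lemma filtM N M a b : J N a -> J M b -> J (N + M)%N (a * b).
Proof. by case: HJ => _ _ _ + _; apply. Qed.

Lemma filtMl N a b : J N b -> J N (a * b).
Proof. by move=> Jb; rewrite -[N]add0n; apply: filtM => //; case: HJ. Qed.

Lemma filt_sum N I r (P : pred I) f : (forall i, P i -> J N (f i)) ->
  J N (\sum_(i <- r | P i) f i).
Proof.
by move=> Jf; elim/big_ind: _ => //; [case: HJ | exact: filtD].
Qed.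

Lemma filt_le N M a : (M <= N)%N -> J N a -> J M a.
Proof. by case: HJ => _ _ _ _; apply. Qed.

Variables (K : comNzRingType) (j : {rmorphism K -> E}).

Lemma filt_mord n (h : 'I_n -> E) p N : (forall i, J 1 (h i)) ->
  mord_ge N p -> J N (mmap j h p).
Proof.
move=> Jh hp; apply: filt_sum => m _.
have [mN|Nm] := ltnP (mdeg m) N.
  by rewrite hp // rmorph0 mul0r; case: HJ.
apply: filtMl; apply: filt_le Nm _; rewrite mdegE /mmap1.
elim/big_rec2: _ => [|i a b _ IH]; first by case: HJ.
apply: filtM => //; elim: (m i) => [|e IHe]; first by case: HJ.
by rewrite exprS -add1n; apply: filtM.
Qed.

Lemma filt_cst n (h : 'I_n -> E) p : (forall i, J 1 (h i)) ->
  J 1 (mmap j h p - j (mcst p)).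
Proof.
move=> Jh; rewrite -[j _](mmapC h) -mmapB; apply: filt_mord => //.
by apply: mord_ge1; rewrite mcoeffB mcoeffC eqxx mulr1 subrr.
Qed.

(** First-order Taylor expansion at the origin: the quadratic terms gain one order
    because [a] and [b] have order at least 1. *)
Lemma filt_taylor n (a b : 'I_n -> E) N p :
  (forall i, J 1 (a i)) -> (forall i, J 1 (b i)) -> (forall i, J N (a i - b i)) ->
  J N.+1 (mmap j a p - mmap j b p - \sum_i j (mcst (mderiv i p)) * (a i - b i)).
Proof.
move=> Ja Jb Jab; pose L p := \sum_i j (mcst (mderiv i p)) * (a i - b i).
have JL q : J N (L q) by apply: filt_sum => i _; apply: filtMl.
rewrite -/(L p); elim/mpoly_ring_ind: p => [c|i|p q IHp IHq|p q IHp IHq].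
- rewrite !mmapC subrr sub0r /L big1 ?oppr0 => [|i _]; first by case: HJ.
  by rewrite mderivC mcoeff0 rmorph0 mul0r.
- rewrite !mmapXU /L (bigD1 i) //= big1 => [|k ki]; last first.
    by rewrite mderiv_mX eq_sym (negPf ki) /= mulr0n mcoeffC mul0r rmorph0 mul0r.
  rewrite mderiv_mX eqxx /= mulr1n mcoeffC eqxx mulr1 rmorph1 mul1r addr0 subrr.
  by case: HJ.
- have -> : mmap j a (p + q) - mmap j b (p + q) - L (p + q) =
    (mmap j a p - mmap j b p - L p) + (mmap j a q - mmap j b q - L q).
    have -> : L (p + q) = L p + L q.
      rewrite /L -big_split; apply: eq_bigr => i _.
      by rewrite mderivD mcoeffD rmorphD mulrDl.
    by rewrite !mmapD; ring.
  exact: filtD.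
- have -> : mmap j a (p * q) - mmap j b (p * q) - L (p * q) =
    mmap j a p * (mmap j a q - mmap j b q - L q)
    + (mmap j a p - j (mcst p)) * L q
    + mmap j b q * (mmap j a p - mmap j b p - L p)
    + (mmap j b q - j (mcst q)) * L p.
    have -> : L (p * q) = j (mcst p) * L q + j (mcst q) * L p.
      rewrite /L !mulr_sumr -big_split; apply: eq_bigr => i _.
      by rewrite mderivM mcoeffD !rmorphM rmorphD !rmorphM /=; ring.
    by rewrite !mmapM; ring.
  have S1 : (N.+1 = 1 + N)%N by [].
  by apply: filtD; [apply: filtD; [apply: filtD|]|];
    [exact: filtMl | rewrite S1; apply: filtM => //; exact: filt_cst
    |exact: filtMl | rewrite S1; apply: filtM => //; exact: filt_cst].
Qed.

Lemma filt_lipschitz n (a b : 'I_n -> E) N p :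
  (forall i, J N (a i - b i)) -> J N (mmap j a p - mmap j b p).
Proof.
move=> Jab; elim/mpoly_ring_ind: p => [c|i|p q IHp IHq|p q IHp IHq].
- by rewrite !mmapC subrr; case: HJ.
- by rewrite !mmapXU.
- by rewrite !mmapD opprD addrACA; exact: filtD.
- have -> : mmap j a (p * q) - mmap j b (p * q) =
    mmap j a p * (mmap j a q - mmap j b q) + mmap j b q * (mmap j a p - mmap j b p).
    by rewrite !mmapM; ring.
  by apply: filtD; exact: filtMl.
Qed.

End Filtration.

Definition join_coord (T : Type) n s (x : 'I_n -> T) (z : 'I_s -> T) (i : 'I_(n + s)) :=
  match fintype.split i with inl a => x a | inr b => z b end.

Lemma join_coordl T n s (x : 'I_n -> T) (z : 'I_s -> T) i :
  join_coord x z (lshift s i) = x i.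
Proof.
rewrite /join_coord; case: split_ordP => k /eqP; rewrite ?eq_lshift ?eq_lrshift //.
by move=> /eqP->.
Qed.

Lemma join_coordr T n s (x : 'I_n -> T) (z : 'I_s -> T) i :
  join_coord x z (rshift n i) = z i.
Proof.
rewrite /join_coord; case: split_ordP => k /eqP; rewrite ?eq_rshift ?eq_rlshift //.
by move=> /eqP->.
Qed.

Lemma join_coordP (T : Type) n s (x : 'I_n -> T) (z : 'I_s -> T) (P : T -> Prop) :
  (forall i, P (x i)) -> (forall i, P (z i)) -> forall i, P (join_coord x z i).
Proof.
by move=> Px Pz i; case: (split_ordP i) => k ->; rewrite ?join_coordl ?join_coordr.
Qed.

Lemma comp_join (T U : Type) n s (g : T -> U) (x : 'I_n -> T) (z : 'I_s -> T) i :
  g (join_coord x z i) = join_coord (g \o x) (g \o z) i.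
Proof. by rewrite /join_coord; case: fintype.split. Qed.

(** The equations [f l (x, z) = 0] can be solved for [z] as functions of [x]
    near the origin. *)
Definition solvable_system (K : nzRingType) n s (f : 'I_s -> mpoly (n + s) K) :=
  (forall l, mcst (f l) = 0) /\
  (forall l k, mcst (mderiv (rshift n k) (f l)) = (l == k)%:R).

Section Approximation.
Variables (K : comNzRingType) (n s : nat) (f : 'I_s -> mpoly (n + s) K).

(** Newton's iteration [z - f (x, z)] for the equation [f (x, z) = 0]. The Jacobian
    matrix in [z] is the identity at the origin, so it is not inverted in each step,
    and the iterates are polynomials in [x]. *)
Fixpoint approx (E : comNzRingType) (j : K -> E) (x : 'I_n -> E) N : 'I_s -> E :=
  if N is N'.+1 then
    fun l => approx j x N' l - mmap j (join_coord x (approx j x N')) (f l)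
  else fun=> 0.

Lemma rmorph_approx (E E' : comNzRingType) (g : {rmorphism E -> E'}) j x N l :
  g (approx j x N l) = approx (g \o j) (g \o x) N l.
Proof.
elim: N l => [|N IH] l /=; first exact: rmorph0.
rewrite rmorphB IH rmorph_mmap; congr (_ - _); apply: eq_mmap => // i.
rewrite [LHS]comp_join /join_coord; case: fintype.split => // k /=; exact: IH.
Qed.

Lemma eq_approx (E : comNzRingType) (j j' : K -> E) x x' N l : j =1 j' -> x =1 x' ->
  approx j x N l = approx j' x' N l.
Proof.
move=> jj xx; elim: N l => //= N IH l; rewrite IH; congr (_ - _).
by apply: eq_mmap => // i; rewrite /join_coord; case: fintype.split.
Qed.

Hypothesis Hf : solvable_system f.

Section InRing.
Variables (E : comNzRingType) (J : nat -> E -> Prop) (HJ : filtration J).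
Variables (j : {rmorphism K -> E}) (x : 'I_n -> E).
Hypothesis Jx : forall i, J 1 (x i).

Let J0 N : J N 0. Proof. by case: HJ. Qed.

Let f_in1 z l : (forall l, J 1 (z l)) -> J 1 (mmap j (join_coord x z) (f l)).
Proof.
move=> Jz; have := filt_cst HJ j (f l) (join_coordP Jx Jz).
by rewrite (proj1 Hf) rmorph0 subr0.
Qed.

(** Newton's step [z - f (x, z)] is a contraction. *)
Let contract N z z' : (forall l, J 1 (z l)) -> (forall l, J 1 (z' l)) ->
  (forall l, J N (z l - z' l)) ->
  forall l, J N.+1 ((z l - mmap j (join_coord x z) (f l)) -
                    (z' l - mmap j (join_coord x z') (f l))).
Proof.
move=> Jz Jz' Jzz l.
have Jd i : J N (join_coord x z i - join_coord x z' i).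
  case: (split_ordP i) => k ->; rewrite ?join_coordl ?join_coordr //.
  by rewrite subrr.
have := filt_taylor HJ j (f l) (join_coordP Jx Jz) (join_coordP Jx Jz') Jd.
move=> /(filtN HJ); congr (J _ _).
rewrite big_split_ord /= [X in _ - (X + _)]big1 => [|i _]; last first.
  by rewrite !join_coordl subrr mulr0.
rewrite (bigD1 l) //= big1 => [|k kl]; last first.
  by rewrite (proj2 Hf) eq_sym (negPf kl) rmorph0 mul0r.
rewrite (proj2 Hf) eqxx rmorph1 !join_coordr; ring.
Qed.

Lemma approx_in1 N l : J 1 (approx j x N l).
Proof.
elim: N l => [|N IH] l /=; first exact: J0.
by apply: (filtB HJ) => //; exact: f_in1.
Qed.

(** A solution of order at least 1 is a fixed point of the contraction, hence the
    limit of the iterates. *)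
Lemma approx_close z : (forall l, J 1 (z l)) ->
  (forall N l, J N (mmap j (join_coord x z) (f l))) ->
  forall N l, J N.+1 (z l - approx j x N l).
Proof.
move=> Jz fz; elim=> [|N IH] l; first by rewrite /= subr0.
have := contract Jz (approx_in1 N) IH l => /(filtD HJ)/(_ (fz N.+2 l)).
by congr (J _ _) => /=; ring.
Qed.

Lemma approx_cauchy N M l : (N <= M)%N -> J N.+1 (approx j x M l - approx j x N l).
Proof.
have step P k : J P.+1 (approx j x P.+1 k - approx j x P k).
  elim: P k => [|P IH] k.
    by rewrite /= subr0 sub0r; apply: (filtN HJ); apply: f_in1 => ?.
  exact: (contract (approx_in1 P.+1) (approx_in1 P) IH k).
elim: M => [|M IH]; first by rewrite leqn0 => /eqP->; rewrite subrr.
rewrite leq_eqVlt ltnS => /orP[/eqP->|NM]; first by rewrite subrr.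
rewrite -[X in X - _](subrK (approx j x M l)) -addrA; apply: (filtD HJ); last exact: IH.
by apply: (filt_le HJ) (step M l).
Qed.

End InRing.

End Approximation.

(** * The implicit power series and the kernel of the evaluation at them *)

Lemma tdvd_filtration (S : comNzRingType) : filtration (@tdvd S).
Proof.
split=> //; first by move=> N i _; rewrite fcoef0.
- by move=> N a b ha hb; apply: tdvdD => //; exact: tdvdN.
- exact: tdvdM.
- exact: tdvd_sub.
Qed.

Section ImplicitSeries.
Variables (K : comNzRingType) (n s : nat) (f : 'I_s -> mpoly (n + s) K).
Hypothesis Hf : solvable_system f.
Variables (S : comNzRingType) (phi : {rmorphism K -> S}) (xi : 'I_n -> fps S).
Hypothesis Hxi : forall i, tdvd 1 (xi i).

Let j : {rmorphism K -> fps S} := fpsC S \o phi.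

(** The limit of the iterates, which are constant in degree [d] from the [d]-th on. *)
Definition implicit_series l : fps S := Fps (fun d => fcoef (approx f j xi d l) d).

Lemma implicit_approx N l : tdvd N.+1 (implicit_series l - approx f j xi N l).
Proof.
move=> d dN; rewrite fcoefB /=; apply/eqP; rewrite subr_eq0 eq_sym -subr_eq0.
rewrite -fcoefB; apply/eqP.
by apply: (approx_cauchy Hf (@tdvd_filtration S) j Hxi l (_ : (d <= N)%N)).
Qed.

Definition series_coord := join_coord xi implicit_series.
Definition series_eval : {rmorphism mpoly (n + s) K -> fps S} := mmap j series_coord.

Lemma series_coord1 i : tdvd 1 (series_coord i).
Proof.
apply: join_coordP => // l.
by have := @implicit_approx 0 l; rewrite /= subr0.
Qed.

Lemma series_evalC c : series_eval (mC c) = fpsC S (phi c).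
Proof. exact: mmapC. Qed.

Lemma series_evalX i : series_eval (mX i) = series_coord i.
Proof. exact: mmapXU. Qed.

(** The iterates over the polynomials in the first [n] variables, substituted in
    [p]. These polynomials do not depend on the ring in which [p] is evaluated, and
    so compare the evaluations at different series, and at [y]. *)
Definition approx_subst N (p : mpoly (n + s) K) : mpoly n K :=
  mmap (@mpolyC n K) (join_coord (fun i => mX i) (approx f (@mpolyC n K) (fun i => mX i) N)) p.

Lemma mmap_approx_subst (E : comNzRingType) (h : {rmorphism K -> E}) (x : 'I_n -> E) N p :
  mmap h x (approx_subst N p) = mmap h (join_coord x (approx f h x N)) p.
Proof.
rewrite mmap_mmap; apply: eq_mmap => // i; rewrite [LHS]comp_join /join_coord.
case: fintype.split => k /=; first by rewrite mmapXU.
rewrite rmorph_approx; apply: eq_approx => c /=; first exact: mmapC.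
by rewrite mmapXU.
Qed.

Lemma series_eval_approx N p :
  tdvd N.+1 (series_eval p - mmap j xi (approx_subst N p)).
Proof.
rewrite mmap_approx_subst; apply: (filt_lipschitz (@tdvd_filtration S)).
move=> i; rewrite /series_coord /join_coord; case: fintype.split => k.
  by move=> d _; rewrite subrr fcoef0.
exact: implicit_approx.
Qed.

Lemma series_eval_f l : series_eval (f l) = 0.
Proof.
apply: fpsP => N; rewrite fcoef0.
have := @series_eval_approx N (f l) N (leqnn _).
have := @approx_cauchy _ _ _ _ Hf _ _ (@tdvd_filtration S) j xi Hxi N N.+1 l (leqnSn N) N (leqnn _).
rewrite mmap_approx_subst /= addrAC subrr add0r.
by move=> /eqP; rewrite oppr_eq0 => /eqP->; rewrite subr0.
Qed.

End ImplicitSeries.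

Section LinearSubstitution.
Variables (K S : comNzRingType) (phi : {rmorphism K -> S}) (n : nat) (u : 'I_n -> S).

(** Along the line [u t] the coefficient of [t^d] is the homogeneous part of
    degree [d]. *)
Lemma fcoef_linear_subst (G : mpoly n K) d :
  fcoef (mmap (fpsC S \o phi) (fun i => fpsC S (u i) * fpsX S) G) d =
  \sum_(m <- msupp G | mdeg m == d) phi (mcoeff m G) * mmap1 u m.
Proof.
rewrite /mmap fcoef_sum [RHS]big_mkcond; apply: eq_bigr => m _.
have -> : mmap1 (fun i => fpsC S (u i) * fpsX S) m =
    fpsC S (mmap1 u m) * fps_of_poly 'X^(mdeg m).
  rewrite mdegE /mmap1 rmorph_prod -prodrXr rmorph_prod -big_split.
  by apply: eq_bigr => i _; rewrite exprMn !rmorphXn.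
rewrite [LHS]fcoefCM fcoefCM /= coefXn eq_sym.
by case: eqP => _; rewrite /= ?mulr1 ?mulr0 ?mulr0.
Qed.

End LinearSubstitution.

Section KernelGeneric.
Variables (K F : fieldType) (iota : {rmorphism K -> F}) (n s : nat).
Variables (y : 'I_(n + s) -> F) (f : 'I_s -> mpoly (n + s) K).
Hypothesis Hf : solvable_system f.
Hypothesis fy : forall l, mmap iota y (f l) = 0.
Hypothesis aug : forall p, mcst p != 0 -> mmap iota y p != 0.

Let S0 := mpoly n K.
Let xi0 (i : 'I_n) : fps S0 := fpsC S0 (mX i) * fpsX S0.
Let Hxi0 i : tdvd 1 (xi0 i).
Proof.
by move=> d; rewrite ltnS leqn0 => /eqP->; rewrite fcoef0M fcoefX mulr0.
Qed.
(** The evaluation at the line of direction [(X_1, .., X_n)], which keeps every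
    monomial of a polynomial in the first [n] variables apart. *)
Definition generic_eval : {rmorphism mpoly (n + s) K -> fps S0} :=
  series_eval f (@mpolyC n K) xi0.

Let mcoeff_xi0 (G : mpoly n K) m :
  mcoeff m (fcoef (mmap (fpsC S0 \o @mpolyC n K) xi0 G) (mdeg m)) = mcoeff m G.
Proof.
rewrite fcoef_linear_subst raddf_sum [in RHS](mpolyE G) raddf_sum /= big_mkcond.
apply: eq_bigr => m' _; rewrite mcoeffZ mcoeffX.
have -> : mmap1 (fun i => mX i) m' = mpolyX K m' by rewrite [RHS]mpolyXE_id.
case: eqP => [_|mm']; first by rewrite mcoeffCM mcoeffX.
by case: eqP mm' => [->//|_ _]; rewrite /= mulr0.
Qed.

Lemma generic_eval_mord p :
  generic_eval p = 0 -> forall N, mord_ge N.+1 (approx_subst f N p).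
Proof.
move=> p0 N m mN; have := series_eval_approx Hf (@mpolyC n K) Hxi0 p mN.
rewrite [series_eval _ _ _ _](p0 : _ = 0) sub0r fcoefN => /eqP.
by rewrite oppr_eq0 => /eqP G0; rewrite -[LHS]mcoeff_xi0 G0 mcoeff0.
Qed.

(** If the generic series of [p] is zero, its approximations have arbitrarily high
    order at the origin, which every series of positive order respects. *)
Lemma generic_eval_series_eval (S : comNzRingType) (phi : {rmorphism K -> S}) xi p :
  (forall i, tdvd 1 (xi i)) -> generic_eval p = 0 -> series_eval f phi xi p = 0.
Proof.
move=> Hxi /generic_eval_mord Hp; apply: fpsP => N; rewrite fcoef0.
have := series_eval_approx Hf phi Hxi p (leqnn N.+1).
have G0 : tdvd N.+1 (mmap (fpsC S \o phi) xi (approx_subst f N p)).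
  by apply: (filt_mord (@tdvd_filtration S)).
by rewrite fcoefB [X in _ - X]G0 // subr0.
Qed.

(* powers of the maximal ideal, pulled back from the local ring of y *)
Let J N (p : mpoly (n + s) K) := exists2 p', mord_ge N p' & mmap iota y p' = mmap iota y p.

Let J_filtration : filtration J.
Proof.
split=> [p|N|N a b [p Hp E] [q Hq E']|N M a b [p Hp E] [q Hq E']|N M a MN [p Hp E]].
- by exists p.
- by exists 0 => // m _; rewrite mcoeff0.
- exists (p - q); last by rewrite !mmapB E E'.
  by apply: mord_geD => //; exact: mord_geN.
- by exists (p * q); [exact: mord_geM | rewrite !mmapM E E'].
- by exists p => // m mM; apply: Hp; rewrite (leq_trans mM).
Qed.

(** Such a [p] lies in all powers of the maximal ideal of the local ring: it agrees
    with its approximations, since [y] satisfies the equations, and these have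
    arbitrarily high order. *)
Lemma generic_eval_ker p : generic_eval p = 0 -> mmap iota y p = 0.
Proof.
move=> p0; apply: (krull_intersection aug) => N.
suff [q Hq E] : J N.+1 p by exists q => // m mN; apply: Hq; rewrite ltnW.
pose x i : mpoly (n + s) K := mX (lshift s i).
pose z l : mpoly (n + s) K := mX (rshift n l).
have JX i : J 1 (mX i) by exists (mX i) => //; exact: mord_ge1X.
have Jx i : J 1 (x i) by exact: JX.
have idE q : mmap (@mpolyC _ K) (join_coord x z) q = q.
  rewrite -[RHS]mmap_id; apply: eq_mmap => // i.
  by case: (split_ordP i) => k ->; rewrite ?join_coordl ?join_coordr.
have clo := approx_close Hf J_filtration (j := @mpolyC _ K) Jx (z := z).
have : J N.+1 (p - mmap (@mpolyC _ K) x (approx_subst f N p)).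
  rewrite -{1}(idE p) mmap_approx_subst; apply: (filt_lipschitz J_filtration) => i.
  case: (split_ordP i) => k ->; rewrite ?join_coordl ?join_coordr.
    by rewrite subrr; exists 0; rewrite ?mmap0 // => m _; rewrite mcoeff0.
  apply: clo => [l|M l]; first exact: JX.
  by rewrite idE; exists 0; rewrite ?mmap0 ?fy // => m _; rewrite mcoeff0.
move=> /(filtD J_filtration); rewrite -[p in J _ p](subrK (mmap (@mpolyC _ K) x (approx_subst f N p))).
by apply; apply: (filt_mord J_filtration) => //; exact: generic_eval_mord.
Qed.

End KernelGeneric.

Lemma mulr_divK_subr0 (W : fieldType) (x z : W) : x != 0 -> x * (z / x) - z = 0.
Proof. by move=> x0; rewrite mulrC divfK // subrr. Qed.

(** A relation among elements of a field of which the last is not [0] may be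
    divided by a power of the last variable, until it is not lost by setting
    that variable to [0]. *)
Lemma relation_at0 (K W : fieldType) (j : {rmorphism K -> W}) n (q : 'I_n.+1 -> W) R :
  q ord_max != 0 -> R != 0 -> mmap j q R = 0 ->
  exists (R' : mpoly n.+1 K) (h0 : mpoly n K), [/\ h0 != 0, mmap j q R' = 0 &
    forall (E : comNzRingType) (j' : {rmorphism K -> E}) (q' : 'I_n.+1 -> E),
      q' ord_max = 0 -> mmap j' q' R' = mmap j' (fun i => q' (widen_ord (leqnSn n) i)) h0].
Proof.
move=> q0 R0 Rq; pose P s := `[< exists h : {poly mpoly n K},
  [/\ size h = s, h != 0 & mmap j q (last_var K n h) = 0] >].
have HP : exists s, P s.
  have [h hR] := last_var_surj R; exists (size h); apply/asboolP; exists h.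
  split=> //; last by rewrite hR.
  by apply: contraNneq R0 => h0; rewrite -hR h0 rmorph0.
case: (ex_minnP HP) => s /asboolP[h [hs hn0 hq]] smin.
exists (last_var K n h), h`_0; split=> //.
  apply/eqP => h00; have /factor_theorem[h' hE] : root h 0.
    by rewrite /root horner_coef0 h00.
  have h'n0 : h' != 0 by apply: contraNneq hn0 => h'0; rewrite hE h'0 mul0r.
  have : P (size h').
    apply/asboolP; exists h'; split=> //; move: hq.
    rewrite hE subr0 rmorphM mmapM => /eqP; rewrite mulf_eq0 => /orP[/eqP //|].
    rewrite [last_var _ _ 'X](_ : _ = mX ord_max).
      by rewrite mmapXU (negPf q0).
    by rewrite /last_var /= map_polyX horner_evalE hornerX.
  by move=> /smin; rewrite -hs hE subr0 size_mulX // ltnn.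
move=> E j' q' q'0; rewrite last_varE raddf_sum /= -mmap_mwiden.
case sh: (size h) => [|m]; first by move: hn0; rewrite -size_poly_eq0 sh.
rewrite big_ord_recl big1 => [|i _]; rewrite mmapM rmorphXn /= mmapXU q'0.
  by rewrite expr0 mulr1 addr0.
by rewrite expr0n mulr0.
Qed.

(** The relation has a common denominator: its two sides are fractions of the
    values of the same two elements of [A], and the numerator is in the kernel of
    [h]. *)
Lemma fraction_relation (K W F : fieldType) (A : comNzRingType)
    (c : {rmorphism K -> A}) (h : {rmorphism A -> W}) (e : {rmorphism A -> F})
    k (a b : 'I_k -> A) R :
  (forall p, h p = 0 -> e p = 0) -> (forall i, e (b i) != 0) ->
  mmap (h \o c) (fun i => h (a i) / h (b i)) R = 0 ->
  mmap (e \o c) (fun i => e (a i) / e (b i)) R = 0.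
Proof.
move=> he b0; have ne0 p : e p != 0 -> h p != 0 by apply: contra_neq => /he.
have [p [q [nq -> ->]]] : exists p q, [/\ e q != 0,
    mmap (h \o c) (fun i => h (a i) / h (b i)) R = h p / h q &
    mmap (e \o c) (fun i => e (a i) / e (b i)) R = e p / e q].
  elim/mpoly_ring_ind: R => [r|i|p q [p1 [p2 [np pW pF]]] [q1 [q2 [nq qW qF]]]
      |p q [p1 [p2 [np pW pF]]] [q1 [q2 [nq qW qF]]]].
  - by exists (c r), 1; rewrite !rmorph1 oner_eq0 !mmapC !divr1.
  - by rewrite !mmapXU; exists (a i), (b i).
  - exists (p1 * q2 + q1 * p2), (p2 * q2).
    rewrite !mmapD pW pF qW qF !(rmorphM, rmorphD) mulf_neq0 //.
    by rewrite !addf_div // ne0.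
  - exists (p1 * q1), (p2 * q2); rewrite !mmapM pW pF qW qF !rmorphM mulf_neq0 //.
    by rewrite !mulf_div.
move=> /eqP; rewrite mulf_eq0 invr_eq0 (negPf (ne0 _ nq)) orbF => /eqP /he ->.
by rewrite mul0r.
Qed.

Section KernelGenericConverse.
Variables (K F : fieldType) (iota : {rmorphism K -> F}) (n s : nat).
Variables (y : 'I_(n + s) -> F) (f : 'I_s -> mpoly (n + s) K).
Hypothesis Hf : solvable_system f.
Hypothesis fy : forall l, mmap iota y (f l) = 0.
Hypothesis aug : forall p, mcst p != 0 -> mmap iota y p != 0.

(* a field containing the generic power series *)
Variables (W : fieldType) (tau : {rmorphism fps (mpoly n K) -> W}).
Hypothesis tau_eq0 : forall u, (tau u == 0) = (u == 0).

Let emb : {rmorphism K -> W} := tau \o (fpsC (mpoly n K) \o @mpolyC n K).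
Let generic_point i : W := tau (series_coord f (@mpolyC n K)
  (fun i => fpsC (mpoly n K) (mX i) * fpsX (mpoly n K)) i).

Let generic_pointE p : mmap emb generic_point p = tau (generic_eval f p).
Proof. by rewrite [RHS]rmorph_mmap. Qed.

(* its determinant is a power series with constant term 1 *)
Let generic_jacobian_unit : \matrix_(l < s, k < s)
  mmap emb generic_point (mderiv (rshift n k) (f l)) \in unitmx.
Proof.
pose M : 'M[fps (mpoly n K)]_s :=
  \matrix_(l, k) generic_eval f (mderiv (rshift n k) (f l)).
have Hxi (i : 'I_n) : tdvd 1 (fpsC (mpoly n K) (mX i) * fpsX (mpoly n K)).
  by move=> d; rewrite ltnS leqn0 => /eqP->; rewrite fcoef0M fcoefX mulr0.
have -> : \matrix_(l < s, k < s) mmap emb generic_point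
    (mderiv (rshift n k) (f l)) = map_mx tau M.
  by apply/matrixP => l k; rewrite !mxE generic_pointE.
rewrite unitmxE det_map_mx unitfE tau_eq0.
apply/eqP => /(congr1 (@fcst _)); rewrite rmorph0 -det_map_mx.
have -> : map_mx (@fcst _) M = 1%:M.
  apply/matrixP => l k; rewrite !mxE rmorph_mmap.
  rewrite (mcst_mmap (@fcst _ \o (fpsC (mpoly n K) \o @mpolyC n K))) /=.
    rewrite (proj2 Hf); case: (l == k); rewrite /= ?mulr1n ?mulr0n.
      by rewrite mpolyC1; exact: coefC.
    by rewrite mpolyC0; exact: coefC.
  by move=> i; apply: (series_coord1 Hf (@mpolyC n K) Hxi).
by rewrite det1 => /eqP; rewrite oner_eq0.
Qed.

(** As the equations cut out [n] dimensions, more than [n] fractions of values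
    of the generic series evaluation are algebraically dependent: otherwise
    the Jacobian matrix of the equations defining them would have a larger rank
    than [jacobian_rank] allows. *)
Lemma generic_fractions_dependent (a b : 'I_n.+1 -> mpoly (n + s) K) :
  (forall i, generic_eval f (b i) != 0) ->
  exists2 R : mpoly n.+1 K, R != 0 & mmap emb
    (fun i => tau (generic_eval f (a i)) / tau (generic_eval f (b i))) R = 0.
Proof.
move=> b0; set w := fun i : 'I_n.+1 => _; apply: contrapT => H.
have ind R : mmap emb w R = 0 -> R = 0.
  by move=> R0; apply/eqP; apply: contrapT => /negP Rn0; apply: H; exists R.
pose q := join_coord w generic_point.
pose v : mpoly (n + s) K -> mpoly (n.+1 + (n + s)) K :=
  mmap (@mpolyC _ K) (fun i => mX (rshift n.+1 i)).
have vE p : mmap emb q (v p) = mmap emb generic_point p.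
  by rewrite mmap_mmap; apply: eq_mmap => // i; rewrite mmapXU /q join_coordr.
have dvl i p : mderiv (lshift (n + s) i) (v p) = 0.
  rewrite mderiv_mmap big1 // => l _.
  by rewrite mderiv_mX eq_rlshift /= mulr0n mpolyC0 mulr0.
have dvr i p : mderiv (rshift n.+1 i) (v p) = v (mderiv i p).
  rewrite mderiv_mmap (bigD1 i) //= big1 => [|l li].
    by rewrite mderiv_mX eqxx /= mulr1n mpolyC1 mulr1 addr0.
  by rewrite mderiv_mX eq_rshift (negPf li) /= mulr0n mpolyC0 mulr0.
pose g : 'I_(n.+1 + s) -> mpoly (n.+1 + (n + s)) K := join_coord
  (fun i => v (b i) * mX (lshift (n + s) i) - v (a i)) (fun l => v (f l)).
have le : (n.+1 <= n.+1 + (n + s))%N by rewrite leq_addr.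
have g0 i : mmap emb q (g i) = 0.
  case: (split_ordP i) => k ->; rewrite /g ?join_coordl ?join_coordr.
    rewrite mmapB mmapM !vE mmapXU /q join_coordl !generic_pointE /w.
    by apply: mulr_divK_subr0; rewrite tau_eq0.
  rewrite vE generic_pointE [generic_eval _ _]series_eval_f ?rmorph0 // => i'.
  by move=> d; rewrite ltnS leqn0 => /eqP->; rewrite fcoef0M fcoefX mulr0.
have := jacobian_rank (le := le) _ g0; set J := \matrix_(_, _) _.
have Jfree : row_free J.
  apply: inj_row_free => u uJ.
  have uJE k : \sum_i u 0 i * J i k = 0.
    by have /rowP/(_ k) := uJ; rewrite !mxE.
  have ul i : u 0 (lshift s i) = 0.
    have := uJE (lshift (n + s) i); rewrite big_split_ord /= [X in _ + X]big1 => [|l _].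
      rewrite (bigD1 i) //= big1 => [|l li].
        rewrite !addr0 mxE /g join_coordl mderivB mderivM !dvl mul0r add0r subr0.
        rewrite mderiv_mX eqxx /= mulr1n mpolyC1 mulr1 vE generic_pointE => /eqP.
        by rewrite mulf_eq0 tau_eq0 (negPf (b0 i)) orbF => /eqP.
      rewrite mxE /g join_coordl mderivB mderivM !dvl mul0r add0r subr0.
      by rewrite mderiv_mX eq_lshift (negPf li) /= mulr0n mpolyC0 mulr0 mmap0 mulr0.
    by rewrite mxE /g join_coordr dvl mmap0 mulr0.
  have ur : rsubmx u = 0.
    apply: (can_inj (mulmxK generic_jacobian_unit)); rewrite mul0mx.
    apply/rowP => k; have := uJE (rshift n.+1 (rshift n k)).
    rewrite big_split_ord /= big1 => [|l _]; last by rewrite ul mul0r.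
    rewrite add0r !mxE => E; rewrite -[RHS]E; apply: eq_bigr => l _.
    by rewrite !mxE /g join_coordr dvr vE.
  rewrite -[u]hsubmxK ur; apply/rowP => i.
  case: (split_ordP i) => k ->; rewrite ?row_mxEl ?row_mxEr !mxE //.
rewrite (eqP Jfree) => Hrk; have := Hrk _; rewrite addKn => /(_ _).
move=> H1; suff : (n.+1 + s <= n + s)%N by rewrite leq_add2r ltnn.
apply: H1 => p p0; apply: ind; rewrite -[RHS]p0; apply: eq_mmap => // i.
have -> : widen_ord le i = lshift (n + s) i by apply: val_inj.
by rewrite /q join_coordl.
Qed.

Hypothesis gen_y : forall z, exists p q, mmap iota y q != 0 /\ z = mmap iota y p / mmap iota y q.
Variable w : 'I_n -> F.
Hypothesis w_ind : forall p : mpoly n K, mmap iota w p = 0 -> p = 0.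

(** The relations of [y] also die in the series: if [g (y) = 0] but the series
    of [g] is not [0], the latter and lifts of the [w i] to fractions of series
    satisfy a relation, and mapping it to [F] gives one among the [w i]. *)
Lemma ker_generic_eval g : mmap iota y g = 0 -> generic_eval f g = 0.
Proof.
move=> gy; apply/eqP; apply: contrapT => /negP G0.
have /boolp.choice[a Ha] : forall i, exists ab : mpoly (n + s) K * mpoly (n + s) K,
    mmap iota y ab.2 != 0 /\ w i = mmap iota y ab.1 / mmap iota y ab.2.
  by move=> i; have [p [q H]] := gen_y (w i); exists (p, q).
pose lift_w (i : 'I_n.+1) : mpoly (n + s) K * mpoly (n + s) K :=
  if unlift ord_max i is Some k then a k else (g, 1).
have lift_max : lift_w ord_max = (g, 1) by rewrite /lift_w unlift_none.
have lift_widen k : lift_w (widen_ord (leqnSn n) k) = a k.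
  rewrite /lift_w (_ : widen_ord _ k = lift ord_max k) ?liftK //.
  by apply: val_inj; rewrite /= /bump leqNgt ltn_ord.
have ne0 p : mmap iota y p != 0 -> generic_eval f p != 0.
  by apply: contraNneq => /(generic_eval_ker Hf fy aug) ->.
have l0 i : mmap iota y (lift_w i).2 != 0.
  rewrite /lift_w; case: unlift => [k|]; first by case: (Ha k).
  by rewrite rmorph1 oner_eq0.
have [R R0 Rq] := generic_fractions_dependent (fun i => (lift_w i).1)
  (fun i => ne0 _ (l0 i)).
have [|R' [h [h0 R'q R'E]]] := relation_at0 _ R0 Rq.
  apply: mulf_neq0; rewrite ?invr_eq0 tau_eq0; last exact: ne0 (l0 _).
  by rewrite lift_max; exact: G0.
have fr : forall p, (tau \o generic_eval f) p = 0 -> mmap iota y p = 0.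
  by move=> p /= /eqP; rewrite tau_eq0 => /eqP; exact: generic_eval_ker.
have ev_cst : emb =1
    (tau \o generic_eval f) \o @mpolyC (n + s) K.
  move=> r; have E : generic_eval f (mC r) = fpsC (mpoly n K) (mC r) := series_evalC _ _ _ _.
  by rewrite /comp E.
rewrite (eq_mmap _ ev_cst (fun=> erefl)) in R'q.
have := fraction_relation (e := mmap iota y) fr l0 R'q.
rewrite R'E; last by rewrite lift_max /= gy mul0r.
move=> h00; case/eqP: h0; apply: w_ind; rewrite -[RHS]h00; apply: eq_mmap => [r|i] /=.
  by rewrite mmapC.
by rewrite lift_widen; case: (Ha i).
Qed.

End KernelGenericConverse.

Section KernelSeries.
Variables (K F : fieldType) (iota : {rmorphism K -> F}) (n s : nat).
Variables (y : 'I_(n + s) -> F) (f : 'I_s -> mpoly (n + s) K).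
Hypothesis Hf : solvable_system f.
Hypothesis fy : forall l, mmap iota y (f l) = 0.
Hypothesis aug : forall p, mcst p != 0 -> mmap iota y p != 0.
Hypothesis gen_y : forall z, exists p q, mmap iota y q != 0 /\ z = mmap iota y p / mmap iota y q.
Variable w : 'I_n -> F.
Hypothesis w_ind : forall p : mpoly n K, mmap iota w p = 0 -> p = 0.
Hypothesis trdeg_le : forall u : 'I_n.+1 -> F,
  exists2 R : mpoly n.+1 K, R != 0 & mmap iota u R = 0.

(** This embeds [K[y]] in a ring of power series. If the series of [g] is 0 but
    [g (y)] is not, then by [relation_at0] the relation of the first [n] coordinates
    and [g (y)] that the transcendence degree provides yields one of the series
    [xi]. *)
Theorem series_eval_eq0 (S : idomainType) (phi : {rmorphism K -> S}) (xi : 'I_n -> fps S) g :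
  (forall i, tdvd 1 (xi i)) ->
  (forall p : mpoly n K, mmap (fpsC S \o phi) xi p = 0 -> p = 0) ->
  series_eval f phi xi g = 0 <-> mmap iota y g = 0.
Proof.
move=> Hxi xi_ind; have sub p : mmap iota y p = 0 -> series_eval f phi xi p = 0.
  move=> py; apply: generic_eval_series_eval => //.
  exact: (ker_generic_eval Hf fy aug (@tofrac_eq0 (fps (mpoly n K))) gen_y w_ind py).
split=> [g0|]; last exact: sub.
apply/eqP; apply: contrapT => /negP gy.
pose u (i : 'I_n.+1) : mpoly (n + s) K :=
  if unlift ord_max i is Some k then mX (lshift s k) else g.
have u_max : u ord_max = g by rewrite /u unlift_none.
have u_widen k : u (widen_ord (leqnSn n) k) = mX (lshift s k).
  rewrite /u (_ : widen_ord _ k = lift ord_max k) ?liftK //.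
  by apply: val_inj; rewrite /= /bump leqNgt ltn_ord.
have [R R0 Ru] := trdeg_le (fun i => mmap iota y (u i)).
have [|R' [h [h0 R'u R'E]]] := relation_at0 _ R0 Ru; first by rewrite u_max.
case/eqP: h0; apply: xi_ind.
have := sub (mmap (@mpolyC _ K) u R'); rewrite mmap_mmap => /(_ R'u).
rewrite /series_eval /= mmap_mmap R'E; last by rewrite u_max; exact: g0.
move=> E; rewrite -[RHS]E; apply: eq_mmap => // i.
by rewrite u_widen mmapXU /series_coord join_coordl.
Qed.

End KernelSeries.

(** * Algebraically independent power series *)

Section MonomialCurve.
Variables (K : fieldType) (k : nat).
Let S := mpoly k K.

(** The blow-up chart [x_0 = t], [x_i = t w_i]. *)
Definition chart_coef (i : 'I_k.+1) : S :=
  if unlift ord0 i is Some l then mX l else 1.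
Definition chart_series (i : 'I_k.+1) : fps S := fpsC S (chart_coef i) * fpsX S.

Lemma chart_coef0 : chart_coef ord0 = 1.
Proof. by rewrite /chart_coef unlift_none. Qed.
Lemma chart_coefS i : chart_coef (lift ord0 i) = mX i.
Proof. by rewrite /chart_coef liftK. Qed.

Lemma chart_series1 i : tdvd 1 (chart_series i).
Proof. by move=> d; rewrite ltnS leqn0 => /eqP->; rewrite fcoefCM fcoefX mulr0. Qed.

(** In fixed degree in [t], a monomial in the [t w_i] is determined by its exponents
    in the [w_i]. *)
Lemma chart_series_independent (p : mpoly k.+1 K) :
  mmap (fpsC S \o @mpolyC k K) chart_series p = 0 -> p = 0.
Proof.
pose tail (m : multinom k.+1) := Multinom [tuple m (lift ord0 i) | i < k].
have monE m : mmap1 chart_coef m = mpolyX K (tail m).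
  rewrite /mmap1 big_ord_recl chart_coef0 expr1n mul1r [RHS]mpolyXE_id.
  by apply: eq_bigr => i _; rewrite chart_coefS mnmE.
have tail_inj m m' : mdeg m = mdeg m' -> tail m = tail m' -> m = m'.
  move=> dm tm; have mS i : m (lift ord0 i) = m' (lift ord0 i).
    by have := congr1 (fun t : multinom k => t i) tm; rewrite !mnmE.
  apply/mnmP => i; case: (unliftP ord0 i) => [l ->//|->].
  move: dm; rewrite !mdegE !big_ord_recl (eq_bigr (fun i => m' (lift ord0 i))) //.
  by move=> /addIn.
move=> p0; apply/mpolyP => m; rewrite mcoeff0.
have := congr1 (fun a => mcoeff (tail m) (fcoef a (mdeg m))) p0.
rewrite fcoef0 mcoeff0 fcoef_linear_subst raddf_sum /= big_mkcond => E.
rewrite -[RHS]E [in LHS](mpolyE p) raddf_sum; apply: eq_bigr => m' _ /=.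
rewrite mcoeffZ mcoeffX monE; case: (eqVneq m' m) => [->|mm'].
  by rewrite eqxx mcoeffCM mcoeffX eqxx.
case: eqP => [dm|_]; last by rewrite mulr0.
rewrite mcoeffCM mcoeffX; case: eqP => // tm.
by rewrite (tail_inj _ _ dm tm) eqxx in mm'.
Qed.

End MonomialCurve.

(** Sums of multiples of the [E i] with factors below [D] behave like expansions in
    a number system: the last digit that differs decides their order. *)
Section SuperincreasingDigits.
Variables (D : nat) (E : nat -> nat).
Hypotheses (E0 : (0 < E 0)%N) (ES : forall i, (D * E i <= E i.+1)%N).

Lemma digits_lt r (c : nat -> nat) : (forall i, (i < r)%N -> (c i < D)%N) ->
  (\sum_(i < r) c i * E i < E r)%N.
Proof.
elim: r => [|r IH] cD; first by rewrite big_ord0.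
rewrite big_ord_recr /= (leq_trans _ (ES r)) //.
have := IH (fun i ir => cD i (ltnW ir)); have := cD r (leqnn _).
move=> cr Hr; apply: (@leq_trans ((c r).+1 * E r)%N); last by rewrite leq_mul2r cr orbT.
by rewrite mulSn ltn_add2r.
Qed.

Lemma digits_inj r (c c' : nat -> nat) : (forall i, (i < r)%N -> (c i < D)%N) ->
  (forall i, (i < r)%N -> (c' i < D)%N) ->
  \sum_(i < r) c i * E i = \sum_(i < r) c' i * E i ->
  forall i, (i < r)%N -> c i = c' i.
Proof.
have lt_top r' b b' : (forall i, (i < r')%N -> (b i < D)%N) -> (b r' < b' r')%N ->
    (\sum_(i < r'.+1) b i * E i < \sum_(i < r'.+1) b' i * E i)%N.
  move=> bD lt_b; rewrite !big_ord_recr /=.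
  apply: (@leq_trans ((b r').+1 * E r')%N).
    by rewrite mulSn ltn_add2r digits_lt.
  by rewrite (leq_trans _ (leq_addl _ _)) // leq_mul2r lt_b orbT.
elim: r => // r IH cD c'D eq_cc' i.
have cD' l : (l < r)%N -> (c l < D)%N by move=> lr; rewrite cD // ltnW.
have c'D' l : (l < r)%N -> (c' l < D)%N by move=> lr; rewrite c'D // ltnW.
have [lt_c|lt_c|eq_c] := ltngtP (c r) (c' r).
- by have := lt_top r c c' cD' lt_c; rewrite eq_cc' ltnn.
- by have := lt_top r c' c c'D' lt_c; rewrite eq_cc' ltnn.
rewrite ltnS leq_eqVlt => /orP[/eqP->//|ir]; apply: IH => //.
by move: eq_cc'; rewrite !big_ord_recr /= eq_c => /addIn.
Qed.

End SuperincreasingDigits.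

Section Lacunary.
Variables (K : fieldType) (S : idomainType) (phi : {rmorphism K -> S}) (n : nat).

(** The series [i] is the sum of the [t ^ (k * n.+1 + i)`!] over [k]; the series [0] is
    [t] itself, so that its value generates the value group. *)
Definition lacunary_exponent (i d : nat) :=
  if i is 0 then d == 1%N else [exists k : 'I_d.+1, d == (k * n.+1 + i)`!].

Definition lacunary_series (i : 'I_n.+1) : fps S :=
  Fps (fun d => (lacunary_exponent i d)%:R).

Lemma lacunary_series0 : lacunary_series ord0 = fpsX S.
Proof. by apply: fpsP => d; rewrite fcoefX. Qed.

Lemma lacunary_series1 i : tdvd 1 (lacunary_series i).
Proof.
move=> d; rewrite ltnS leqn0 => /eqP->; case: i => -[|i] Hi //=.
case: existsP => // -[k /eqP E]; have := fact_gt0 (k * n.+1 + i.+1).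
by rewrite -E.
Qed.

Lemma lacunary_gap D i d : (0 < i < n.+1)%N ->
  ((D * n.+1 + i)`! < d < (D.+1 * n.+1 + 1)`!)%N -> lacunary_exponent i d = false.
Proof.
case: i => // i /= Hi /andP[d1 d2]; apply/existsP => -[[k Hk] /= /eqP E].
have [kD|Dk] := leqP k D.
  by move: d1; rewrite E ltnNge leq_fact // leq_add2r leq_mul2r kD orbT.
move: d2; rewrite E ltnNge leq_fact // leq_add //.
by rewrite leq_mul2r Dk orbT.
Qed.

(** In a relation of degree less than [D] replace each series by its truncation
    after the [D]-th term: the degrees of the truncations grow so fast that the
    monomials have distinct degrees, and the error has larger order still. *)
Theorem lacunary_series_independent (p : mpoly n.+1 K) :
  mmap (fpsC S \o phi) lacunary_series p = 0 -> p = 0.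
Proof.
move=> pxi; apply/eqP; apply: contrapT => /negP p0.
pose D := msize p; pose E i := if i is 0 then 1%N else (D * n.+1 + i)`!.
have le_fact m : (m <= m`!)%N.
  by case: m => // m; rewrite factS leq_pmulr // fact_gt0.
have DE i : (D <= D * n.+1 + i)%N.
  by rewrite (leq_trans _ (leq_addr _ _)) // leq_pmulr.
have ES i : (D * E i <= E i.+1)%N.
  case: i => [|i]; first by rewrite muln1 (leq_trans _ (le_fact _)).
  by rewrite /E [X in (_ <= X`!)%N]addnS factS leq_mul2r (leq_trans (DE i.+1)) ?orbT // addnS.
pose P (i : 'I_n.+1) : {poly S} := ftrunc (E i).+1 (lacunary_series i).
have Pd i d : (d < (D.+1 * n.+1 + 1)`!)%N -> (P i)`_d = fcoef (lacunary_series i) d.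
  move=> dB; rewrite coef_ftrunc; case: ltnP => // Ed; case: i Ed => -[|i] Hi /= Ed.
    by rewrite gtn_eqF.
  by have := @lacunary_gap D i.+1 d; rewrite /= => ->; rewrite ?Hi ?Ed.
have lead i : (P i)`_(E i) = 1.
  rewrite coef_ftrunc leqnn; case: i => -[|i] Hi //=.
  case: existsP => // -[]; have HD : (D < (D * n.+1 + i.+1)`!.+1)%N.
    by rewrite ltnS (leq_trans _ (le_fact _)).
  by exists (Ordinal HD).
have Psize i : size (P i) = (E i).+1.
  apply/eqP; rewrite eqn_leq size_poly /= ltnNge; apply: contra_eqN (lead i) => sP.
  by rewrite nth_default // eq_sym oner_eq0.
have Pmonic i : P i \is monic by rewrite monicE lead_coefE Psize lead.
pose wt (m : multinom n.+1) := (\sum_(i < n.+1) m i * E i)%N.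
have mon m : mmap1 P m \is monic /\ size (mmap1 P m) = (wt m).+1.
  rewrite /mmap1 /wt; apply: (big_ind2 (fun q w => q \is monic /\ size q = w.+1)).
  - by rewrite monic1 size_poly1.
  - move=> q w q' w' [qm qs] [q'm q's]; rewrite monicMl // size_monicM //.
      by rewrite qs q's addSn addnS.
    by rewrite -size_poly_eq0 q's.
  - move=> i _; elim: (m i) => [|e [IHm IHs]]; first by rewrite expr0 monic1 size_poly1.
    rewrite exprS monicMl // size_monicM // ?Psize ?IHs; last first.
      by rewrite -size_poly_eq0 IHs.
    by rewrite mulSn addSn addnS.
have dig (m : multinom n.+1) : m \in msupp p -> forall i : 'I_n.+1, (m i < D)%N.
  move=> mp i; rewrite (leq_trans _ (msize_mdeg_lt mp)) // ltnS mdegE (bigD1 i) //=.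
  exact: leq_addr.
pose c (m : multinom n.+1) i := if insub i is Some i' then m (i' : 'I_n.+1) else 0%N.
have cE m (i : 'I_n.+1) : c m i = m i by rewrite /c valK.
have cD m : m \in msupp p -> forall i, (i < n.+1)%N -> (c m i < D)%N.
  by move=> mp i Hi; rewrite -[i]/(val (Ordinal Hi)) cE dig.
have wtE m : wt m = (\sum_(i < n.+1) c m i * E i)%N.
  by apply: eq_bigr => i _; rewrite cE.
have wt_inj m m' : m \in msupp p -> m' \in msupp p -> wt m = wt m' -> m = m'.
  move=> mp m'p; rewrite !wtE => /(digits_inj (isT : (0 < E 0)%N) ES (cD m mp) (cD m' m'p)) H.
  by apply/mnmP => i; rewrite -!cE; exact: H.
have [M Mp Mmax] : exists2 M, M \in msupp p & forall m, m \in msupp p -> (wt m <= wt M)%N.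
  have: msupp p != [::] by rewrite msupp_eq0.
  elim: (msupp p) => // m l IH _; have [->|l0] := eqVneq l [::].
    by exists m; rewrite ?mem_head // => m'; rewrite inE => /eqP->.
  have [M Ml HM] := IH l0; have [lt_m|lt_m] := leqP (wt m) (wt M).
    exists M; first by rewrite inE Ml orbT.
    by move=> m'; rewrite inE => /orP[/eqP->//|/HM].
  exists m; first exact: mem_head.
  by move=> m'; rewrite inE => /orP[/eqP->//|/HM/leq_trans]; apply; exact: ltnW.
have Q0 : (mmap (polyC \o phi) P p)`_(wt M) = phi (mcoeff M p).
  rewrite /mmap coef_sum (bigD1_seq M) ?msupp_uniq //= coefCM.
  have [MM Ms] := mon M; move: MM; rewrite monicE lead_coefE Ms /= => /eqP->.
  rewrite mulr1 big_seq_cond big1 ?addr0 // => m /andP[mp mM].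
  rewrite coefCM nth_default ?mulr0 // (proj2 (mon m)).
  by rewrite ltn_neqAle Mmax // andbT; apply: contra_neq mM; exact: wt_inj.
have wtB : (wt M < (D.+1 * n.+1 + 1)`!)%N.
  rewrite wtE; apply: leq_trans (digits_lt (isT : (0 < E 0)%N) ES (cD M Mp)) _.
  by rewrite /E leq_fact // mulSn addnC addn1.
have Pxi i : tdvd (D.+1 * n.+1 + 1)`! (lacunary_series i - fps_of_poly (P i)).
  by move=> d dB; rewrite fcoefB [fcoef (fps_of_poly _) _]Pd // subrr.
have := filt_lipschitz (@tdvd_filtration S) (fpsC S \o phi) p Pxi.
move=> /(_ (wt M)); rewrite pxi sub0r fcoefN => /(_ wtB) /eqP.
rewrite oppr_eq0 -(rmorph_mmap (@fps_of_poly S) (polyC \o phi) P) /= Q0.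
by rewrite fmorph_eq0 mcoeff_eq0 Mp.
Qed.

End Lacunary.

(** * Lexicographic leading terms *)

Section LexPositive.
Variable k : nat.
Local Notation exponent := {ffun 'I_k.+1 -> int}.
Implicit Types g h : exponent.

Definition lexpos g := exists i : 'I_k.+1, (forall l : 'I_k.+1, (l < i)%N -> g l = 0) /\ 0 < g i.
Definition lexnneg g := g = 0 \/ lexpos g.

Lemma lexposD g h : lexpos g -> lexpos h -> lexpos (g + h).
Proof.
move=> [i [gi gi0]] [l [hl hl0]]; have [il|li|/val_inj il] := ltngtP i l.
- exists i; split=> [t ti|]; first by rewrite ffunE gi // hl ?addr0 // (ltn_trans ti).
  by rewrite ffunE hl // addr0.
- exists l; split=> [t tl|]; first by rewrite ffunE hl // gi ?addr0 // (ltn_trans tl).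
  by rewrite ffunE gi // add0r.
- subst l; exists i; split=> [t ti|]; first by rewrite ffunE gi // hl // addr0.
  by rewrite ffunE addr_gt0.
Qed.

Lemma lexnnegD g h : lexnneg g -> lexnneg h -> lexnneg (g + h).
Proof.
move=> [->|Pg] [->|Ph]; rewrite ?addr0 ?add0r; [by left|by right|by right|].
by right; exact: lexposD.
Qed.

Lemma lexpos_nnegD g h : lexpos g -> lexnneg h -> lexpos (g + h).
Proof. by move=> Pg [->|Ph]; [rewrite addr0 | exact: lexposD]. Qed.

Lemma lexpos0 : ~ lexpos 0.
Proof. by case=> i []; rewrite ffunE ltxx. Qed.

Lemma lexposN g : lexpos g -> ~ lexnneg (- g).
Proof.
move=> Pg [|/(lexposD Pg)]; last by rewrite subrr; exact: lexpos0.
by move=> /eqP; rewrite oppr_eq0 => /eqP g0; move: Pg; rewrite g0; exact: lexpos0.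
Qed.

Lemma lexnneg_anti g : lexnneg g -> lexnneg (- g) -> g = 0.
Proof. by case=> // /lexposN. Qed.

Lemma lex_total g : lexnneg g \/ lexpos (- g).
Proof.
have [->|g0] := eqVneq g 0; first by left; left.
have ex_nz : exists i : 'I_k.+1, g i != 0.
  apply: contrapT => H; case/eqP: g0; apply/ffunP => i; rewrite ffunE.
  by apply/eqP; apply: contrapT => /negP gi; apply: H; exists i.
have [i gi imin] : exists2 i : 'I_k.+1, g i != 0 & forall l : 'I_k.+1, (l < i)%N -> g l = 0.
  have [i0 gi0] := ex_nz; case: (@arg_minnP _ i0 (fun i => g i != 0) val gi0) => i gi imin.
  exists i => // l li; apply/eqP; apply: contraTT li => /imin.
  by rewrite -leqNgt.
case: (ltgtP (g i) 0) gi => // gi _.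
- right; exists i; split=> [l li|]; first by rewrite ffunE imin // oppr0.
  by rewrite ffunE oppr_gt0.
- by left; right; exists i.
Qed.

Lemma lexnnegNP g : ~ lexnneg g -> lexpos (- g).
Proof. by case: (lex_total g). Qed.

Lemma lexnneg_neq g : lexnneg g -> g != 0 -> lexpos g.
Proof. by case=> // ->; rewrite eqxx. Qed.

Lemma lex_min (T : eqType) (f : T -> exponent) (s : seq T) : s != [::] ->
  exists2 x, x \in s & forall z, z \in s -> lexnneg (f z - f x).
Proof.
elim: s => // x s IH _; have [->|s0] := eqVneq s [::].
  by exists x; rewrite ?mem_head // => z; rewrite inE => /eqP->; left; rewrite subrr.
have [m ms Hm] := IH s0; have [xm|mx] := lex_total (f x - f m).
  exists m; first by rewrite inE ms orbT.
  by move=> z; rewrite inE => /orP[/eqP->//|/Hm].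
rewrite opprB in mx; exists x; first exact: mem_head.
move=> z; rewrite inE => /orP[/eqP->|/Hm zm]; first by left; rewrite subrr.
by rewrite -(subrKA (f m)); right; rewrite addrC; exact: lexpos_nnegD.
Qed.

End LexPositive.

Section LeadingTerm.
Variables (K : fieldType) (k : nat).
Local Notation S := (mpoly k K).
Local Notation exponent := {ffun 'I_k.+1 -> int}.
Implicit Types a b : fps S.

(** The exponent of [t^d w^m]; [t] comes first, so it dominates in the lexicographic
    order. *)
Definition expo (d : nat) (m : multinom k) : exponent :=
  [ffun i => if unlift ord0 i is Some l then (m l)%:Z else d%:Z].

Lemma expo0 d m : expo d m ord0 = d.
Proof. by rewrite ffunE unlift_none. Qed.
Lemma expoS d m l : expo d m (lift ord0 l) = m l.
Proof. by rewrite ffunE liftK. Qed.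

Lemma expoD d d' m m' : expo (d + d') (mnm_add m m') = expo d m + expo d' m'.
Proof.
by apply/ffunP => i; rewrite !ffunE; case: unliftP => [l _|_]; rewrite ?mnmDE PoszD.
Qed.

Lemma expo_inj d d' m m' : expo d m = expo d' m' -> d = d' /\ m = m'.
Proof.
move=> E; split; first by have := congr1 (fun g : exponent => g ord0) E; rewrite !expo0 => -[].
apply/mnmP => l; have := congr1 (fun g : exponent => g (lift ord0 l)) E.
by rewrite !expoS => -[].
Qed.

Definition term a d m := mcoeff m (fcoef a d).

Definition terms_ge a (g : exponent) := forall d m, term a d m != 0 -> lexnneg (expo d m - g).

Definition leading a (g : exponent) (c : K) := [/\ c != 0, terms_ge a g &
  exists d m, expo d m = g /\ term a d m = c].

Lemma terms_geD a b g : terms_ge a g -> terms_ge b g -> terms_ge (a + b) g.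
Proof.
move=> Ha Hb d m; have [a0|/Ha//] := eqVneq (term a d m) 0.
by rewrite /term fcoefD mcoeffD [X in X + _]a0 add0r; exact: Hb.
Qed.

Lemma terms_ge_trans a g h : terms_ge a g -> lexnneg (g - h) -> terms_ge a h.
Proof. by move=> Ha gh d m /Ha /lexnnegD/(_ gh); rewrite addrA subrK. Qed.

(** The lowest power of [t] has a coefficient with finitely many monomials. *)
Lemma leading_ex a : a != 0 -> exists g c, leading a g c.
Proof.
move=> /tord[d [lowd ad]]; have [|m ms Hm] := @lex_min k _ (expo d) (msupp (fcoef a d)).
  by rewrite msupp_eq0.
exists (expo d m), (term a d m); split; first by rewrite /term mcoeff_eq0 ms.
  move=> d' m' a'; have [d'd|dd'|d'E] := ltngtP d' d.
  - by move: a'; rewrite /term lowd // mcoeff0 eqxx.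
  - right; exists ord0; split=> //; rewrite !ffunE unlift_none subr_gt0.
    by rewrite ltz_nat.
  - by rewrite d'E; apply: Hm; rewrite -d'E mcoeff_msupp.
by exists d, m.
Qed.

Lemma leading_uniq a g c g' c' : leading a g c -> leading a g' c' -> g = g' /\ c = c'.
Proof.
move=> [c0 age [d [m [E ac]]]] [c'0 age' [d' [m' [E' ac']]]].
have gg' : g = g'.
  apply/eqP; rewrite -subr_eq0; apply/eqP; apply: lexnneg_anti.
    by rewrite -E; apply: age'; rewrite ac.
  by rewrite opprB -E'; apply: age; rewrite ac'.
split=> //; have [dd mm] : d = d' /\ m = m' by apply: expo_inj; rewrite E E'.
by rewrite -ac -ac' dd mm.
Qed.

Lemma leading_neq0 a g c : leading a g c -> a != 0.
Proof.
case=> c0 _ [d [m [_ E]]]; apply: contraNneq c0 => a0.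
by rewrite -E a0 /term fcoef0 mcoeff0.
Qed.

Lemma termM a b d m : term (a * b) d m != 0 ->
  exists i l m1 m2, [/\ (i + l)%N = d, mnm_add m1 m2 = m, term a i m1 != 0 & term b l m2 != 0].
Proof.
rewrite /term fcoefM raddf_sum /= => H; apply: contrapT => H'; case/eqP: H.
apply: big1 => -[i Hi] _ /=; rewrite mcoeffM big1 // => -[m1 m2] /= /eqP mE.
have [a0|a0] := eqVneq (mcoeff m1 (fcoef a i)) 0; first by rewrite a0 mul0r.
have [b0|b0] := eqVneq (mcoeff m2 (fcoef b (d - i))) 0; first by rewrite b0 mulr0.
case: H'; exists i, (d - i)%N, m1, m2; split=> //.
by rewrite subnKC.
Qed.

Lemma leadingM a b g h c e : leading a g c -> leading b h e -> leading (a * b) (g + h) (c * e).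
Proof.
move=> [c0 age [d1 [m1 [gE ac]]]] [e0 bge [d2 [m2 [hE be]]]]; split.
- exact: mulf_neq0.
- move=> d m /termM[i [l [n1 [n2 [<- <- /age ai /bge bl]]]]].
  by rewrite expoD opprD addrACA; exact: lexnnegD.
exists (d1 + d2)%N, (mnm_add m1 m2); split; first by rewrite expoD gE hE.
have only i l n1 n2 : expo i n1 + expo l n2 = g + h ->
    term a i n1 != 0 -> term b l n2 != 0 -> i = d1 /\ n1 = m1.
  move=> E /age ai /bge bl; apply: expo_inj; rewrite gE; apply/eqP.
  rewrite -subr_eq0; apply/eqP; apply: lexnneg_anti => //.
  have -> : - (expo i n1 - g) = expo l n2 - h; last exact: bl.
  by apply/eqP; rewrite opprB subr_eq addrAC eq_sym subr_eq addrC E.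
rewrite /term fcoefM raddf_sum /=.
have H1 : (d1 < (d1 + d2).+1)%N by rewrite ltnS leq_addr.
rewrite (bigD1 (Ordinal H1)) //= addKn big1 ?addr0 => [|[i Hi] /= id1]; last first.
  rewrite mcoeffM big1 // => -[n1 n2] /= /eqP nE; apply/eqP; apply: contraNT id1.
  rewrite mulf_eq0 negb_or => /andP[ai bl]; apply/eqP/val_inj => /=.
  have [] // := only i (d1 + d2 - i)%N n1 n2 _ ai bl.
  by rewrite -expoD -nE subnKC // expoD gE hE.
have [mm1 mm2] : (mdeg m1 < (mdeg (mnm_add m1 m2)).+1)%N /\ (mdeg m2 < (mdeg (mnm_add m1 m2)).+1)%N.
  by rewrite !mdegD !ltnS leq_addr leq_addl.
rewrite mcoeffM (bigD1 (BMultinom mm1, BMultinom mm2)) //= big1 ?addr0.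
  by rewrite -ac -be.
move=> -[n1 n2] /= /andP[/eqP nE ne]; apply/eqP; apply: contraNT ne.
rewrite mulf_eq0 negb_or => /andP[ai bl].
have [|_ n1E] := only d1 d2 n1 n2 _ ai bl; first by rewrite -expoD -nE expoD gE hE.
apply/eqP; congr (_, _); apply: val_inj => //=.
by move: nE; rewrite n1E => /addmI.
Qed.

Lemma leadingC c : c != 0 -> leading (fpsC S (mC c)) 0 c.
Proof.
move=> c0; have e0 : expo 0 mnm0 = 0.
  by apply/ffunP => i; rewrite !ffunE; case: unlift => // l; rewrite mnm0E.
split=> //; last by exists 0%N, mnm0; rewrite /term fcoefC mcoeffC eqxx mulr1.
move=> d m; rewrite /term fcoefC; case: (eqVneq d 0%N) => [->|_]; last first.
  by rewrite mcoeff0 eqxx.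
rewrite mcoeffC; case: (eqVneq m mnm0) => [->|_]; last by rewrite mulr0 eqxx.
by move=> _; left; rewrite e0 subr0.
Qed.

Lemma terms_geCM c b g : terms_ge b g -> terms_ge (fpsC S (mC c) * b) g.
Proof.
move=> Hb d m; rewrite /term fcoefCM mcoeffCM mulf_eq0 negb_or => /andP[_].
exact: Hb.
Qed.

(** The constant is the quotient of the leading coefficients if the exponents agree,
    and 0 otherwise. This makes the residue field of the valuation equal to [K]. *)
Lemma leading_residue a b g h c e : leading a g c -> leading b h e -> lexnneg (g - h) ->
  exists r, forall g' c', leading (a - fpsC S (mC r) * b) g' c' -> lexpos (g' - h).
Proof.
move=> la lb gh; case: (la) => c0 age [d1 [m1 [gE ac]]].
case: (lb) => e0 bge [d2 [m2 [hE be]]].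
exists (if g == h then c / e else 0) => g' c' [c'0 ge' [d [m [g'E tE]]]].
apply: lexnneg_neq.
  rewrite -g'E; have : terms_ge (a - fpsC S (mC (if g == h then c / e else 0)) * b) h.
    apply: terms_geD; first exact: terms_ge_trans age gh.
    by rewrite -mulNr -rmorphN -rmorphN; exact: terms_geCM.
  by apply; rewrite tE.
apply: contraNneq c'0 => /eqP; rewrite subr_eq0 => /eqP g'h.
have [dd mm] : d = d2 /\ m = m2 by apply: expo_inj; rewrite g'E g'h hE.
rewrite -tE /term fcoefB fcoefCM mcoeffB mcoeffCM dd mm [mcoeff m2 (fcoef b d2)]be.
case: (eqVneq g h) => [ghE|gneh].
  have [<- <-] : d1 = d2 /\ m1 = m2 by apply: expo_inj; rewrite gE hE.
  by rewrite [mcoeff m1 _]ac divfK // subrr.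
rewrite mul0r subr0; apply: contraT => an0.
have := age d2 m2 an0; rewrite hE => hg.
case/negP: gneh; rewrite -subr_eq0; apply/eqP; apply: lexnneg_anti => //.
by rewrite opprB.
Qed.

End LeadingTerm.

(** * The valuation of a field given by leading terms *)

Section FieldValuation.
Variables (K F : fieldType) (iota : {rmorphism K -> F}) (k N : nat).
Variables (y : 'I_N -> F) (theta : {rmorphism mpoly N K -> fps (mpoly k K)}).
Local Notation exponent := {ffun 'I_k.+1 -> int}.
Local Notation eval := (mmap iota y).
Hypothesis gen_y : forall z, exists p q, eval q != 0 /\ z = eval p / eval q.
Hypothesis theta_eq0 : forall p, theta p = 0 <-> eval p = 0.
Hypothesis thetaC : forall c, theta (mC c) = fpsC (mpoly k K) (mC c).

(* fractions are compared through their series, so no fraction field of the power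
   series ring is involved *)
Let has_val a g := exists p q h h' c c', [/\ a = eval p / eval q,
  leading (theta p) h c, leading (theta q) h' c' & g = h - h'].

Let theta_neq0 p : theta p != 0 <-> eval p != 0.
Proof. by split; apply: contraNneq => /theta_eq0 ->. Qed.

Let val_ex a : a != 0 -> exists g, has_val a g.
Proof.
have [p [q [q0 ->]]] := gen_y a => a0.
have p0 : eval p != 0 by apply: contraNneq a0 => ->; rewrite mul0r.
have [h [c lp]] := leading_ex (proj2 (theta_neq0 p) p0).
have [h' [c' lq]] := leading_ex (proj2 (theta_neq0 q) q0).
by exists (h - h'), p, q, h, h', c, c'.
Qed.

Let val_uniq a g g' : has_val a g -> has_val a g' -> g = g'.
Proof.
move=> [p [q [h [h' [c [c' [aE lp lq ->]]]]]]] [r [s [i [i' [d [d' [aE' lr ls ->]]]]]]].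
have q0 := proj1 (theta_neq0 q) (leading_neq0 lq).
have s0 := proj1 (theta_neq0 s) (leading_neq0 ls).
have E : eval (p * s - r * q) = 0.
  rewrite mmapB !mmapM; apply/eqP; rewrite subr_eq0; apply/eqP.
  by move/eqP: aE'; rewrite aE eqr_div // => /eqP.
have : theta p * theta s = theta r * theta q.
  by apply/eqP; rewrite -!rmorphM -subr_eq0 -rmorphB; apply/eqP/theta_eq0.
move=> E'; have := leadingM lp ls; rewrite E' => /leading_uniq/(_ (leadingM lr lq))[Eg _].
by apply/eqP; rewrite subr_eq addrAC eq_sym subr_eq -Eg.
Qed.

Definition fval (a : F) : exponent :=
  if pselect (exists g, has_val a g) is left H then projT1 (cid H) else 0.

Let fvalP a : a != 0 -> has_val a (fval a).
Proof.
by move=> /val_ex H; rewrite /fval; case: pselect => // H'; case: (cid H').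
Qed.

Let fval_uniq a g : a != 0 -> has_val a g -> fval a = g.
Proof. by move=> a0; apply: val_uniq; exact: fvalP. Qed.

Lemma fval_leading p g c : leading (theta p) g c -> eval p != 0 /\ fval (eval p) = g.
Proof.
move=> lp; have p0 := proj1 (theta_neq0 p) (leading_neq0 lp); split=> //.
apply: fval_uniq => //; exists p, 1, g, 0, c, 1.
rewrite rmorph1 divr1 subr0; split=> //.
by rewrite -(mpolyC1 N K) thetaC; apply: leadingC; exact: oner_neq0.
Qed.

Lemma leading_fval p : eval p != 0 -> exists c, leading (theta p) (fval (eval p)) c.
Proof.
move=> p0; have [g [c lp]] := leading_ex (proj2 (theta_neq0 p) p0).
by have [_ ->] := fval_leading lp; exists c.
Qed.

Lemma fvalM a b : a != 0 -> b != 0 -> fval (a * b) = fval a + fval b.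
Proof.
move=> a0 b0; have [p [q [h [h' [c [c' [aE lp lq ->]]]]]]] := fvalP a0.
have [r [s [i [i' [d [d' [bE lr ls ->]]]]]]] := fvalP b0.
apply: fval_uniq; first exact: mulf_neq0.
exists (p * r), (q * s), (h + i), (h' + i'), (c * d), (c' * d').
rewrite !mmapM !rmorphM aE bE mulf_div opprD addrACA.
by split=> //; exact: leadingM.
Qed.

Lemma fval_cst c : c != 0 -> fval (iota c) = 0.
Proof.
by move=> c0; rewrite -(mmapC y); apply: (proj2 (@fval_leading _ _ c _)); rewrite thetaC; exact: leadingC.
Qed.

Lemma fvalV a : a != 0 -> fval a^-1 = - fval a.
Proof.
move=> a0; apply/eqP; rewrite -addr_eq0 -fvalM ?invr_eq0 // mulVf //.
by rewrite -(rmorph1 iota) fval_cst // oner_neq0.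
Qed.

Let common_denominator a b : a != 0 -> b != 0 -> exists p r q h c h' c' i d,
  [/\ a = eval p / eval q, b = eval r / eval q, leading (theta p) h c,
      leading (theta r) h' c' & leading (theta q) i d] /\
  fval a = h - i /\ fval b = h' - i.
Proof.
move=> a0 b0; have [p [q [h [h' [c [c' [aE lp lq va]]]]]]] := fvalP a0.
have [r [s [i [i' [d [d' [bE lr ls vb]]]]]]] := fvalP b0.
have q0 := proj1 (theta_neq0 q) (leading_neq0 lq).
have s0 := proj1 (theta_neq0 s) (leading_neq0 ls).
exists (p * s), (r * q), (q * s), (h + i'), (c * d'), (i + h'), (d * c'), (h' + i'), (c' * d').
rewrite !mmapM !rmorphM; split; first split.
- by rewrite aE -mulf_div divff // mulr1.
- by rewrite bE [eval q * _]mulrC -mulf_div divff // mulr1.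
- exact: leadingM.
- exact: leadingM.
- exact: leadingM.
- rewrite va vb !opprD; split; first by rewrite addrACA subrr addr0.
  by rewrite addrA addrK.
Qed.

Lemma fvalD a b : a != 0 -> b != 0 -> a + b != 0 ->
  lexnneg (fval a) -> lexnneg (fval b) -> lexnneg (fval (a + b)).
Proof.
move=> a0 b0; have [p [r [q [h [c [h' [c' [i [d [[-> -> lp lr lq] [-> ->]]]]]]]]]]] :=
  common_denominator a0 b0.
rewrite -mulrDl -mmapD => ab0 va vb.
have pr0 : eval (p + r) != 0 by apply: contraNneq ab0 => ->; rewrite mul0r.
have [e lpr] := leading_fval pr0.
have [q0 vq] := fval_leading lq.
rewrite fvalM ?invr_eq0 // fvalV // vq.
case: lpr => e0 _ [d1 [m1 [<- tE]]]; suff : terms_ge (theta (p + r)) i.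
  by apply; rewrite tE.
rewrite rmorphD; apply: terms_geD.
  by case: lp => _ lp _; exact: terms_ge_trans lp va.
by case: lr => _ lr _; exact: terms_ge_trans lr vb.
Qed.

Lemma fval_residue a : a != 0 -> lexnneg (fval a) ->
  exists c, a - iota c = 0 \/ lexpos (fval (a - iota c)).
Proof.
move=> a0; have [p [q [h [i [c [d [aE lp lq ->]]]]]]] := fvalP a0 => va.
have [r Hr] := leading_residue lp lq va.
have [q0 vq] := fval_leading lq.
have E : a - iota r = eval (p - mC r * q) / eval q.
  by rewrite aE mmapB mmapM mmapC mulrBl mulfK.
exists r; have [z|nz] := eqVneq (a - iota r) 0; [by left | right].
have pq0 : eval (p - mC r * q) != 0.
  by apply: contraNneq nz => z; rewrite E z mul0r.
have [e le] := leading_fval pq0.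
rewrite E fvalM ?invr_eq0 // fvalV // vq; apply: (Hr _ e).
by rewrite -thetaC -rmorphM -rmorphB.
Qed.

End FieldValuation.

(** * Monomial blow-ups *)

Section Toric.
Variables (k M : nat) (R : comNzRingType) (w : nat -> R).
Hypothesis M0 : (0 < M)%N.

(** The solution of [toric i = w i * toric i.+1 ^+ M]; lexicographic order of
    exponents of the [toric i] becomes divisibility of monomials in the [w i],
    as long as the smaller exponents are below [M]. *)
Definition toric i := \prod_(i <= j < k.+1) w j ^+ (M ^ (j - i)).

Lemma toric_rec i : (i < k)%N -> toric i = w i * toric i.+1 ^+ M.
Proof.
move=> ik; rewrite /toric big_ltn ?ltnS 1?ltnW // subnn expn0 expr1; congr (_ * _).
rewrite -prodrXl !big_seq; apply: eq_bigr => j; rewrite mem_index_iota => /andP[ij _].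
by rewrite -exprM -expnSr subnSK.
Qed.

Lemma toric_last : toric k = w k.
Proof. by rewrite /toric big_nat1 subnn expn0 expr1. Qed.

(** The equation [toric j = w j * toric j.+1 ^+ M] spends one of the [M] factors
    [toric j.+1] on the next equation and leaves [M.-1] of them. *)
Lemma toric_div i : (i <= k)%N ->
  exists z, toric i = w i * z * \prod_(i.+1 <= j < k.+1) toric j ^+ M.-1.
Proof.
move=> ik; rewrite -(subKn ik); elim: (k - i)%N (leq_subr i k) => [|d IH] dk.
  by rewrite subn0 big_geq // toric_last; exists 1; rewrite !mulr1.
have [z E] := IH (ltnW dk).
have dE : (k - d)%N = (k - d.+1).+1 by rewrite subnSK.
have lt_k : (k - d.+1 < k)%N by rewrite -subSn // leq_subLR addSn ltnS leq_addl.
rewrite toric_rec // -dE big_ltn ?ltnS ?leq_subr // -{1}(prednK M0) exprS.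
exists (w (k - d)%N * z); rewrite {1}E; ring.
Qed.

Lemma toric_div_lt (al : nat -> nat) i : (i <= k)%N -> (forall l, al l < M)%N ->
  exists z, toric i = w i * z * \prod_(i.+1 <= j < k.+1) toric j ^+ al j.
Proof.
move=> /toric_div[z E] alM.
exists (z * \prod_(i.+1 <= j < k.+1) toric j ^+ (M.-1 - al j)).
rewrite [LHS]E -!mulrA -big_split; congr (_ * (_ * _)); apply: eq_bigr => j _ /=.
by rewrite -exprD subnK // -ltnS prednK.
Qed.

Lemma toric_mono_div (al be : nat -> nat) i : (i <= k)%N -> (forall l, al l < M)%N ->
  (forall l, (l < i)%N -> be l = al l) -> (al i < be i)%N ->
  exists z, \prod_(l < k.+1) toric l ^+ be l = (\prod_(l < k.+1) toric l ^+ al l) * (w i * z).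
Proof.
move=> ik alM eq_i lt_i; have [z E] := toric_div_lt ik alM.
rewrite -(big_mkord xpredT (fun l => toric l ^+ be l)) -(big_mkord xpredT (fun l => toric l ^+ al l)).
rewrite !(@big_cat_nat _ _ _ i 0 k.+1) ?leqW //=.
have -> : \prod_(0 <= l < i) toric l ^+ be l = \prod_(0 <= l < i) toric l ^+ al l.
  by rewrite !big_seq; apply: eq_bigr => l; rewrite mem_index_iota => /eq_i ->.
rewrite !(big_ltn (m := i)) //.
have -> : be i = (al i + 1 + (be i - (al i).+1))%N by rewrite addn1 subnKC.
rewrite !exprD expr1.
exists (z * toric i ^+ (be i - (al i).+1) * \prod_(i.+1 <= l < k.+1) toric l ^+ be l).
rewrite {2}E; ring.
Qed.

End Toric.

Lemma rmorph_toric k M (R R' : comNzRingType) (g : {rmorphism R -> R'}) w i :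
  g (toric k M w i) = toric k M (g \o w) i.
Proof. by rewrite /toric rmorph_prod; apply: eq_bigr => j _; rewrite rmorphXn. Qed.

Section Truncation.
Variables (K : fieldType) (k : nat).
Local Notation S := (mpoly k K).

(** Substitution of [V 0] for [t] and of [V i] for [w_i]; the truncation makes sense of
    it in rings without a topology. *)
Definition trunc_eval (R : comNzRingType) (j : K -> R) (V : nat -> R) N (a : fps S) : R :=
  \sum_(d < N) V 0%N ^+ d * mmap j (fun i : 'I_k => V i.+1) (fcoef a d).

Lemma rmorph_trunc_eval (R R' : comNzRingType) (g : {rmorphism R -> R'}) j V N a :
  g (trunc_eval j V N a) = trunc_eval (g \o j) (g \o V) N a.
Proof.
rewrite /trunc_eval rmorph_sum; apply: eq_bigr => d _.
by rewrite rmorphM rmorphXn rmorph_mmap.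
Qed.

Lemma eq_trunc_eval (R : comNzRingType) (j j' : K -> R) V V' N a : j =1 j' ->
  (forall i, (i <= k)%N -> V i = V' i) -> trunc_eval j V N a = trunc_eval j' V' N a.
Proof.
move=> jj VV; apply: eq_bigr => d _; rewrite VV //; congr (_ * _).
by apply: eq_mmap => // i; rewrite VV.
Qed.

Section InRing.
Variables (R : comNzRingType) (j : {rmorphism K -> R}) (V : nat -> R).
Local Notation tev := (trunc_eval j V).

Lemma power_filtration (u : R) : filtration (fun N a => exists z, a = u ^+ N * z).
Proof.
split=> [a|N|N _ _ [a ->] [b ->]|N N' _ _ [a ->] [b ->]|N N' _ NN' [a ->]].
- by exists a; rewrite expr0 mul1r.
- by exists 0; rewrite mulr0.
- by exists (a - b); rewrite mulrBr.
- by exists (a * b); rewrite exprD mulrACA.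
- by exists (u ^+ (N - N') * a); rewrite mulrA -exprD subnKC.
Qed.

Lemma trunc_evalD N a b : tev N (a + b) = tev N a + tev N b.
Proof.
by rewrite -big_split; apply: eq_bigr => d _; rewrite fcoefD mmapD mulrDr.
Qed.

Lemma trunc_evalC N c : tev N.+1 (fpsC S (mC c)) = j c.
Proof.
rewrite /trunc_eval big_ord_recl expr0 mul1r fcoefC mmapC big1 ?addr0 // => d _.
by rewrite fcoefC mmap0 mulr0.
Qed.

(** A polynomial in [t] that is zero below degree [N] is a multiple of [t^N]. *)
Lemma trunc_evalM N a b : exists z, tev N (a * b) - tev N a * tev N b = V 0%N ^+ N * z.
Proof.
pose ev : {rmorphism {poly S} -> R} :=
  horner_eval (V 0%N) \o map_poly (mmap j (fun i : 'I_k => V i.+1)).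
have evE c : tev N c = ev (ftrunc N c).
  rewrite /ftrunc poly_def rmorph_sum; apply: eq_bigr => d _ /=.
  rewrite -mul_polyC rmorphM /= map_polyC map_polyXn horner_evalE hornerM hornerC.
  by rewrite hornerXn mulrC.
pose p := ftrunc N (a * b) - ftrunc N a * ftrunc N b.
have take0 : take_poly N p = 0.
  apply/polyP => i; rewrite coef_take_poly coef0; case: ltnP => // iN.
  by rewrite coefB coef_ftrunc iN (fcoefM_ftrunc _ _ iN) subrr.
exists (ev (drop_poly N p)); rewrite !evE -rmorphM -rmorphB -/p.
rewrite -[p in LHS](poly_take_drop N) take0 add0r rmorphM mulrC; congr (_ * _).
by rewrite /= map_polyXn horner_evalE hornerXn.
Qed.

Lemma trunc_eval_mmap n (a : 'I_n -> fps S) N p :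
  exists z, mmap j (fun i => tev N.+1 (a i)) p =
    tev N.+1 (mmap (fpsC S \o @mpolyC k K) a p) + V 0%N ^+ N.+1 * z.
Proof.
elim/mpoly_ring_ind: p => [c|i|p q [z Ez] [z' Ez']|p q [z Ez] [z' Ez']].
- by exists 0; rewrite !mmapC /= mulr0 addr0 trunc_evalC.
- by exists 0; rewrite !mmapXU mulr0 addr0.
- by exists (z + z'); rewrite !mmapD trunc_evalD Ez Ez' mulrDr addrACA.
- have [z0 E0] := trunc_evalM N.+1 (mmap (fpsC S \o @mpolyC k K) a p)
      (mmap (fpsC S \o @mpolyC k K) a q).
  have congruent (x x' u c : R) : c - x * x' = u * z0 ->
      (x + u * z) * (x' + u * z') = c + u * (z * x' + x * z' + u * (z * z') - z0).
    move=> E; have -> : c = u * z0 + x * x' by rewrite -E subrK.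
    by ring.
  by eexists; rewrite !mmapM Ez Ez'; exact: congruent E0.
Qed.

End InRing.

(** The entries of [expo d m] as natural numbers, indexed like the [V l]. *)
Definition mexp d (m : multinom k) (l : nat) : nat :=
  if l is l'.+1 then (if insub l' is Some o then m o else 0%N) else d.

Lemma mexpE d m (i : 'I_k.+1) : expo d m i = mexp d m i.
Proof.
by case: (unliftP ord0 i) => [l ->|->]; rewrite ?expo0 ?expoS //= valK.
Qed.

Lemma expoBE d m d' m' (i : 'I_k.+1) :
  (expo d' m' - expo d m) i = (mexp d' m' i)%:Z - (mexp d m i)%:Z.
Proof. by rewrite -!mexpE !ffunE. Qed.

Lemma mono_mexp (R : comNzRingType) (V : nat -> R) d m :
  V 0%N ^+ d * mmap1 (fun i : 'I_k => V i.+1) m = \prod_(l < k.+1) V l ^+ mexp d m l.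
Proof. by rewrite big_ord_recl; congr (_ * _); apply: eq_bigr => i _ /=; rewrite valK. Qed.

Section LeadingMonomial.
Variables (M : nat) (R : comNzRingType) (j : {rmorphism K -> R}) (w : nat -> R).
Hypothesis M0 : (0 < M)%N.
Let V := toric k M w.

Lemma toric_lexpos d m d' m' : (forall l, mexp d m l < M)%N ->
  lexpos (expo d' m' - expo d m) ->
  exists (i : 'I_k.+1) z, \prod_(l < k.+1) V l ^+ mexp d' m' l =
    (\prod_(l < k.+1) V l ^+ mexp d m l) * (w i * z).
Proof.
move=> dmM [i [eq_i lt_i]]; have iS : (i < k.+1)%N := ltn_ord i.
have ik : (i <= k)%N by rewrite -ltnS.
have [||z Ez] := @toric_mono_div k M R w M0 (mexp d m) (mexp d' m') i ik dmM.
- move=> l li; have lk := ltn_trans li iS.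
  have := eq_i (Ordinal lk) li; rewrite expoBE /=.
  by move/eqP; rewrite subr_eq0 eqz_nat => /eqP.
- by move: lt_i; rewrite expoBE subr_gt0 ltz_nat.
by exists i, z.
Qed.

(** All other terms have lexicographically larger exponents, so by [toric_lexpos]
    their monomials are multiples of the leading monomial and of some [w i], and so
    is the power of [V 0] that bounds the error of the truncation. *)
Lemma trunc_eval_leading (I : R -> Prop) a d m c z :
  I 0 -> (forall x x', I x -> I x' -> I (x + x')) ->
  (forall i x, (i <= k)%N -> I (w i * x)) ->
  leading a (expo d m) c -> (forall l, mexp d m l < M)%N ->
  exists2 h, I h & trunc_eval j V M.+1 a + V 0%N ^+ M * z =
    (\prod_(l < k.+1) V l ^+ mexp d m l) * (j c + h).
Proof.
move=> I0 ID Iw [c0 age [d1 [m1 [/expo_inj[-> ->] ac]]]] dmM.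
set mon := \prod_(l < k.+1) _.
pose J x := exists2 h, I h & x = mon * h.
have J0 : J 0 by exists 0; rewrite ?mulr0.
have JD x x' : J x -> J x' -> J (x + x').
  by move=> [h Ih ->] [h' Ih' ->]; exists (h + h'); [exact: ID | rewrite mulrDr].
suff [h Ih E] : J (trunc_eval j V M.+1 a + V 0%N ^+ M * z - mon * j c).
  by exists h => //; rewrite [RHS]mulrDr -E [RHS]addrC subrK.
have Jw i x : (i <= k)%N -> J (mon * (w i * x)) by move=> ik; exists (w i * x) => //; exact: Iw.
pose a' : fps S := Fps (fun e => fcoef a e - (if e == d then c *: mpolyX K m else 0)).
have dM : (d < M.+1)%N by rewrite ltnW // ltnS (dmM 0%N).
have -> : trunc_eval j V M.+1 a = trunc_eval j V M.+1 a' + mon * j c.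
  rewrite /trunc_eval /mon -mono_mexp -[X in _ + X]mulrA.
  have -> : V 0%N ^+ d * (mmap1 (fun i : 'I_k => V i.+1) m * j c) =
      \sum_(e < M.+1) V 0%N ^+ e * mmap j (fun i : 'I_k => V i.+1)
        (if e == d :> nat then c *: mpolyX K m else 0).
    rewrite (bigD1 (Ordinal dM)) //= eqxx big1 ?addr0 => [|e ed].
      by rewrite mmapZ mmapX; congr (_ * _); rewrite mulrC.
    by rewrite (_ : (e == d :> nat) = false) ?mmap0 ?mulr0 //; apply: contraNF ed => /eqP ed; apply/eqP/val_inj.
  by rewrite -big_split; apply: eq_bigr => e _ /=; rewrite -mulrDr -mmapD subrK.
rewrite addrAC addrK; apply: (JD).
  rewrite /trunc_eval; elim/big_ind: _ => // e _; rewrite /mmap mulr_sumr.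
  elim/big_ind: _ => // m' _; rewrite mulrCA mono_mexp.
  have [m'0|m'0] := eqVneq (mcoeff m' (fcoef a' e)) 0.
    by rewrite m'0 rmorph0 mul0r.
  have pos : lexpos (expo e m' - expo d m).
    have tE : mcoeff m' (fcoef a' e) = term a e m' - (if (e == d :> nat) && (m' == m) then c else 0).
      rewrite /term /= mcoeffB; congr (_ - _); case: (e == d :> nat); last by rewrite mcoeff0.
      by rewrite mcoeffZ mcoeffX eq_sym; case: eqP; rewrite ?mulr1 ?mulr0.
    have [/andP[/eqP ed /eqP mm]|ne] := boolP ((e == d :> nat) && (m' == m)).
      by move: m'0; rewrite tE ed mm !eqxx ac subrr eqxx.
    apply: lexnneg_neq; first by apply: age; rewrite tE (negPf ne) subr0 in m'0.
    apply: contra ne; rewrite subr_eq0 => /eqP /expo_inj[-> ->].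
    by rewrite !eqxx.
  have [i [x ->]] := toric_lexpos dmM pos.
  by rewrite mulrCA (mulrCA (j _)); apply: Jw; rewrite -ltnS.
have pos : lexpos (expo M mnm0 - expo d m).
  exists ord0; split=> //; rewrite expoBE subr_gt0 ltz_nat.
  exact: (dmM 0%N).
have [i [x E]] := toric_lexpos dmM pos.
have -> : V 0%N ^+ M = \prod_(l < k.+1) V l ^+ mexp M mnm0 l.
  by rewrite -mono_mexp mmap11 mulr1.
by rewrite E -mulrA -(mulrA (w i)); apply: Jw; rewrite -ltnS.
Qed.

End LeadingMonomial.

End Truncation.

(** * Places with value group a lexicographic power of the integers *)

Section LexPlace.
Variables (K F : fieldType) (iota : {rmorphism K -> F}) (k : nat).
Local Notation exponent := {ffun 'I_k.+1 -> int}.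
Variable v : F -> exponent.
Hypothesis vM : forall a b, a != 0 -> b != 0 -> v (a * b) = v a + v b.
Hypothesis vD : forall a b, a != 0 -> b != 0 -> a + b != 0 ->
  lexnneg (v a) -> lexnneg (v b) -> lexnneg (v (a + b)).
Hypothesis v_cst : forall c, c != 0 -> v (iota c) = 0.
Hypothesis v_residue : forall a, a != 0 -> lexnneg (v a) ->
  exists c, a - iota c = 0 \/ lexpos (v (a - iota c)).

Local Notation O a := (a = 0 \/ lexnneg (v a)).
Local Notation M a := (a = 0 \/ lexpos (v a)).

Let v1 : v 1 = 0. Proof. by rewrite -(rmorph1 iota) v_cst // oner_neq0. Qed.
Let vV a : a != 0 -> v a^-1 = - v a.
Proof. by move=> a0; apply/eqP; rewrite -addr_eq0 -vM ?invr_eq0 // mulVf // v1. Qed.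
Let vN a : v (- a) = v a.
Proof.
have [->|a0] := eqVneq a 0; first by rewrite oppr0.
by rewrite -mulN1r vM ?oppr_eq0 ?oner_eq0 // -(rmorphN1 iota) v_cst ?add0r // oppr_eq0 oner_eq0.
Qed.

Let Onz a : a != 0 -> O a -> lexnneg (v a).
Proof. by move=> /eqP a0 []. Qed.
Let Mnz a : a != 0 -> M a -> lexpos (v a).
Proof. by move=> /eqP a0 []. Qed.

Let OD a b : O a -> O b -> O (a + b).
Proof.
have [->|a0] := eqVneq a 0; first by rewrite add0r.
have [->|b0] := eqVneq b 0; first by rewrite addr0.
have [->|ab0] := eqVneq (a + b) 0; first by move=> _ _; left.
by move=> /(Onz a0) va /(Onz b0) vb; right; exact: vD.
Qed.

Let OM a b : O a -> O b -> O (a * b).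
Proof.
have [->|a0] := eqVneq a 0; first by move=> _ _; rewrite mul0r; left.
have [->|b0] := eqVneq b 0; first by move=> _ _; rewrite mulr0; left.
move=> /(Onz a0) va /(Onz b0) vb; right.
by rewrite vM //; exact: lexnnegD.
Qed.

Let MO a : M a -> O a. Proof. by case=> [->|va]; [left | right; right]. Qed.

Let MN a : M a -> M (- a).
Proof. by case=> [->|va]; [left; rewrite oppr0 | right; rewrite vN]. Qed.

Let MD a b : M a -> M b -> M (a + b).
Proof.
have [->|a0] := eqVneq a 0; first by rewrite add0r.
have [->|b0] := eqVneq b 0; first by rewrite addr0.
have [->|ab0] := eqVneq (a + b) 0; first by move=> _ _; left.
have main c d : c != 0 -> d != 0 -> c + d != 0 -> lexpos (v c) ->
    lexnneg (v d - v c) -> lexpos (v (c + d)).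
  move=> c0 d0 cd0 vc vdc; have cdE : c + d = c * (1 + d / c).
    by rewrite mulrDr mulr1 [c * _]mulrC divfK.
  have e0 : 1 + d / c != 0 by apply: contraNneq cd0 => z; rewrite cdE z mulr0.
  rewrite cdE vM //; apply: lexpos_nnegD => //; apply: vD => //.
  - exact: oner_neq0.
  - by rewrite mulf_neq0 ?invr_eq0.
  - by left.
  - by rewrite vM ?invr_eq0 // vV.
move=> /(Mnz a0) va /(Mnz b0) vb; right.
have [ba|ab] := lex_total (v b - v a); first exact: main.
rewrite addrC; apply: main => //; first by rewrite addrC.
by right; rewrite -opprB.
Qed.

Let MM a b : O a -> M b -> M (a * b).
Proof.
have [->|a0] := eqVneq a 0; first by move=> _ _; rewrite mul0r; left.
have [->|b0] := eqVneq b 0; first by move=> _ _; rewrite mulr0; left.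
move=> /(Onz a0) va /(Mnz b0) vb; right.
by rewrite vM // addrC; exact: lexpos_nnegD.
Qed.

Let M_cst c : M (iota c) -> c = 0.
Proof.
have [//|c0] := eqVneq c 0; have i0 : iota c != 0 by rewrite fmorph_eq0.
by move=> /(Mnz i0); rewrite v_cst // => /lexpos0.
Qed.

Let res_ex a : O a -> exists c, M (a - iota c).
Proof.
have [->|a0] := eqVneq a 0; first by exists 0; rewrite rmorph0 subr0; left.
by move=> /(Onz a0)/(v_residue a0).
Qed.

Let res (a : F) : option K :=
  if pselect (O a) is left H then Some (projT1 (cid (res_ex H))) else None.

Let resP a c : O a -> M (a - iota c) -> res a = Some c.
Proof.
move=> Oa Mc; rewrite /res; case: pselect => // H; case: (cid _) => c' /= Mc'.
congr Some; apply/eqP; rewrite -subr_eq0; apply/eqP/M_cst.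
have -> : iota (c' - c) = (a - iota c) - (a - iota c') by rewrite rmorphB; ring.
exact: MD Mc (MN Mc').
Qed.

Let res_some a c : res a = Some c -> O a /\ M (a - iota c).
Proof. by rewrite /res; case: pselect => // H; case: (cid _) => c' /= Mc' [<-]. Qed.

Let res_none a : res a = None -> ~ O a.
Proof. by rewrite /res; case: pselect. Qed.

Let O_cst c : O (iota c).
Proof.
have [->|c0] := eqVneq c 0; first by left; rewrite rmorph0.
by right; left; rewrite v_cst.
Qed.

Let res_emb c : res (iota c) = Some c.
Proof. by apply: resP; [exact: O_cst | left; rewrite subrr]. Qed.

Let res1 : res 1 = Some 1.
Proof. by rewrite -(rmorph1 iota) res_emb. Qed.

Let resD a b c d : res a = Some c -> res b = Some d -> res (a + b) = Some (c + d).
Proof.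
move=> /res_some[Oa Ma] /res_some[Ob Mb]; apply: resP; first exact: OD.
by rewrite rmorphD opprD addrACA; exact: MD.
Qed.

Let resM a b c d : res a = Some c -> res b = Some d -> res (a * b) = Some (c * d).
Proof.
move=> /res_some[Oa Ma] /res_some[Ob Mb]; apply: resP; first exact: OM.
have -> : a * b - iota (c * d) = a * (b - iota d) + iota d * (a - iota c).
  by rewrite rmorphM /=; ring.
by apply: MD; apply: MM => //; exact: O_cst.
Qed.

Let O_inv a : ~ O a -> M a^-1.
Proof.
have [->|a0 Oa] := eqVneq a 0; first by case; left.
by right; rewrite vV //; apply: lexnnegNP => va; apply: Oa; right.
Qed.

Let resV a : res a = None -> res a^-1 = Some 0.
Proof.
move=> /res_none /O_inv Ma; apply: resP; first exact: MO.
by rewrite rmorph0 subr0.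
Qed.

(** The residue of [a] is the constant [c] for which [a - c] has positive value. *)
Definition lex_place : place iota := @Place K F iota K res (idfun : {rmorphism K -> K})
  res1 resD resM resV (fun u => ex_intro _ (iota u) (res_emb u)) res_emb.

Lemma lex_place_rational : rational lex_place.
Proof. by move=> u; exists u. Qed.

Lemma lex_place_ring a : place_ring lex_place a <-> a = 0 \/ lexnneg (v a).
Proof.
rewrite /place_ring /=; split; first by case E: (res a) => [c|//] _; case: (res_some E).
by move=> Oa E; exact: (res_none E).
Qed.

Lemma lex_place_ideal a : lex_place a = Some 0 <-> a = 0 \/ lexpos (v a).
Proof.
split=> [/res_some[_]|Ma]; first by rewrite rmorph0 subr0.
by apply: resP; rewrite ?rmorph0 ?subr0 //; exact: MO.
Qed.

Variable t : 'I_k.+1 -> F.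
Hypothesis t0 : forall i, t i != 0.
Hypothesis vt : forall i l, v (t i) l = (i == l)%:R.

Local Notation G := (value_group lex_place).

Definition lex_value (g : G) : exponent := v (val (repr g)).

Lemma val_leE x z : val_le lex_place x z <-> lexnneg (v (val z) - v (val x)).
Proof.
have x0 := valP x; have z0 := valP z.
have q0 : val z / val x != 0 by rewrite mulf_neq0 ?invr_eq0.
have -> : v (val z) - v (val x) = v (val z / val x) by rewrite vM ?invr_eq0 // vV.
split=> [/place_ringP/lex_place_ring/(Onz q0)//|H].
by apply/place_ringP/lex_place_ring; right.
Qed.

Lemma lex_valueE x : lex_value (value lex_place x) = v (val x).
Proof.
have /andP[/val_leE a /val_leE b] := val_eq_repr lex_place x.
apply/eqP; rewrite -subr_eq0; apply/eqP; apply: lexnneg_anti => //.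
by rewrite opprB.
Qed.

Lemma lex_value_le (g h : G) : (g <= h) <-> lexnneg (lex_value h - lex_value g).
Proof. exact: val_leE. Qed.

Lemma lex_valueD (g h : G) : lex_value (g + h) = lex_value g + lex_value h.
Proof.
have -> : g + h = value lex_place (nz_mul (repr g) (repr h)) by [].
by rewrite lex_valueE vM //; [exact: (valP (repr g)) | exact: (valP (repr h))].
Qed.

Lemma lex_value0 : lex_value 0 = 0.
Proof. by apply: (addrI (lex_value 0)); rewrite -lex_valueD !addr0. Qed.

Lemma lex_valueN (g : G) : lex_value (- g) = - lex_value g.
Proof. by apply/eqP; rewrite -addr_eq0 -lex_valueD addNr lex_value0. Qed.

Lemma lex_valueB (g h : G) : lex_value (g - h) = lex_value g - lex_value h.
Proof. by rewrite lex_valueD lex_valueN. Qed.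

Lemma lex_unit i : exists e : G, forall l, lex_value e l = (i == l)%:R.
Proof.
exists (value lex_place (exist _ (t i) (t0 i))) => l.
by rewrite lex_valueE /= vt.
Qed.

End LexPlace.

(** The place enters only through an isomorphism [lam] of its ordered value group
    with the lexicographically ordered integer vectors; surjectivity of [lam] is
    used in the form that the unit vectors are values. *)
Section LexValueGroup.
Variables (K F : fieldType) (iota : {rmorphism K -> F}) (P : place iota) (k : nat).
Local Notation G := (value_group P).
Local Notation exponent := {ffun 'I_k.+1 -> int}.
Variable lam : G -> exponent.
Hypothesis lamB : forall g h, lam (g - h) = lam g - lam h.
Hypothesis lam_le : forall g h : G, (g <= h) <-> lexnneg (lam h - lam g).
Hypothesis lam_unit : forall i, exists e : G, forall l, lam e l = (i == l)%:R.

Let lam0 : lam 0 = 0. Proof. by rewrite -(subrr 0) lamB subrr. Qed.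
Let lamN g : lam (- g) = - lam g. Proof. by rewrite -sub0r lamB lam0 sub0r. Qed.
Let lamD g h : lam (g + h) = lam g + lam h.
Proof. by rewrite -[h in LHS]opprK lamB lamN opprK. Qed.
Let lamMn g m : lam (g *+ m) = lam g *+ m.
Proof. by elim: m => [|m IH]; rewrite ?mulr0n ?lam0 // !mulrS lamD IH. Qed.
Let lam_inj : injective lam.
Proof.
by move=> g h E; apply: le_anti; apply/andP; split; apply/lam_le; rewrite E subrr; left.
Qed.

Let ffunMnE (c : exponent) m l : (c *+ m) l = c l *+ m.
Proof. by elim: m => [|m IH]; rewrite ?mulr0n ?ffunE // !mulrS ffunE IH. Qed.

Definition first_coord (g : G) : int := lam g ord0.
Let first_coord_additive : zmod_morphism first_coord.
Proof. by move=> g h; rewrite /first_coord lamB !ffunE. Qed.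
HB.instance Definition _ := GRing.isZmodMorphism.Build G int first_coord first_coord_additive.

Lemma lex_discrete : k = 0%N -> discrete P.
Proof.
move=> k0; have ord0E (i : 'I_k.+1) : i = ord0.
  by apply: val_inj; case: i => i /=; rewrite k0 ltnS leqn0 => /eqP.
have nnE (c : exponent) : lexnneg c <-> 0 <= c ord0.
  split=> [[->|[i [_]]]|]; rewrite ?ffunE //; first by rewrite (ord0E i) => /ltW.
  rewrite le_eqVlt => /orP[/eqP c0|c0].
    by left; apply/ffunP => i; rewrite (ord0E i) ffunE.
  by right; exists ord0.
have [e eE] := lam_unit ord0.
have fe : first_coord e = 1 by rewrite /first_coord eE.
exists (first_coord : {additive G -> int}); split; last first.
  move=> g h; apply/idP/idP => [gh|/lam_le/nnE].
    by apply/lam_le/nnE; rewrite !ffunE subr_ge0.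
  by rewrite !ffunE subr_ge0.
have fK z : first_coord (e *~ z) = z by rewrite raddfMz /= fe intz.
exists (fun z => e *~ z) => // g; apply: lam_inj; apply/ffunP => i.
by rewrite (ord0E i); exact: fK.
Qed.

(* the vectors whose entries vanish up to the place i *)
Let tail_group (i : nat) : set G := [set g | forall l : 'I_k.+1, (l <= i)%N -> lam g l = 0].

Let tail_convex i : convex_subgroup (tail_group i).
Proof.
split=> [l _|g h Hg Hh l li|g h d Hg Hd /andP[gh hd] l li].
- by rewrite lam0 ffunE.
- by rewrite lamB !ffunE Hg // Hh // subrr.
have [H1|[a [a1 a2]]] : lexnneg (lam h - lam g) by apply/lam_le.
  by have := congr1 (fun c : exponent => c l) H1; rewrite !ffunE Hg // subr0.
have [H1|[b [b1 b2]]] : lexnneg (lam d - lam h) by apply/lam_le.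
  have := congr1 (fun c : exponent => c l) H1; rewrite !ffunE Hd // sub0r.
  by move/eqP; rewrite oppr_eq0 => /eqP.
have [al|la] := leqP a i; last first.
  by have := a1 l (leq_ltn_trans li la); rewrite !ffunE Hg // subr0.
have [bl|lb] := leqP b i; last first.
  have := b1 l (leq_ltn_trans li lb); rewrite !ffunE Hd // sub0r.
  by move/eqP; rewrite oppr_eq0 => /eqP.
move: a2 b2; rewrite !ffunE Hg // Hd // subr0 sub0r oppr_gt0 => a2 b2.
have [ab|ba|ab] := ltngtP a b.
- by have := b1 a ab; rewrite !ffunE Hd // sub0r => /eqP; rewrite oppr_eq0 gt_eqF.
- by have := a1 b ba; rewrite !ffunE Hg // subr0 => /eqP; rewrite lt_eqF.
- by move: b2; rewrite -(val_inj ab) ltNge ltW.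
Qed.

Let e i : G := projT1 (cid (lam_unit i)).
Let eE i l : lam (e i) l = (i == l)%:R.
Proof. exact: (projT2 (cid (lam_unit i))). Qed.

Let gtF (i l : 'I_k.+1) : (l < i)%N -> (i == l) = false.
Proof. by move=> li; rewrite -val_eqE /= gtn_eqF. Qed.

Let convexMn (H : set G) g m : convex_subgroup H -> H g -> H (g *+ m).
Proof.
move=> [H0 HB _] Hg; have HN d : H d -> H (- d) by rewrite -sub0r; exact: HB.
elim: m => [|m IH]; first by rewrite mulr0n.
by rewrite mulrS -[g *+ m]opprK; apply: HB => //; exact: HN.
Qed.

(* an element with no coordinate before i is bounded by a multiple of e i *)
Let bounded (H : set G) i g : convex_subgroup H -> H (e i) ->
  (forall l : 'I_k.+1, (l < i)%N -> lam g l = 0) -> H g.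
Proof.
move=> CH Hi gl; case: (CH) => H0 HB Hc; pose m := `|lam g i|%N.+1.
have Hm : H (e i *+ m) by exact: convexMn.
have HmN : H (- (e i *+ m)) by rewrite -sub0r; exact: HB.
have gm : `|lam g i| < m%:Z by rewrite /m -abszE ltz_nat.
apply: (Hc _ _ _ HmN Hm); apply/andP; split; apply/lam_le; right; exists i.
  split=> [l li|]; rewrite lamN lamMn !ffunE ffunMnE eE opprK.
    by rewrite gl // gtF //= mulr0n mul0rn addr0.
  by move: gm; rewrite eqxx /= -mulrnA mul1n ltr_norml => /andP[+ _]; rewrite -subr_gt0 opprK natz.
split=> [l li|]; rewrite lamMn !ffunE ffunMnE eE.
  by rewrite gl // gtF //= mulr0n mul0rn subr0.
by move: gm; rewrite eqxx /= -mulrnA mul1n ltr_norml => /andP[_]; rewrite -subr_gt0 natz.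
Qed.

(** If a convex subgroup contains a vector whose first nonzero entry is at [l], it
    contains the unit vector at [l], which lies between 0 and twice that vector up
    to sign, and then all vectors that vanish before [l], which lie between
    multiples of that unit vector. So the proper convex subgroups are the
    [tail_group]s. *)
Lemma lex_rank : rank_is P k.+1.
Proof.
rewrite /rank_is card_eq_sym; apply/card_set_bijP; exists tail_group; split.
- move=> i /= ik; split; first exact: tail_convex.
  move=> /(congr1 (fun H : set G => H (e (Ordinal ik)))) E.
  have : tail_group i (e (Ordinal ik)) by rewrite E.
  by move=> /(_ (Ordinal ik) (leqnn i)) /eqP; rewrite eE eqxx oner_eq0.
- have main i l : (i < l)%N -> (l < k.+1)%N -> tail_group i = tail_group l -> False.
    move=> il lk E; have : tail_group l (e (Ordinal lk)).
      rewrite -E => d di; rewrite eE gtF //.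
      exact: leq_ltn_trans il.
    by move=> /(_ (Ordinal lk) (leqnn l)) /eqP; rewrite eE eqxx oner_eq0.
  move=> i l; rewrite !inE /= => ik lk E; have [il|li|//] := ltngtP i l.
    by case: (main _ _ il lk E).
  by case: (main _ _ li ik (esym E)).
move=> H [CH HT]; case: (CH) => H0 HB Hc.
have He_le (i l : 'I_k.+1) : (i <= l)%N -> H (e i) -> H (e l).
  move=> il Hi; apply: (bounded CH Hi) => d di; rewrite eE gtF //.
  exact: leq_trans di il.
have not0 : ~ H (e ord0).
  move=> He; apply: HT; rewrite eqEsubset; split=> // g _.
  exact: (bounded CH He).
have [i iH imax] : exists2 i, ~ H (e i) & forall l : 'I_k.+1, (i < l)%N -> H (e l).
  have P0 : `[< ~ H (e ord0) >] by apply/asboolP.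
  case: (@arg_maxnP _ ord0 (fun i => `[< ~ H (e i) >]) val P0) => i /asboolP iH imax.
  exists i => // l il; apply: contrapT => lH.
  by have := imax l (asboolT lH); rewrite /= leqNgt il.
exists (val i) => /=; first exact: ltn_ord.
rewrite eqEsubset; split=> g Hg.
  have [ik|ki] := ltnP i.+1 k.+1.
    apply: (bounded CH (imax (Ordinal ik) (ltnSn i))) => l li.
    exact: Hg.
  have -> : g = 0; last exact: H0.
  apply: lam_inj; rewrite lam0; apply/ffunP => l; rewrite ffunE; apply: Hg.
  by rewrite -ltnS (leq_trans (ltn_ord l)).
move=> l0 l0i; apply/eqP; apply: contrapT => /negP l0n.
have [l ln lmin] : exists2 l : 'I_k.+1, lam g l != 0 & forall d : 'I_k.+1, (d < l)%N -> lam g d = 0.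
  case: (@arg_minnP _ l0 (fun i => lam g i != 0) val l0n) => l ln lmin.
  exists l => // d dl; apply/eqP; apply: contraTT dl => /lmin.
  by rewrite -leqNgt.
have li : (l <= i)%N.
  rewrite (leq_trans _ l0i) // leqNgt; apply/negP => l0l.
  by move: l0n; rewrite lmin // eqxx.
apply: iH; apply: (He_le l) => //.
(* up to sign, twice an element with first nonzero entry at l exceeds e l *)
have [g' [Hg' g'l g'0]] : exists g', [/\ H g', 0 < lam g' l &
    forall d : 'I_k.+1, (d < l)%N -> lam g' d = 0].
  case: (ltgtP (lam g l) 0) ln => // gl _; last by exists g.
  exists (- g); rewrite lamN !ffunE oppr_gt0; split=> //.
    by rewrite -sub0r; exact: HB.
  by move=> d dl; rewrite ffunE lmin // oppr0.
apply: (Hc 0 _ (g' *+ 2) H0); first exact: convexMn.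
apply/andP; split; apply/lam_le; rewrite ?lam0 ?subr0; right; exists l.
  by split=> [d dl|]; rewrite eE ?eqxx // gtF.
have cE d : (lam (g' *+ 2) - lam (e l)) d = lam g' d *+ 2 - (l == d)%:R.
  by rewrite lamMn -eE -ffunMnE !ffunE.
split=> [d dl|]; rewrite cE; first by rewrite g'0 // gtF.
rewrite eqxx /= subr_gt0 mulr2n; apply: (@lt_le_trans _ _ (1 + 1)) => //.
by apply: lerD; rewrite -gtz0_ge1.
Qed.

End LexValueGroup.

(** * Smooth models for a place given by leading terms *)

Section PlaceOnPolynomials.
Variables (K F : fieldType) (iota : {rmorphism K -> F}) (P : place iota).

Lemma place_mmap m (y : 'I_m -> F) (z : 'I_m -> residue_field P) p :
  (forall i, P (y i) = Some (z i)) -> P (mmap iota y p) = Some (mmap (residue_emb P) z p).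
Proof.
move=> Py; elim/mpoly_ring_ind: p => [c|i|p q IHp IHq|p q IHp IHq].
- by rewrite !mmapC place_emb.
- by rewrite !mmapXU.
- by rewrite !mmapD; exact: placeD.
- by rewrite !mmapM; exact: placeM.
Qed.

Lemma place_inv a u : P a = Some u -> u != 0 -> P a^-1 = Some u^-1.
Proof.
move=> Pa u0; case Ea: (P a^-1) => [w|]; last first.
  by have := placeV Ea; rewrite invrK Pa => -[/eqP]; rewrite (negPf u0).
have a0 : a != 0 by apply: contraNneq u0 => a0; move: Pa; rewrite a0 place0 => -[<-].
have := placeM Pa Ea; rewrite divff // place1 => -[/esym uw].
by congr Some; apply: (mulfI u0); rewrite uw divff.
Qed.

(** The inverse of [sg] joins the coordinates, with the equation [sg * u - 1 = 0]. Its
    derivative in [u] is the value of [sg] at the center, so the rank of the Jacobian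
    matrix grows by one. *)
Lemma chart_smooth n r m (y : 'I_m -> F) (g : 'I_r -> mpoly m K) (sg : mpoly m K) (s : seq F) :
  has_trdeg iota n -> (n + r)%N = m -> generates iota y ->
  (forall i, P (y i) = Some 0) -> (forall i, mmap iota y (g i) = 0) ->
  row_free (\matrix_(i < r, l < m) mcst (mderiv l (g i))) ->
  mcst sg != 0 -> (forall a, a \in s -> exists p, a * mmap iota y sg = mmap iota y p) ->
  exists (m' : nat) (y' : 'I_m' -> F), [/\ generates iota y', centered P y',
    center_smooth P y' & {in s, forall a, exists p, a = mmap iota y' p}].
Proof.
move=> Hn nrm gen_y Py gy Jg sg0 sP.
pose u := mmap iota y sg.
have Pu : P u = Some (residue_emb P (mcst sg)).
  by rewrite (place_mmap sg Py) mcst_mmap.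
have eu0 : residue_emb P (mcst sg) != 0 by rewrite fmorph_eq0.
have u0 : u != 0 by apply: contraNneq eu0 => u0; move: Pu; rewrite u0 place0 => -[<-].
pose y' := join_coord y (fun _ : 'I_1 => u^-1).
pose e : mpoly m K -> mpoly (m + 1) K := mmap (@mpolyC _ K) (fun i => mX (lshift 1 i)).
have eE p : mmap iota y' (e p) = mmap iota y p.
  by rewrite mmap_mmap; apply: eq_mmap => // i; rewrite mmapXU /y' join_coordl.
pose z' := join_coord (fun _ : 'I_m => 0) (fun _ : 'I_1 => (residue_emb P (mcst sg))^-1).
have Py' i : P (y' i) = Some (z' i).
  case: (split_ordP i) => l ->; rewrite /y' /z' ?join_coordl ?join_coordr //.
  exact: place_inv.
have ez p : mmap (residue_emb P) z' (e p) = residue_emb P (mcst p).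
  by rewrite mmap_mmap mcst_mmap // => i; rewrite mmapXU /z' join_coordl.
exists (m + 1)%N, y'; split.
- move=> a; have [p [q [q0 ->]]] := gen_y a.
  by exists (e p), (e q); rewrite !eE.
- by move=> i; rewrite /place_ring /= Py'.
- have centE : Defs.center P y' =1 z' by move=> i; rewrite /Defs.center Py'.
  pose g' : 'I_(r + 1) -> mpoly (m + 1) K := join_coord (fun i => e (g i))
    (fun _ : 'I_1 => e sg * mX (rshift m ord0) - 1).
  have dl i p : mderiv (lshift 1 i) (e p) = e (mderiv i p).
    rewrite mderiv_mmap (bigD1 i) //= big1 => [|l li].
      by rewrite mderiv_mX eqxx /= mulr1n mpolyC1 mulr1 addr0.
    by rewrite mderiv_mX eq_lshift (negPf li) /= mulr0n mpolyC0 mulr0.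
  have dr i p : mderiv (rshift m i) (e p) = 0.
    rewrite mderiv_mmap big1 // => l _.
    by rewrite mderiv_mX eq_lrshift /= mulr0n mpolyC0 mulr0.
  exists n, (r + 1)%N, g'; split=> //.
    move=> i; case: (split_ordP i) => l ->; rewrite /g' ?join_coordl ?join_coordr.
      by rewrite eE.
    by rewrite mmapB mmapM eE mmapXU rmorph1 /y' join_coordr divff ?subrr.
  set J := \matrix_(_, _) _; suff /eqP -> : row_free J by rewrite addnAC [(r + n)%N]addnC nrm.
  have JE i l : J i l = mmap (residue_emb P) z' (mderiv l (g' i)).
    by rewrite mxE; exact: eq_mmap.
  apply: inj_row_free => v vJ.
  have vJE l : \sum_i v 0 i * J i l = 0 by have /rowP/(_ l) := vJ; rewrite !mxE.
  have vr : v 0 (rshift r ord0) = 0.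
    have := vJE (rshift m ord0); rewrite big_split_ord /= big_ord1 big1 => [|i _].
      rewrite add0r JE /g' join_coordr mderivB mderivM dr mul0r add0r mderiv_mX eqxx.
      rewrite -(mpolyC1 (m + 1) K) mderivC subr0 /= mulr1n mpolyC1 mulr1 ez.
      by move/eqP; rewrite mulf_eq0 (negPf eu0) orbF => /eqP.
    by rewrite JE /g' join_coordl dr mmap0 mulr0.
  have vl : lsubmx v = 0.
    have : row_free (map_mx (residue_emb P) (\matrix_(i < r, l < m) mcst (mderiv l (g i)))).
      by rewrite row_free_map.
    move/row_free_inj; apply; rewrite mul0mx; apply/rowP => l.
    have El : \sum_i v 0 (lshift 1 i) * J (lshift 1 i) (lshift 1 l) = 0.
      by have := vJE (lshift 1 l); rewrite big_split_ord /= big_ord1 vr mul0r addr0.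
    rewrite [RHS]mxE -[RHS]El mxE; apply: eq_bigr => i _.
    by rewrite JE /g' join_coordl dl ez !mxE.
  rewrite -[v]hsubmxK vl; apply/rowP => i.
  case: (split_ordP i) => l ->; rewrite ?row_mxEl ?row_mxEr !mxE //.
  by rewrite ord1.
- move=> a /sP[p Ea]; exists (e p * mX (rshift m ord0)).
  by rewrite mmapM eE -Ea mmapXU /y' join_coordr mulfK.
Qed.

End PlaceOnPolynomials.

Section SeriesPlace.
Variables (K F : fieldType) (iota : {rmorphism K -> F}) (n s k : nat).
Variables (y : 'I_(n + s) -> F) (f : 'I_s -> mpoly (n + s) K).
Hypothesis Hf : solvable_system f.
Hypothesis fy : forall l, mmap iota y (f l) = 0.
Hypothesis gen_y : generates iota y.
Hypothesis trdeg_n : has_trdeg iota n.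
Hypothesis kn : (k.+1 <= n)%N.
Variable xi : 'I_n -> fps (mpoly k K).
Hypothesis Hxi : forall i, tdvd 1 (xi i).
Hypothesis xi_chart : forall i : 'I_k.+1, xi (widen_ord kn i) = chart_series K i.

Local Notation S := (mpoly k K).
Local Notation exponent := {ffun 'I_k.+1 -> int}.
Definition series_hom : {rmorphism mpoly (n + s) K -> fps S} := series_eval f (@mpolyC k K) xi.
Hypothesis theta_eq0 : forall p, series_hom p = 0 <-> mmap iota y p = 0.

Let thetaC c : series_hom (mC c) = fpsC S (mC c). Proof. exact: series_evalC. Qed.

Let v : F -> exponent := fval iota y series_hom.
Let vM : forall a b, a != 0 -> b != 0 -> v (a * b) = v a + v b :=
  fvalM gen_y theta_eq0.
Let v_cst c : c != 0 -> v (iota c) = 0.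
Proof. by move=> c0; exact: fval_cst. Qed.
Let vV a : a != 0 -> v a^-1 = - v a.
Proof. by move=> a0; exact: fvalV. Qed.

Definition series_place : place iota := lex_place vM (fvalD gen_y theta_eq0 thetaC) v_cst
  (fval_residue gen_y theta_eq0 thetaC).

Let x0 := y (lshift s (widen_ord kn ord0)).
Let V (j : nat) : F :=
  if j is 0 then x0 else y (lshift s (widen_ord kn (inord j))) / x0.

(* z is a fraction with a power of x0 below, and a is the power series that
   series_hom, extended to such fractions, assigns to it *)
Let rep (z : F) (a : fps S) := exists B p,
  mmap iota y p = x0 ^+ B * z /\ series_hom p = fpsX S ^+ B * a.

Let repD z a z' a' : rep z a -> rep z' a' -> rep (z + z') (a + a').
Proof.
move=> [B [p [pz pa]]] [B' [p' [pz' pa']]].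
pose X0 : mpoly (n + s) K := mX (lshift s (widen_ord kn ord0)).
have X0y : mmap iota y X0 = x0 by rewrite mmapXU.
have X0t : series_hom X0 = fpsX S.
  rewrite /series_hom series_evalX /series_coord join_coordl xi_chart /chart_series.
  by rewrite chart_coef0 rmorph1 mul1r.
exists (B + B')%N, (p * X0 ^+ B' + p' * X0 ^+ B); split.
  rewrite mmapD !mmapM pz pz' !rmorphXn /= X0y exprD; ring.
by rewrite rmorphD !rmorphM pa pa' !rmorphXn X0t exprD mulrDr mulrAC; congr (_ + _); rewrite mulrC mulrA.
Qed.

Let repM z a z' a' : rep z a -> rep z' a' -> rep (z * z') (a * a').
Proof.
move=> [B [p [pz pa]]] [B' [p' [pz' pa']]].
exists (B + B')%N, (p * p'); split.
  by rewrite mmapM pz pz' exprD mulrACA.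
by rewrite rmorphM pa pa' exprD mulrACA.
Qed.

Let repC c : rep (iota c) (fpsC S (mC c)).
Proof. by exists 0%N, (mC c); rewrite mmapC thetaC !expr0 !mul1r. Qed.

Let repy l : rep (y l) (series_coord f (@mpolyC k K) xi l).
Proof. by exists 0%N, (mX l); rewrite mmapXU /series_hom series_evalX !expr0 !mul1r. Qed.

Let repX0 : rep x0 (fpsX S).
Proof.
have := repy (lshift s (widen_ord kn ord0)).
by rewrite /series_coord join_coordl xi_chart /chart_series chart_coef0 rmorph1 mul1r.
Qed.

Let lead_mono m : leading (fpsC S (mpolyX K m)) (expo 0 m) 1.
Proof.
split; [exact: oner_neq0 | | by exists 0%N, m; rewrite /term fcoefC mcoeffX eqxx].
move=> d m'; rewrite /term fcoefC; case: (eqVneq d 0%N) => [->|_]; last by rewrite mcoeff0 eqxx.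
by rewrite mcoeffX; case: (eqVneq m m') => [->|_]; rewrite ?eqxx // subrr; left.
Qed.

Let lead_X : leading (fpsX S) (expo 1 (@mnm0 k)) 1.
Proof.
split; [exact: oner_neq0 | | by exists 1%N, mnm0; rewrite /term fcoefX mcoeff1 eqxx].
move=> d m'; rewrite /term fcoefX; case: (eqVneq d 1%N) => [->|_]; last by rewrite mcoeff0 eqxx.
by rewrite mcoeff1; case: (eqVneq m' mnm0) => [->|_]; rewrite ?eqxx // subrr; left.
Qed.

Let x0_lead : x0 != 0 /\ v x0 = expo 1 (@mnm0 k).
Proof.
have : leading (series_hom (mX (lshift s (widen_ord kn ord0)))) (expo 1 (@mnm0 k)) 1.
  rewrite /series_hom series_evalX /series_coord join_coordl xi_chart /chart_series.
  by rewrite chart_coef0 rmorph1 mul1r.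
by move/(fval_leading gen_y theta_eq0 thetaC); rewrite mmapXU.
Qed.

Let rep_leading z a g c : rep z a -> leading a g c -> z != 0 /\ v z = g.
Proof.
move=> [B [p [pz pa]]] la; have [x00 vx0] := x0_lead.
have lXB : leading (fpsX S ^+ B) (expo 1 (@mnm0 k) *+ B) 1.
  elim: B {pz pa} => [|B IH].
    rewrite expr0 mulr0n -(rmorph1 (fpsC S)) -(mpolyC1 k K).
    by apply: leadingC; exact: oner_neq0.
  by have := leadingM lead_X IH; rewrite mulr1 -exprS -mulrS.
have := leadingM lXB la; rewrite -pa => /(fval_leading gen_y theta_eq0 thetaC)[].
rewrite pz mulf_eq0 negb_or => /andP[xB0 z0]; rewrite -/v vM //.
have -> : v (x0 ^+ B) = expo 1 (@mnm0 k) *+ B.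
  elim: (B) => [|B' IH]; last by rewrite exprS vM ?expf_neq0 // vx0 IH mulrS.
  by rewrite expr0 mulr0n -(rmorph1 iota) v_cst // oner_neq0.
by move/addrI.
Qed.

Let rep_neq0 z a : rep z a -> z != 0 -> a != 0.
Proof.
move=> [B [p [pz pa]]] z0; apply: contraNneq z0 => a0.
have [x00 _] := x0_lead.
have /theta_eq0/eqP : series_hom p = 0 by rewrite pa a0 mulr0.
by rewrite pz mulf_eq0 expf_eq0 (negPf x00) andbF.
Qed.

Let repV (i : 'I_k) : rep (V i.+1) (fpsC S (mX i)).
Proof.
have [x00 _] := x0_lead.
exists 1%N, (mX (lshift s (widen_ord kn (lift ord0 i)))); split.
  rewrite mmapXU expr1 /V mulrC divfK //; congr (y (lshift s (widen_ord kn _))).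
  by apply: val_inj; rewrite /= inordK // ltnS.
rewrite /series_hom series_evalX /series_coord join_coordl xi_chart /chart_series.
by rewrite chart_coefS expr1 mulrC.
Qed.

Let V_lead j : (j <= k)%N -> V j != 0 /\ forall l : 'I_k.+1, v (V j) l = (j == l :> nat)%:R.
Proof.
case: j => [|j] jk.
  have [x00 vx0] := x0_lead; split=> // l; rewrite [v _]vx0 mexpE.
  by case: l => -[|l] Hl //=; case: insub => // o; rewrite mnm0E.
have [V0 VE] := rep_leading (repV (Ordinal jk)) (lead_mono _); split=> // l.
rewrite [v _]VE mexpE; case: l => -[|l] Hl //=.
rewrite (insubT (fun i => i < k)%N (Hl : (l < k)%N)) mnm1E -val_eqE /= eqSS.
by rewrite natz.
Qed.

Let V_neq0 (i : 'I_k.+1) : V i != 0.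
Proof. by case: (V_lead (ltnSE (ltn_ord i))). Qed.
Let vV_unit (i l : 'I_k.+1) : v (V i) l = (i == l)%:R.
Proof. by case: (V_lead (ltnSE (ltn_ord i))) => _ ->; rewrite val_eqE. Qed.

Lemma series_place_rational : rational series_place.
Proof. exact: lex_place_rational. Qed.

Lemma series_place_discrete : k = 0%N -> discrete series_place.
Proof.
apply: (lex_discrete (lam := @lex_value _ _ _ _ _ vM (fvalD gen_y theta_eq0 thetaC) v_cst
  (fval_residue gen_y theta_eq0 thetaC))).
- exact: lex_valueB.
- exact: lex_value_le.
- exact: (lex_unit _ _ _ _ V_neq0 vV_unit).
Qed.

Lemma series_place_rank : rank_is series_place k.+1.
Proof.
apply: (lex_rank (lam := @lex_value _ _ _ _ _ vM (fvalD gen_y theta_eq0 thetaC) v_cst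
  (fval_residue gen_y theta_eq0 thetaC))).
- exact: lex_valueB.
- exact: lex_value_le.
- exact: (lex_unit _ _ _ _ V_neq0 vV_unit).
Qed.

Let place0P a : a = 0 \/ lexpos (v a) -> series_place a = Some 0.
Proof. by move=> H; apply/lex_place_ideal. Qed.

(** The series of a coordinate has positive order in [t], so its leading exponent is
    positive whatever the other entries are. *)
Lemma series_place_center l : series_place (y l) = Some 0.
Proof.
apply: place0P; have [->|yl0] := eqVneq (y l) 0; [by left | right].
have [g [c lg]] := leading_ex (rep_neq0 (repy l) yl0).
have [_ ->] := rep_leading (repy l) lg.
case: lg => c0 _ [d [m [<- E]]]; exists ord0; split=> //; rewrite expo0.
case: d E => [|d] // E; move: c0.
by rewrite -E /term (series_coord1 Hf (@mpolyC k K) Hxi) // mcoeff0 eqxx.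
Qed.

(** The data used to put a member of the valuation ring in the coordinate ring of
    the chart of level B. *)
Let presented B a := a = 0 \/ exists p q d m c d' m' c',
  [/\ mmap iota y q != 0 /\ a = mmap iota y p / mmap iota y q,
      leading (series_hom p) (expo d m) c /\ leading (series_hom q) (expo d' m') c',
      forall l, (mexp d m l < B)%N, forall l, (mexp d' m' l < B)%N &
      lexnneg (expo d m - expo d' m')].

Section Chart.
Variable M : nat.
Hypothesis M0 : (0 < M)%N.

(* toric k M recovers the V_j from these *)
Let w (j : nat) : F := if (j < k)%N then V j / V j.+1 ^+ M else V j.

Let toric_w j : (j <= k)%N -> toric k M w j = V j.
Proof.
move=> jk; rewrite -(subKn jk); elim: (k - j)%N (leq_subr j k) => [|d IH] dk.
  by rewrite subn0 toric_last /w ltnn.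
have lt_k : (k - d.+1 < k)%N by rewrite -subSn // leq_subLR addSn ltnS leq_addl.
have dE : (k - d.+1).+1 = (k - d)%N by rewrite subnSK.
have Vd : V (k - d)%N != 0 by case: (V_lead (leq_subr d k)).
rewrite toric_rec ?lt_k // dE (IH (ltnW dk)) /w lt_k dE.
by rewrite divfK // expf_neq0.
Qed.

Local Notation E := (mpoly (k.+1 + (n + s)) K).
Let W (j : nat) : E := mX (lshift (n + s) (inord j)).
Let VE := toric k M W.
Let sc := series_coord f (@mpolyC k K) xi.
(* AE and AF are the truncated series of y l as a polynomial in the chart
   coordinates and as an element of F; H expresses a polynomial in y in the chart
   coordinates Y *)
Let AE l : E := trunc_eval (@mpolyC _ K) VE M.+1 (sc l).
Let AF l : F := trunc_eval iota V M.+1 (sc l).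
Let H : mpoly (n + s) K -> E :=
  mmap (@mpolyC _ K) (fun l => AE l + VE 0%N ^+ M * mX (rshift k.+1 l)).
Let Y : 'I_(k.+1 + (n + s)) -> F :=
  join_coord (fun i : 'I_k.+1 => w i) (fun l => (y l - AF l) / V 0%N ^+ M).

Let V0n0 : V 0%N != 0. Proof. by case: (V_lead (leq0n k)). Qed.

Let VY j : (j <= k)%N -> mmap iota Y (VE j) = V j.
Proof.
move=> jk; rewrite rmorph_toric -[RHS]toric_w // /toric !big_seq.
apply: eq_bigr => i; rewrite mem_index_iota => /andP[_ ik].
by rewrite /= mmapXU /Y join_coordl inordK.
Qed.

Let HY p : mmap iota Y (H p) = mmap iota y p.
Proof.
rewrite mmap_mmap; apply: eq_mmap => // l.
rewrite mmapD mmapM rmorphXn /= VY // mmapXU /Y join_coordr mulrC divfK ?expf_neq0 //.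
rewrite [X in X + _](_ : _ = AF l); first by rewrite addrC subrK.
by rewrite rmorph_trunc_eval; apply: eq_trunc_eval => [c|i ik] /=; [rewrite mmapC | exact: VY].
Qed.

Let Y_gen : generates iota Y.
Proof. by move=> a; have [p [q [q0 ->]]] := gen_y a; exists (H p), (H q); rewrite !HY. Qed.

Let rep_trunc a : rep (trunc_eval iota V M.+1 a)
  (\sum_(d < M.+1) fpsX S ^+ d * fpsC S (fcoef a d)).
Proof.
have rep0 : rep 0 0 by exists 0%N, 0; rewrite !rmorph0 !mulr0.
have rep1 : rep 1 1.
  by have := repC 1; rewrite mpolyC1 !rmorph1.
apply: (big_ind2 rep) => [|z1 a1 z2 a2|d _]; [exact: rep0 | exact: repD | apply: repM].
  elim: (val d) => [|e IH]; first by rewrite !expr0.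
  by rewrite !exprS; apply: repM IH; exact: repX0.
elim/mpoly_ring_ind: (fcoef a d) => [c|i|p q IHp IHq|p q IHp IHq].
- by rewrite mmapC; exact: repC.
- by rewrite mmapXU; exact: repV.
- by rewrite mmapD fpsCD; exact: repD IHp IHq.
- by rewrite mmapM fpsCM; exact: repM IHp IHq.
Qed.

Let Y_place i : series_place (Y i) = Some 0.
Proof.
apply: place0P; case: (split_ordP i) => l ->; rewrite /Y ?join_coordl ?join_coordr.
  right; rewrite /w; have lk : (l <= k)%N by rewrite -ltnS.
  have [Vl0 Vl] := V_lead lk; case: ltnP => [lt_lk|_].
    have [VS0 VS] := V_lead lt_lk.
    have vX : v (V l.+1 ^+ M) = v (V l.+1) *+ M.
      elim: (M) => [|e IH]; last by rewrite exprS vM ?expf_neq0 // IH mulrS.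
      by rewrite expr0 mulr0n -(rmorph1 iota) v_cst // oner_neq0.
    have vlE d : v (V l / V l.+1 ^+ M) d = v (V l) d - v (V l.+1) d *+ M.
      rewrite vM ?invr_eq0 ?expf_neq0 // vV ?expf_neq0 // vX !ffunE; congr (_ - _).
      by elim: (M) => [|e IH]; rewrite ?mulr0n ?ffunE // !mulrS ffunE IH.
    exists l; split=> [d dl|]; rewrite vlE Vl VS.
      by rewrite !gtn_eqF ?(ltnW dl) //= ?mul0rn ?subr0 // ltnS ltnW.
    by rewrite eqxx gtn_eqF //= mul0rn subr0.
  by exists l; split=> [d dl|]; rewrite Vl ?eqxx // gtn_eqF.
have [->|z0] := eqVneq (y l - AF l) 0; [by left; rewrite mul0r | right].
have : rep (y l - AF l) (sc l - \sum_(d < M.+1) fpsX S ^+ d * fpsC S (fcoef (sc l) d)).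
  have := repD (repy l) (repM (repC (-1)) (rep_trunc (sc l))).
  by rewrite !rmorphN1 !mulN1r.
set a := sc l - _ => ra.
have aM : tdvd M.+1 a := @tdvd_trunc _ M.+1 (sc l).
have [g [c lg]] := leading_ex (rep_neq0 ra z0).
have [_ vE] := rep_leading ra lg.
have [_ vx0] := x0_lead.
have vX : v (V 0%N ^+ M) = expo 1 (@mnm0 k) *+ M.
  elim: (M) => [|e IH]; last by rewrite exprS vM ?expf_neq0 // IH mulrS [v (V 0)]vx0.
  by rewrite expr0 mulr0n -(rmorph1 iota) v_cst // oner_neq0.
exists ord0; split=> //; rewrite vM ?invr_eq0 ?expf_neq0 // vV ?expf_neq0 // vX vE.
have -> : (g - expo 1 (@mnm0 k) *+ M) ord0 = g ord0 - M%:Z.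
  rewrite ffunE [X in _ + X]ffunE; congr (_ - _).
  elim: (M) => [|e IH]; first by rewrite mulr0n ffunE.
  by rewrite mulrS ffunE IH expo0 -PoszD.
case: lg => c0 _ [d [m [<- tE]]]; rewrite expo0 subr_gt0 ltz_nat ltnNge.
by apply: contra c0 => dM; rewrite -tE /term aM ?mcoeff0.
Qed.

(* in the chart p(y) is its truncated series, up to a multiple of V_0^M *)
Let H_expand p : exists z, H p = trunc_eval (@mpolyC _ K) VE M.+1 (series_hom p) + VE 0%N ^+ M * z.
Proof.
have [z1 E1] := trunc_eval_mmap (@mpolyC (k.+1 + (n + s)) K) VE sc M p.
have [|z2 E2] := filt_lipschitz (power_filtration (VE 0%N)) (@mpolyC _ K) (N := M)
  (a := fun l => AE l + VE 0%N ^+ M * mX (rshift k.+1 l)) (b := AE) p.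
  by move=> l; exists (mX (rshift k.+1 l)); rewrite addrC addKr.
have {}E2 : H p = mmap (@mpolyC _ K) AE p + VE 0%N ^+ M * z2 by rewrite -E2 addrC subrK.
exists (VE 0%N * z1 + z2); rewrite E2 E1 exprS -addrA.
by congr (_ + _); rewrite mulrDr mulrCA mulrA.
Qed.

Let H_cst p : mcst (H p) = mcst p.
Proof.
rewrite /H rmorph_mmap.
rewrite (mcst_mmap (@mcoeff _ _ mnm0 \o @mpolyC (k.+1 + (n + s)) K)) /=.
  by rewrite mcoeffC eqxx mulr1.
have V00 : mcst (VE 0%N) = 0.
  rewrite rmorph_toric /toric big_ltn //= subnn expn0 expr1.
  by rewrite mcoeffX mnm1_eq0 mul0r.
move=> l; rewrite /= mcoeffD rmorphM rmorphXn /= V00 expr0n gtn_eqF // mul0r addr0.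
rewrite rmorph_trunc_eval /trunc_eval big1 // => -[[|d] Hd] _ /=; last first.
  by rewrite V00 expr0n mul0r.
have -> : fcoef (sc l) 0 = 0 by apply: (series_coord1 Hf (@mpolyC k K) Hxi).
by rewrite mmap0 mulr0.
Qed.

(* the V_j and the AE l involve the first k.+1 chart coordinates only, so the
   derivatives in the others see only the linear terms in dcoord *)
Let e : mpoly k.+1 K -> E := mmap (@mpolyC _ K) (fun i => mX (lshift (n + s) i)).
Let VB := toric k M (fun j => mX (inord j) : mpoly k.+1 K).
Let eV j : VE j = e (VB j).
Proof.
rewrite [e _]rmorph_toric; apply: eq_bigr => i _.
by rewrite /= mmapXU.
Qed.
Let eA l : AE l = e (trunc_eval (@mpolyC _ K) VB M.+1 (sc l)).
Proof.
rewrite [e _]rmorph_trunc_eval; apply: eq_trunc_eval => [c|i ik] /=.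
  by rewrite mmapC.
exact: eV.
Qed.
Let de i p : mderiv (rshift k.+1 i) (e p) = 0.
Proof.
rewrite mderiv_mmap big1 // => l _.
by rewrite mderiv_mX eq_lrshift /= mulr0n mpolyC0 mulr0.
Qed.

Let eVM : VE 0%N ^+ M = e (VB 0%N ^+ M).
Proof. by rewrite eV /e rmorphXn. Qed.

Let dcoord i l : mderiv (rshift k.+1 i) (AE l + VE 0%N ^+ M * mX (rshift k.+1 l)) =
  VE 0%N ^+ M * mC (l == i)%:R.
Proof.
by rewrite mderivD mderivM eA eVM !de add0r mul0r add0r mderiv_mX eq_rshift.
Qed.

Let dH i p : mderiv (rshift k.+1 i) (H p) = VE 0%N ^+ M * H (mderiv i p).
Proof.
rewrite [LHS]mderiv_mmap; transitivity (H (mderiv i p) * VE 0%N ^+ M); last exact: mulrC.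
rewrite (bigD1 i) //= [X in _ + X]big1 => [|l li].
  by rewrite addr0 dcoord eqxx /= mulr1n mpolyC1 mulr1.
by rewrite dcoord (negPf li) /= mulr0n mpolyC0 !mulr0.
Qed.

Let VE0 : VE 0%N != 0.
Proof.
rewrite /VE /toric prodf_seq_neq0; apply/allP => j _ /=.
apply: expf_neq0; apply/eqP => /(congr1 (mcoeff (mnm1 (lshift (n + s) (inord j))))).
by rewrite mcoeffX eqxx mcoeff0 => /eqP; rewrite oner_eq0.
Qed.

(* the series of f l is 0, so the error in H_expand is all that is left *)
Let f_chart : exists f' : 'I_s -> E, forall l, H (f l) = VE 0%N ^+ M * f' l.
Proof.
have /boolp.choice[f' Hf'] : forall l, exists z, H (f l) = VE 0%N ^+ M * z.
  move=> l; have [z Ez] := H_expand (f l); exists z; rewrite Ez.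
  rewrite (proj2 (theta_eq0 _) (fy l)) /trunc_eval big1 ?add0r // => d _.
  by rewrite fcoef0 mmap0 mulr0.
by exists f'.
Qed.

(* the series t and t w_i are equal to their truncations *)
Let AF_base (i : 'I_k.+1) : AF (lshift s (widen_ord kn i)) = y (lshift s (widen_ord kn i)).
Proof.
rewrite /AF /sc /series_coord join_coordl xi_chart /chart_series /trunc_eval.
have tE d : fcoef (fpsC S (chart_coef K i) * fpsX S) d = if d == 1%N then chart_coef K i else 0.
  by rewrite fcoefCM fcoefX; case: (d == 1%N); rewrite ?mulr1 ?mulr0.
have M1 : (1 < M.+1)%N by [].
rewrite (eq_bigr (fun d : 'I_M.+1 => if d == 1%N :> nat
    then V 0%N * mmap iota (fun l : 'I_k => V l.+1) (chart_coef K i) else 0)) => [|d _]; last first.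
  by rewrite tE; case: eqP => [->|_]; rewrite ?expr1 // mmap0 mulr0.
rewrite (bigD1 (Ordinal M1)) //= big1 ?addr0 => [|d d1]; last first.
  by case: eqP => // dE; case/eqP: d1; exact: val_inj.
case: (unliftP ord0 i) => [l ->|->].
  rewrite chart_coefS mmapXU /= mulrC divfK //.
  by congr (y (lshift s (widen_ord kn _))); apply: val_inj; rewrite /= inordK // ltnS.
by rewrite chart_coef0 rmorph1 mulr1.
Qed.

(* both p(y) and q(y) are leading monomials times polynomials that do not vanish at
   the origin of the chart, and the monomial of q divides that of p *)
Let chart_member p q d m c d' m' c' :
  mmap iota y q != 0 ->
  leading (series_hom p) (expo d m) c -> leading (series_hom q) (expo d' m') c' ->
  (forall l, mexp d m l < M)%N -> (forall l, mexp d' m' l < M)%N ->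
  lexnneg (expo d m - expo d' m') ->
  exists2 sg, mcst sg != 0 & exists r, mmap iota y p / mmap iota y q * mmap iota Y sg = mmap iota Y r.
Proof.
move=> q0 lp lq pM qM pq.
pose I (h : E) := mcst h = 0.
have I0 : I 0 by rewrite /I mcoeff0.
have ID h h' : I h -> I h' -> I (h + h') by rewrite /I mcoeffD => -> ->; rewrite addr0.
have Iw i h : (i <= k)%N -> I (W i * h).
  by rewrite /I rmorphM /= mcoeffX mnm1_eq0 mul0r.
have [zp Ep] := H_expand p; have [zq Eq] := H_expand q.
have [hp hp0 Hp] := trunc_eval_leading (@mpolyC _ K) M0 zp I0 ID Iw lp pM.
have [hq hq0 Hq] := trunc_eval_leading (@mpolyC _ K) M0 zq I0 ID Iw lq qM.
have [z Ez] : exists z, \prod_(l < k.+1) VE l ^+ mexp d m l =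
    (\prod_(l < k.+1) VE l ^+ mexp d' m' l) * z.
  case: pq => [/eqP|pq].
    by rewrite subr_eq0 => /eqP/expo_inj[-> ->]; exists 1; rewrite mulr1.
  by have [i [z Ez]] := toric_lexpos W M0 qM pq; exists (W i * z).
exists (mC c' + hq); first by rewrite mcoeffD mcoeffC eqxx mulr1 hq0 addr0; case: lq.
exists (z * (mC c + hp)).
have pE : mmap iota y p = mmap iota Y (\prod_(l < k.+1) VE l ^+ mexp d' m' l) *
    mmap iota Y (z * (mC c + hp)).
  by rewrite -HY Ep Hp -mmapM mulrA -Ez.
have qE : mmap iota y q = mmap iota Y (\prod_(l < k.+1) VE l ^+ mexp d' m' l) *
    mmap iota Y (mC c' + hq).
  by rewrite -HY Eq Hq -mmapM.
move: q0; rewrite qE mulf_eq0 negb_or => /andP[m0 u0].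
by rewrite pE -mulf_div divff // mul1r divfK.
Qed.

(** The equations are [y_l - A_l = 0] for the [k.+1] coordinates that agree with their
    truncations, and the equations [f], divided by [V_0^M]. In the coordinates
    [(y_l - A_l) / V_0^M] their Jacobian matrix is triangular, since [dH] shows that
    [f] has the same derivatives there as at the center of [y]. *)
Lemma chart_uniformization (t : seq F) : (forall a, a \in t -> presented M a) ->
  exists (m' : nat) (y' : 'I_m' -> F), [/\ generates iota y', centered series_place y',
    center_smooth series_place y' & {in t, forall a, exists p, a = mmap iota y' p}].
Proof.
move=> tM; have tP a : a \in t -> exists2 sg : E, mcst sg != 0 &
    exists p, a * mmap iota Y sg = mmap iota Y p.
  move=> /tM[->|[p [q [d [m [c [d' [m' [c' [[q0 ->] [lp lq] pM qM pq]]]]]]]]]].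
    by exists 1; [rewrite mcoeff1 eqxx oner_neq0 | exists 0; rewrite mul0r rmorph0].
  exact: chart_member q0 lp lq pM qM pq.
have [sg [sg0 Hsg]] : exists sg : E, mcst sg != 0 /\
    forall a, a \in t -> exists p, a * mmap iota Y sg = mmap iota Y p.
  elim: t {tM} tP => [|a t IH] tP; first by exists 1; rewrite mcoeff1 eqxx oner_neq0.
  have [sg [sg0 Hsg]] := IH (fun b bt => tP b (mem_behead (s := a :: t) bt)).
  have [sa sa0 [pa Ea]] := tP a (mem_head _ _).
  exists (sa * sg); split; first by rewrite rmorphM mulf_neq0.
  move=> b; rewrite inE => /orP[/eqP->|/Hsg[p Eb]].
    by exists (pa * sg); rewrite !mmapM mulrA Ea.
  by exists (p * sa); rewrite !mmapM mulrCA Eb mulrC.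
have [f' Hf'] := f_chart.
pose g : 'I_(k.+1 + s) -> E := join_coord
  (fun i => mX (rshift k.+1 (lshift s (widen_ord kn i)))) f'.
have dims : (n + (k.+1 + s))%N = (k.+1 + (n + s))%N by rewrite addnCA.
apply: (chart_smooth (g := g) trdeg_n dims Y_gen Y_place _ _ sg0 Hsg).
  move=> i; case: (split_ordP i) => l ->; rewrite /g ?join_coordl ?join_coordr.
    by rewrite mmapXU /Y join_coordr AF_base subrr mul0r.
  have := congr1 (mmap iota Y) (Hf' l); rewrite HY fy mmapM => /esym/eqP.
  by rewrite mulf_eq0 rmorphXn /= VY // expf_eq0 (negPf V0n0) andbF => /eqP.
apply: inj_row_free => u uJ; set J := \matrix_(_, _) _ in uJ.
have uJE l : \sum_i u 0 i * J i l = 0 by have /rowP/(_ l) := uJ; rewrite !mxE.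
have Jl i l : J (lshift s i) (rshift k.+1 l) = (lshift s (widen_ord kn i) == l)%:R.
  by rewrite mxE /g join_coordl mderiv_mX eq_rshift mcoeffC eqxx mulr1.
have Jr j l : J (rshift k.+1 j) (rshift k.+1 l) = mcst (mderiv l (f j)).
  rewrite mxE /g join_coordr -[RHS]H_cst; congr (mcst _).
  apply: (mulfI (expf_neq0 M VE0)); rewrite -dH Hf' mderivM.
  by rewrite eVM de mul0r add0r.
have ur j : u 0 (rshift k.+1 j) = 0.
  have := uJE (rshift k.+1 (rshift n j)); rewrite big_split_ord /= big1 => [|i _].
    rewrite add0r (bigD1 j) //= big1 => [|j' jj'].
      by rewrite addr0 Jr (proj2 Hf) eqxx mulr1.
    by rewrite Jr (proj2 Hf) (negPf jj') mulr0.
  by rewrite Jl eq_lrshift mulr0.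
apply/rowP => i; rewrite [RHS]mxE; case: (split_ordP i) => l -> //.
have := uJE (rshift k.+1 (lshift s (widen_ord kn l))).
rewrite big_split_ord /= [X in _ + X]big1 => [|j _]; last by rewrite ur mul0r.
rewrite addr0 (bigD1 l) //= big1 => [|l' ll'].
  by rewrite addr0 Jl eqxx mulr1.
by rewrite Jl eq_lshift -val_eqE /= val_eqE (negPf ll') mulr0.
Qed.

End Chart.

(** Finitely many members of the valuation ring have finitely many leading
    exponents, and [M] is chosen above all their entries. *)
Theorem series_place_uniformization : smooth_local_uniformization series_place.
Proof.
move=> t tO.
have bound d (m : multinom k) : exists B, forall l, (mexp d m l < B)%N.
  exists (d + mdeg m).+1; case=> [|l] /=; first by rewrite ltnS leq_addr.
  case: insubP => [i _ _|_] //; rewrite ltnS (leq_trans _ (leq_addl _ _)) //.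
  by rewrite mdegE (bigD1 i) //= leq_addr.
have presentedW B B' a : (B <= B')%N -> presented B a -> presented B' a.
  move=> leBB [->|[p [q [d [m [c [d' [m' [c' [qa l pB qB pq]]]]]]]]]]; first by left.
  right; exists p, q, d, m, c, d', m', c'; split=> // i; exact: leq_trans leBB.
have presented_ex a : place_ring series_place a -> exists B, presented B a.
  move/lex_place_ring => [->|va]; first by exists 0%N; left.
  have [->|a0] := eqVneq a 0; first by exists 0%N; left.
  have [p [q [q0 aE]]] := gen_y a.
  have p0 : mmap iota y p != 0 by apply: contraNneq a0 => p0; rewrite aE p0 mul0r.
  have [c lp] := leading_fval gen_y theta_eq0 thetaC p0.
  have [c' lq] := leading_fval gen_y theta_eq0 thetaC q0.
  have vE : v a = v (mmap iota y p) - v (mmap iota y q).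
    by rewrite aE vM ?invr_eq0 // vV.
  have [_ _ [d [m [Ep _]]]] := lp; have [_ _ [d' [m' [Eq _]]]] := lq.
  have [B pB] := bound d m; have [B' qB'] := bound d' m'.
  exists (maxn B B'); right; exists p, q, d, m, c, d', m', c'; split=> //.
  - by split; rewrite ?Ep ?Eq.
  - by move=> l; rewrite leq_max pB.
  - by move=> l; rewrite leq_max qB' orbT.
  - by rewrite Ep Eq -vE.
have [B tB] : exists B, forall a, a \in t -> presented B a.
  elim: t tO => [|a t IH] tO; first by exists 0%N.
  have [B tB] := IH (fun b bt => tO b (mem_behead (s := a :: t) bt)).
  have [B' aB'] := presented_ex a (tO a (mem_head _ _)).
  exists (maxn B B') => b; rewrite inE => /orP[/eqP->|/tB bB].
    by apply: presentedW aB'; rewrite leq_maxr.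
  by apply: presentedW bB; rewrite leq_maxl.
apply: (@chart_uniformization B.+1) => // a /tB; exact: presentedW.
Qed.

End SeriesPlace.

(** * Coordinates centered at the origin, in solved form *)

Section Normalization.
Variables (K F : fieldType) (iota : {rmorphism K -> F}) (P : place iota).
Hypothesis ratP : rational P.

(** As P is rational its center has coordinates [c i] in [K], and the Jacobian matrix
    there is defined over [K]. Choose [s] independent columns of it, [s] being its
    rank; the corresponding coordinates become the last ones, and combining the
    equations by a one-sided inverse turns the square part of the Jacobian matrix
    into the identity. *)
Lemma solved_coordinates m (y0 : 'I_m -> F) n r (f0 : 'I_r -> mpoly m K) :
  generates iota y0 -> centered P y0 -> (forall i, mmap iota y0 (f0 i) = 0) ->
  (\rank (\matrix_(i < r, j < m) mmap (residue_emb P) (Defs.center P y0) (mderiv j (f0 i))) + n)%N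
    = m ->
  exists (s : nat) (y : 'I_(n + s) -> F) (f : 'I_s -> mpoly (n + s) K),
    [/\ generates iota y, forall l, P (y l) = Some 0,
        solvable_system f, forall l, mmap iota y (f l) = 0 &
        exists (pi : 'I_m -> 'I_(n + s)) (c : 'I_m -> K),
          forall i, y0 i = y (pi i) + iota (c i)].
Proof.
move=> gen_y0 Oy0 fy0; set J := \matrix_(_, _) _ => rkJ.
have /boolp.choice[c cE] : forall i, exists c, residue_emb P c = Defs.center P y0 i.
  by move=> i; exact: ratP.
have Py0 i : P (y0 i) = Some (residue_emb P (c i)).
  by rewrite cE /Defs.center; have := Oy0 i; rewrite /place_ring /=; case: (P (y0 i)).
pose ev := mmap (idfun : {rmorphism K -> K}) c.
have evE p : residue_emb P (ev p) = mmap (residue_emb P) (Defs.center P y0) p.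
  by rewrite rmorph_mmap; apply: eq_mmap.
pose J0 := \matrix_(l < m, i < r) ev (mderiv l (f0 i)).
have JE : J = (map_mx (residue_emb P) J0)^T by apply/matrixP => i l; rewrite !mxE evE.
pose s := \rank J0.
have {}rkJ : (s + n)%N = m by rewrite -rkJ JE mxrank_tr mxrank_map.
pose kap : 'I_s -> 'I_m := maxrankfun J0.
have kap_inj : injective kap by exact: maxrankfun_inj.
pose T := [set l | l \notin codom kap]%SET.
have cT : #|T| = n.
  have -> : T = ~: [set l in codom kap]%SET by apply/setP => l; rewrite !inE.
  rewrite cardsCs finset.setCK card_ord cardsE (card_codom kap_inj) card_ord -rkJ.
  by rewrite addnC addnK.
pose e : 'I_(n + s) -> 'I_m := join_coord (fun i => enum_val (cast_ord (esym cT) i)) kap.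
have e_inj : injective e.
  move=> i j; rewrite /e; case: (split_ordP i) => a ->; case: (split_ordP j) => b ->;
    rewrite ?join_coordl ?join_coordr.
  - by move/enum_val_inj/cast_ord_inj ->.
  - move=> E; have := enum_valP (cast_ord (esym cT) a).
    by rewrite E inE codom_f.
  - move=> E; have := enum_valP (cast_ord (esym cT) b).
    by rewrite -E inE codom_f.
  - by move/kap_inj ->.
have [pi eK piK] : bijective e.
  by apply: inj_card_bij e_inj _; rewrite !card_ord -rkJ addnC.
pose y i := y0 (e i) - iota (c (e i)).
have y0E i : y0 i = y (pi i) + iota (c i) by rewrite /y piK subrK.
have Py l : P (y l) = Some 0.
  have := placeD (Py0 (e l)) (place_emb P (- c (e l))).
  by rewrite !rmorphN subrr.
pose C := pinvmx (rowsub kap J0).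
have JC : rowsub kap J0 *m C = 1%:M by apply: mulmxVp; exact: maxrowsub_free.
(* the rows of J0 are the columns of J, so C combines the equations *)
pose h j : mpoly m K := \sum_i mC (C i j) * f0 i.
pose H : mpoly m K -> mpoly (n + s) K := mmap (@mpolyC _ K) (fun i => mX (pi i) + mC (c i)).
have HY p : mmap iota y (H p) = mmap iota y0 p.
  rewrite mmap_mmap; apply: eq_mmap => // i.
  by rewrite mmapD mmapXU mmapC -y0E.
have Hcst p : mcst (H p) = ev p.
  rewrite [LHS]rmorph_mmap; apply: eq_mmap => [a|i] /=.
    by rewrite mcoeffC eqxx mulr1.
  by rewrite mcoeffD mcoeffX mnm1_eq0 add0r mcoeffC eqxx mulr1.
have hy j : mmap iota y0 (h j) = 0.
  by rewrite rmorph_sum big1 // => i _; rewrite /= mmapM fy0 mulr0.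
exists s, y, (fun j => H (h j)); split=> //.
- by move=> a; have [p [q [q0 ->]]] := gen_y0 a; exists (H p), (H q); rewrite !HY.
- split=> [j|j l].
    rewrite Hcst; apply: (fmorph_inj (residue_emb P)); rewrite rmorph0 rmorph_mmap.
    by have := place_mmap (h j) Py0; rewrite hy place0 => -[->].
  have -> : mderiv (rshift n l) (H (h j)) = H (mderiv (kap l) (h j)).
    rewrite [LHS]mderiv_mmap (bigD1 (kap l)) //= [X in _ + X]big1 => [|i il].
      have -> : pi (kap l) = rshift n l.
        by rewrite -[RHS]eK /e join_coordr.
      by rewrite mderivD mderivC mderiv_mX eqxx /= mulr1n mpolyC1 !addr0 mulr1.
    rewrite mderivD mderivC mderiv_mX -(inj_eq e_inj) piK /e join_coordr.
    by rewrite (negPf il) /= mulr0n mpolyC0 addr0 mulr0.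
  have /matrixP/(_ l j) := JC; rewrite !mxE eq_sym => <-.
  rewrite Hcst /h linear_sum /= /ev rmorph_sum; apply: eq_bigr => i _.
  by rewrite !mxE mderivM mderivC mul0r add0r /= mmapM mmapC mulrC.
- by move=> j; rewrite HY hy.
by exists pi, c.
Qed.

End Normalization.

(** * Density *)

Section Approximation.
Variables (K F : fieldType) (iota : {rmorphism K -> F}).

Lemma has_trdeg_uniq n m : has_trdeg iota n -> has_trdeg iota m -> n = m.
Proof.
move=> [[x xi] n_max] [[z zi] m_max]; apply/eqP; rewrite eqn_leq.
by rewrite (m_max _ x xi) (n_max _ z zi).
Qed.

Lemma has_trdeg_dependent n (u : 'I_n.+1 -> F) : has_trdeg iota n ->
  exists2 R : mpoly n.+1 K, R != 0 & mmap iota u R = 0.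
Proof.
move=> [_ n_max]; apply: contrapT => nR.
suff : alg_independent iota u by move/n_max; rewrite ltnn.
move=> p pu; apply: contrapT => /eqP p0; apply: nR.
by exists p.
Qed.

Variables (n k : nat) (kn : (k < n)%N) (xi : 'I_n -> fps (mpoly k K)).
Hypothesis trdeg_n : has_trdeg iota n.
Hypothesis Hxi : forall i, tdvd 1 (xi i).
Hypothesis xi_chart : forall i : 'I_k.+1, xi (widen_ord kn i) = chart_series K i.
Hypothesis xi_ind : forall p, mmap (fpsC (mpoly k K) \o @mpolyC k K) xi p = 0 -> p = 0.

(** The new place has the center of [P] on the chosen model, hence the same residues
    on the coordinate ring, which contains the members of [a] and [b]. *)
Lemma place_approximation (P : place iota) (a b : seq F) :
  rational P -> smooth_local_uniformization P ->
  {in a, forall x, place_ring P x} -> {in b, forall x, place_ideal P x} ->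
  exists Q : place iota, [/\ rational Q /\ smooth_local_uniformization Q,
    k = 0%N -> discrete Q, rank_is Q k.+1,
    {in a, forall x, place_ring Q x} & {in b, forall x, place_ideal Q x}].
Proof.
move=> ratP smP aP bP.
have abP : {in a ++ b, forall x, place_ring P x}.
  move=> x; rewrite mem_cat => /orP[/aP//|/bP]; rewrite /place_ideal /place_ring /=.
  by move=> ->.
have [m [y0 [gen_y0 Oy0 [n' [r [f0 [trdeg_n' f0y rkJ]]]] aby]]] := smP _ abP.
rewrite -(has_trdeg_uniq trdeg_n trdeg_n') in rkJ.
have [s [y [f [gen_y Py Hf fy [pi [c y0E]]]]]] := solved_coordinates ratP gen_y0 Oy0 f0y rkJ.
have aug p : mcst p != 0 -> mmap iota y p != 0.
  apply: contra => /eqP py; have := place_mmap p Py.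
  by rewrite py place0 mcst_mmap // => -[/esym/eqP]; rewrite fmorph_eq0.
have [[w w_ind] _] := trdeg_n.
have theta_eq0 p : series_hom f xi p = 0 <-> mmap iota y p = 0.
  apply: (series_eval_eq0 Hf fy aug gen_y w_ind _ p Hxi xi_ind) => u.
  exact: has_trdeg_dependent.
have [Q [srQ dQ rQ Qy]] : exists Q : place iota,
    [/\ rational Q /\ smooth_local_uniformization Q, k = 0%N -> discrete Q, rank_is Q k.+1 &
        forall l, Q (y l) = Some 0].
  exists (series_place gen_y theta_eq0); split.
  - split; first exact: series_place_rational.
    exact: (series_place_uniformization Hf fy trdeg_n Hxi xi_chart).
  - exact: (series_place_discrete gen_y xi_chart theta_eq0).
  - exact: (series_place_rank gen_y xi_chart theta_eq0).
  - exact: (series_place_center Hf gen_y Hxi xi_chart theta_eq0).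
have val_y0 (R : place iota) p : (forall l, R (y l) = Some 0) ->
    R (mmap iota y0 p) = Some (residue_emb R (mmap (idfun : {rmorphism K -> K}) c p)).
  move=> Ry; have Ry0 i : R (y0 i) = Some (residue_emb R (c i)).
    by rewrite y0E (placeD (Ry _) (place_emb R (c i))) add0r.
  by rewrite (place_mmap p Ry0) rmorph_mmap.
exists Q; split=> // x.
- move=> xa; have [|p ->] := aby x; first by rewrite mem_cat xa.
  by rewrite /place_ring /= val_y0.
- move=> xb; have [|p xE] := aby x; first by rewrite mem_cat xb orbT.
  have := bP x xb; rewrite /place_ideal /= xE !val_y0 // => -[/eqP].
  by rewrite fmorph_eq0 => /eqP ->; rewrite rmorph0.
Qed.

End Approximation.

Lemma dense_in_smooth (K F : fieldType) (iota : {rmorphism K -> F})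
    (C : place iota -> Prop) :
  (forall (P : place iota) (a b : seq F),
    rational P -> smooth_local_uniformization P ->
    {in a, forall x, place_ring P x} -> {in b, forall x, place_ideal P x} ->
    exists Q : place iota, [/\ rational Q /\ smooth_local_uniformization Q, C Q,
      {in a, forall x, place_ring Q x} & {in b, forall x, place_ideal Q x}]) ->
  dense_in (smooth_rational_places iota) (classes_of C).
Proof.
move=> approx O [x Ox] [U [D _ <-] UO]; move: Ox; rewrite -UO => -[[a b] Dab abx].
have [P [ratP smP] Px] := set_valP x.
have [P' [aP' bP'] P'x] := abx.
have PP' : place_class P = place_class P' by rewrite Px P'x.
have aP : {in a, forall z, place_ring P z} by rewrite (place_class_ring PP').
have bP : {in b, forall z, place_ideal P z} by rewrite (place_class_ideal PP').
have [Q [srQ CQ aQ bQ]] := approx P a b ratP smP aP bP.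
have sQ : smooth_rational_places iota (place_class Q) by exists Q.
exists (SigSub (mem_set sQ)); split; last by exists Q.
by exists (a, b) => //; exists Q.
Qed.

Theorem theorem13 (K F : fieldType) (iota : {rmorphism K -> F}) :
  function_field iota ->
  dense_in (smooth_rational_places iota) (rational_discrete_places iota) /\
  dense_in (smooth_rational_places iota) (rational_maxrank_places iota).
Proof.
move=> [_ [[//|n] _ trdeg_n]]; split; apply: dense_in_smooth => P a b ratP smP aP bP.
- have xi_chart (i : 'I_1) : lacunary_series (mpoly 0 K) (widen_ord (ltn0Sn n) i) =
      chart_series K i.
    rewrite (ord1 i); have -> : widen_ord (ltn0Sn n) ord0 = ord0 by exact: val_inj.
    by rewrite lacunary_series0 /chart_series chart_coef0 rmorph1 mul1r.
  have [Q [srQ dQ _ aQ bQ]] := place_approximation trdeg_n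
    (@lacunary_series1 _ n) xi_chart (@lacunary_series_independent _ _ _ n) ratP smP aP bP.
  by exists Q; split=> //; split; [case: srQ | exact: dQ].
have xi_chart (i : 'I_n.+1) : chart_series K (widen_ord (ltnSn n) i) = chart_series K i.
  by congr (chart_series K _); exact: val_inj.
have [Q [srQ _ rQ aQ bQ]] := place_approximation trdeg_n (@chart_series1 K n) xi_chart
  (@chart_series_independent K n) ratP smP aP bP.
by exists Q; split=> //; split; [case: srQ | exists n.+1].
Qed.
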